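(* Let $E\to B$ be a real vector bundle of rank $d\geq 1$ over a compact triangulable space $B$ and let $0<\epsilon\leq3/8$. There exist a triangulation $K$ of $B$ (a simplicial complex $K$ with a homeomorphism $|K|\cong B$) and a discrete $\epsilon$-approximate cocycle $\Omega\in\mathsf{DZ}^1_\epsilon(K;O(d))$ such that $\pi_*(\mathsf{cl}(\Omega))\in[B,\mathsf{Gr}(d)]$ represents the vector bundle $E\to B$ (up to isomorphism).
   Context: $\|A\|=\sqrt{\mathrm{tr}(A^tA)}$ is the Frobenius norm. $[X,Y]$ is the set of homotopy classes of continuous maps. $\mathsf{Gr}(d,n)=\{A\in\mathbb{R}^{n\times n}: A=A^t=A^2,\ \mathrm{rank}\,A=d\}$, and $\mathsf V(d,n)$ is the set of real $n\times d$ matrices with orthonormal columns. $\mathsf{Gr}(d)$, $\mathsf V(d)$, $\mathbb{R}^{\infty\times\infty}$ are the unions over $n$ of $\mathsf{Gr}(d,n)$, $\mathsf V(d,n)$, $\mathbb{R}^{n\times n}$ (padding by zeros), with the direct limit topology. For $\epsilon>0$, $\mathsf{Gr}(d)^\epsilon\subseteq\mathbb{R}^{\infty\times\infty}$ is the set of matrices at Frobenius distance $<\epsilon$ from some element of $\mathsf{Gr}(d)$. If $\epsilon\leq\sqrt2/2$, every $A\in\mathsf{Gr}(d)^\epsilon$ has a unique Frobenius-closest point $\pi(A)\in\mathsf{Gr}(d)$, $\pi$ is a homotopy inverse of the inclusion $\mathsf{Gr}(d)\subseteq\mathsf{Gr}(d)^\epsilon$, and $\pi_*:[B,\mathsf{Gr}(d)^\epsilon]\to[B,\mathsf{Gr}(d)]$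 is the induced bijection. A homotopy class $[f]\in[B,\mathsf{Gr}(d)]$ represents the vector bundle over $B$ whose fiber at $y$ is the image of the projection $f(y)$. Discrete approximate cocycles. For a simplicial complex $K$, an element of $\mathsf{DZ}^1_\epsilon(K;O(d))$ is a family of orthogonal matrices $\{\Omega_{ij}\in O(d)\}$ indexed by the ordered $1$-simplices $(ij)$ of $K$, with $\Omega_{ij}=\Omega_{ji}^t$ and $\|\Omega_{ij}\Omega_{jk}-\Omega_{ik}\|<\epsilon$ for every ordered $2$-simplex $(ijk)$ of $K$ (with the convention $\Omega_{ii}=\mathrm{id}$). Let $\mathrm{st}(i)\subseteq|K|$ be the open star of the vertex $i$; the open stars form an open cover of $|K|$ whose nerve is $K$. A discrete approximate cocycle is regarded as the family of constant maps $\Omega_{ij}:\mathrm{st}(j)\cap\mathrm{st}(i)\to O(d)$. Construction of $\mathsf{cl}$ (for $K$ with countably many vertices and $|K|$ paracompact). Choose a partition of unity $\phi=\{\phi_i\}$ subordinate to the star cover and an injection $\iota$ from the vertices of $K$ to $\{1,2,\dots\}$. For $\Omega\in\mathsf{DZ}^1_\epsilon(K;O(d))$ define $\Phi_i:\mathrm{st}(i)\to\mathsf V(d)$ by declaring, for each vertex $j$, the rows of $\Phi_i(y)$ from $d\,\iota(j)$ to $d(\iota(j)+1)-1$ to be $\sqrt{\phi_j(y)}\,\Omega_{ij}^t$ (zero if $y\notin\mathrm{st}(j)$), all other rows zero. Then $\mathsf{cl}(\Omega)\in[|K|,\mathsf{Gr}(d)^{\sqrt2\epsilon}]$ is the homotopy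 class of $y\mapsto\sum_{i}\phi_i(y)\,\Phi_i(y)\Phi_i(y)^t$; it does not depend on the choice of $\phi$ and $\iota$. *)

(* Defs.v *)
From HB Require Import structures.
From mathcomp Require Import all_boot all_order all_algebra finmap.
From mathcomp Require Import all_classical all_reals all_analysis.

Set Implicit Arguments.
Unset Strict Implicit.
Unset Printing Implicit Defensive.

Import Order.TTheory GRing.Theory Num.Theory.
Import numFieldNormedType.Exports.

Local Open Scope classical_set_scope.
Local Open Scope ring_scope.

(** [U] is open iff all its preimages by the [f i] are; for the increasing unions
    below this is the direct limit topology. *)
Definition final_topology (I : Type) (X : I -> topologicalType)
  (T : choiceType) (f : forall i, X i -> T) : Type := T.

Section FinalTopology.
Context (I : Type) (X : I -> topologicalType) (T : choiceType).
Variable f : forall i, X i -> T.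
Local Notation FT := (final_topology f).

Definition final_open (U : set FT) : Prop := 
  forall i, open [set x : X i | U (f x)].

Lemma final_openT : final_open setT.
Proof. by move=> i; exact: openT. Qed.

Lemma final_openI : setI_closed final_open.
Proof. by move=> A B oA oB i; exact: openI. Qed.

Lemma final_open_bigU (J : Type) (F : J -> set FT) :
  (forall j, final_open (F j)) -> final_open (\bigcup_j F j).
Proof.
move=> oF i.
rewrite (_ : [set x | _] = \bigcup_j [set x | F j (f x)]) //.
by apply: bigcup_open => j _; exact: oF.
Qed.

HB.instance Definition _ := Choice.copy FT T.
HB.instance Definition _ :=
  isOpenTopological.Build FT final_openT final_openI final_open_bigU.
End FinalTopology.

Definition homeomorphism (X Y : topologicalType) (h : X -> Y) : Prop :=
  continuous h /\
  exists k : Y -> X, [/\ continuous k, cancel h k & cancel k h].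

Section HomotopyClasses.
Context (R : realType).

Definition homotopic (X Y : topologicalType) (f g : X -> Y) : Prop :=
  exists H : X * R -> Y,
    [/\ {within [set: X] `*` `[0, 1], continuous H},
        forall x, H (x, 0) = f x & forall x, H (x, 1) = g x].

(** An element of [X, Y] is represented by the set of all maps in the class. *)
Definition hclass (X Y : topologicalType) (f : X -> Y) : set (X -> Y) :=
  [set g | continuous g /\ homotopic f g].

(** On an actual homotopy class [c] these are the induced maps
    [X, Y] -> [X, Z] and [X, Y] -> [W, Y]. *)
Definition hpush (X Y Z : topologicalType) (p : Y -> Z) (c : set (X -> Y)) :
  set (X -> Z) := \bigcup_(f in c) hclass (p \o f).
Definition hpull (W X Y : topologicalType) (h : W -> X) (c : set (X -> Y)) :
  set (W -> Y) := \bigcup_(f in c) hclass (f \o h).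
End HomotopyClasses.

Section FinitelySupported.
Context (R : realType) (T : Type).

Definition finsupp_pred : {pred T -> R} :=
  mem [set x : T -> R | finite_set [set t | x t != 0]].

Record fsarray := FSArray {
  fsarray_val :> T -> R;
  fsarrayP : fsarray_val \in finsupp_pred }.

HB.instance Definition _ := [isSub for fsarray_val].
HB.instance Definition _ := [Choice of fsarray by <:].

Lemma finsupp_submod_closed : submod_closed finsupp_pred.
Proof.
split=> [|c x y]; rewrite !inE /=.
  by rewrite [X in finite_set X](_ : _ = set0) // -subset0 => t /= /eqP.
move=> fx fy.
apply: (@sub_finite_set _ _ ([set t | x t != 0] `|` [set t | y t != 0])).
  move=> t /=; rewrite -[(c *: x + y) t]/(c *: x t + y t).
  have [->|//] := eqVneq (x t) 0; last by left.
  by rewrite scaler0 add0r; right.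
by rewrite finite_setU.
Qed.

HB.instance Definition _ :=
  GRing.isSubmodClosed.Build R (T -> R) finsupp_pred finsupp_submod_closed.
HB.instance Definition _ := [SubChoice_isSubLmodule of fsarray by <:].
End FinitelySupported.

Section InfiniteMatrices.
Context (R : realType).

Definition pad_vec_fun n (x : 'cV[R]_n) : nat -> R :=
  fun a => if (insub a : option 'I_n) is Some i then x i ord0 else 0.

Definition pad_mx_fun n (A : 'M[R]_n) : nat * nat -> R := fun p =>
  if ((insub p.1 : option 'I_n), (insub p.2 : option 'I_n)) is (Some i, Some j)
  then A i j else 0.

Lemma pad_vec_finsupp n (x : 'cV[R]_n) :
  pad_vec_fun x \in @finsupp_pred R nat.
Proof.
rewrite inE /=; apply: (@sub_finite_set _ _ `I_n); last exact: finite_II.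
move=> a /=; rewrite /pad_vec_fun; have [//|na] := ltnP a n.
by rewrite insubF ?eqxx // ltnNge na.
Qed.

Lemma pad_mx_finsupp n (A : 'M[R]_n) :
  pad_mx_fun A \in @finsupp_pred R (nat * nat)%type.
Proof.
rewrite inE /=; apply: (@sub_finite_set _ _ (`I_n `*` `I_n)).
  move=> [a b] /=; rewrite /pad_mx_fun /=.
  have [an|na] := ltnP a n; last by rewrite insubF ?eqxx // ltnNge na.
  have [//|nb] := ltnP b n.
  by case: insub => [i|]; rewrite ?(@insubF _ _ _ b) ?eqxx // ltnNge nb.
by apply: finite_setX; exact: finite_II.
Qed.

(** R^oo and R^(oo x oo), as unions over n of R^n and R^(n x n). *)
Definition Rinf : Type := fsarray R nat.
Definition Minf : Type := fsarray R (nat * nat).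

HB.instance Definition _ := GRing.Lmodule.on Rinf.
HB.instance Definition _ := GRing.Lmodule.on Minf.

Definition pad_vec n (x : 'cV[R]_n) : Rinf := FSArray (pad_vec_finsupp x).
Definition pad_mx n (A : 'M[R]_n) : Minf := FSArray (pad_mx_finsupp A).

HB.instance Definition _ := Topological.copy Rinf (final_topology pad_vec).
HB.instance Definition _ := Topological.copy Minf (final_topology pad_mx).

Definition frobenius m n (A : 'M[R]_(m, n)) : R := Num.sqrt (\tr (A^T *m A)).

(** [sqrt (tr (A^t A))], the product and the trace being written out. *)
Definition frobenius_inf (A : Minf) : R :=
  Num.sqrt (\sum_(b \in [set: nat]) \sum_(a \in [set: nat]) A (a, b) * A (a, b)).

(** The range of [A] as an operator on R^oo. *)
Definition image_inf (A : Minf) : {pred Rinf} :=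
  mem [set x : Rinf | exists z : Rinf,
    forall a, x a = \sum_(b \in [set: nat]) A (a, b) * z b].

Lemma image_inf_submod_closed (A : Minf) : submod_closed (image_inf A).
Proof.
split=> [|c x y]; rewrite !inE /=.
  by exists 0 => a; rewrite fsbig1 // => b _; rewrite mulr0.
move=> [u xu] [v yv]; have [w wE] : exists w : Rinf, forall b, w b = c * u b + v b.
  by exists (c *: u + v).
exists w => a.
have finP : finite_set ([set b | u b != 0] `|` [set b | v b != 0]).
  by rewrite finite_setU; split; [have := fsarrayP u|have := fsarrayP v];
    rewrite inE.
set P := _ `|` _ in finP.
have zP b : (setT `\` P) b -> u b = 0 /\ v b = 0.
  by move=> [_ /not_orP[/negP/negPn/eqP-> /negP/negPn/eqP->]].
have sumP (f : nat -> R) : (forall b, (setT `\` P) b -> f b = 0) ->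
    \sum_(b \in [set: nat]) A (a, b) * f b = \sum_(b \in P) A (a, b) * f b.
  move=> f0; apply/esym/fsbig_widen => // b Pb /=.
  by rewrite f0 ?mulr0.
rewrite -[LHS]/(c * x a + y a) xu yv.
rewrite !sumP => [|b /zP[u0 v0]|b /zP[]|b /zP[]] //; last first.
  by rewrite wE u0 v0 mulr0 addr0.
rewrite mulr_fsumr -fsbig_split //; apply: eq_fsbigr => b _ /=.
by rewrite wE mulrDr mulrCA.
Qed.

HB.instance Definition _ (A : Minf) :=
  GRing.isSubmodClosed.Build R Rinf (image_inf A) (image_inf_submod_closed A).

Record image_space (A : Minf) := ImageSpace {
  image_vec :> Rinf;
  image_vecP : image_vec \in image_inf A }.

HB.instance Definition _ (A : Minf) := [isSub for @image_vec A].
HB.instance Definition _ (A : Minf) := [Choice of image_space A by <:].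
HB.instance Definition _ (A : Minf) :=
  [SubChoice_isSubLmodule of image_space A by <:].
End InfiniteMatrices.

Section Grassmannians.
Context (R : realType).

Definition Grn (d n : nat) : set 'M[R]_n :=
  [set A | [/\ A^T = A, A *m A = A & \rank A = d]].

Record Gr (d : nat) := MkGr {
  Gr_val :> Minf R;
  Gr_valP : exists n, exists2 A : 'M[R]_n, Grn d A & Gr_val = pad_mx A }.

HB.instance Definition _ d := gen_eqMixin (Gr d).
HB.instance Definition _ d := gen_choiceMixin (Gr d).

Definition Gr_stage d n (A : Grn d (n := n)) : Gr d :=
  MkGr (ex_intro _ n (ex_intro2 _ _ (val A) (set_mem (valP A)) erefl)).

HB.instance Definition _ d :=
  Topological.copy (Gr d) (final_topology (@Gr_stage d)).

Lemma Grn1 d : Grn d (1%:M : 'M[R]_d).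
Proof. by split; rewrite ?trmx1 ?mulmx1 ?mxrank1. Qed.

HB.instance Definition _ d := isPointed.Build (Gr d)
  (MkGr (ex_intro _ d (ex_intro2 _ _ _ (Grn1 d) erefl))).

Definition thickening (d : nat) (e : R) : set (Minf R) :=
  [set A : Minf R | exists P : Gr d, frobenius_inf (A - Gr_val P) < e].

(** The Frobenius-closest point of [Gr d], which exists and is unique for
    [e <= sqrt 2 / 2]. *)
Definition closest (d : nat) (e : R) (A : thickening d e) : Gr d :=
  get [set P : Gr d | forall Q : Gr d,
    frobenius_inf (val A - Gr_val P) <= frobenius_inf (val A - Gr_val Q)].
End Grassmannians.

(** A continuous family of vector spaces over B: a total space over B together
    with a vector space structure on each fibre [bundle_proj @^-1` [set b]],
    transported from [fiber b] along the bijection [fiber_incl b]. *)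
Record vfamily (R : realType) (B : topologicalType) := VFamily {
  fiber : B -> lmodType R;
  total_space : topologicalType;
  bundle_proj : total_space -> B;
  fiber_incl : forall b, fiber b -> total_space;
  bundle_proj_continuous : continuous bundle_proj;
  fiber_incl_bij : forall b,
    set_bij [set: fiber b] (bundle_proj @^-1` [set b]) (@fiber_incl b) }.

Section VectorBundles.
Context (R : realType) (B : topologicalType).

(** [t] and [x |-> (bundle_proj x, c x)] are inverse homeomorphisms between
    [U * R^d] and [bundle_proj @^-1` U], and [t] is linear on fibres. *)
Definition local_trivialization (E : vfamily R B) (d : nat) (U : set B)
    (t : B * 'cV[R]_d -> total_space E) (c : total_space E -> 'cV[R]_d) : Prop :=
  [/\ {within U `*` [set: 'cV[R]_d], continuous t},
      {within @bundle_proj R B E @^-1` U, continuous c},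
      forall b v, U b -> c (t (b, v)) = v,
      forall x, U (bundle_proj x) -> t (bundle_proj x, c x) = x &
      forall b, U b -> exists L : {linear 'cV[R]_d -> fiber E b},
        forall v, t (b, v) = fiber_incl (L v)].

Record vbundle (d : nat) := VBundle {
  vbundle_family :> vfamily R B;
  vbundle_trivial : forall b, exists U t c,
    [/\ open U, U b & @local_trivialization vbundle_family d U t c] }.

Definition viso (E E' : vfamily R B) : Prop :=
  exists F : total_space E -> total_space E', homeomorphism F /\
    forall b, exists L : {linear fiber E b -> fiber E' b},
      forall v, F (fiber_incl v) = fiber_incl (L v).

Section ImageFamily.
Variables (d : nat) (f : B -> Gr R d).

(** The fibre at [y] is the image of the matrix [f y]; the total space is a
    subspace of [B * R^oo]. *)
Definition image_total : set (B * Rinf R) :=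
  [set p | p.2 \in image_inf (f p.1)].

Definition image_proj (p : image_total) : B := (val p).1.

Definition image_incl (b : B) (v : image_space (f b)) : image_total :=
  exist _ (b, image_vec v) (mem_set (image_vecP v : image_total (b, _))).

Lemma image_proj_continuous : continuous image_proj.
Proof.
move=> p; apply: (@continuous_comp image_total (B * Rinf R)%type B val fst).
  exact: initial_continuous.
exact: cvg_fst.
Qed.

Lemma image_incl_bij b :
  set_bij [set: image_space (f b)] (image_proj @^-1` [set b]) (@image_incl b).
Proof.
split=> [v _ //|v w _ _ [vw]|]; first exact: val_inj.
move=> [[b' x] bx] /= eb; rewrite /image_proj /= in eb; subst b'.
exists (ImageSpace (set_mem bx : x \in image_inf (f b))) => //.
exact: val_inj.
Qed.

Definition image_family : vfamily R B :=
  VFamily image_proj_continuous image_incl_bij.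
End ImageFamily.

Definition represents (d : nat) (c : set (B -> Gr R d)) (E : vfamily R B) :
  Prop :=
  exists f : B -> Gr R d,
    [/\ continuous f, c = hclass R f & viso (image_family f) E].
End VectorBundles.

Record simplicial_complex := SimplicialComplex {
  vertex : choiceType;
  face : set {fset vertex};
  face_vertex : forall v, face [fset v]%fset;
  face_nonempty : ~ face fset0;
  face_sub : forall s t : {fset vertex},
    face s -> (t `<=` s)%fset -> t != fset0 -> face t }.

Section Realization.
Context (R : realType) (K : simplicial_complex).

(** The closed geometric simplex on [s]; as its points vanish outside [s], the
    topology of pointwise convergence on it is the Euclidean one. *)
Definition simplex (s : {fset vertex K}) : set {ptws vertex K -> R} :=
  [set x | [/\ forall v, 0 <= x v, forall v, v \notin s -> x v = 0
             & \sum_(v <- s) x v = 1]].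

Record realization := MkReal {
  bary :> vertex K -> R;
  baryP : exists2 s, face s & simplex s bary }.

HB.instance Definition _ := gen_eqMixin realization.
HB.instance Definition _ := gen_choiceMixin realization.

Definition of_simplex (s : @face K) (x : simplex (val s)) : realization :=
  MkReal (ex_intro2 _ _ (val s) (set_mem (valP s)) (set_mem (valP x))).

HB.instance Definition _ :=
  Topological.copy realization (final_topology of_simplex).

(** The open star, i.e. the union of the open simplices having [v] as vertex. *)
Definition star (v : vertex K) : set realization := [set y | 0 < y v].

Definition subordinate_partition (phi : vertex K -> realization -> R) : Prop :=
  [/\ forall i, continuous (phi i),
      forall i y, 0 <= phi i y,
      forall y : realization, exists2 U : set realization, nbhs y U &
        finite_set [set i | exists2 z, U z & phi i z != 0],
      forall y, \sum_(i \in [set: vertex K]) phi i y = 1 &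
      forall i, closure [set y | phi i y != 0] `<=` star i].
End Realization.

Definition triangulation (R : realType) (B : topologicalType)
  (K : simplicial_complex) (h : B -> realization R K) : Prop := homeomorphism h.

Definition triangulable (R : realType) (B : topologicalType) : Prop :=
  exists (K : simplicial_complex) (h : B -> realization R K), triangulation h.

Section Cocycles.
Context (R : realType) (K : simplicial_complex) (d : nat) (e : R).

(** The values of [Om] at pairs which do not span a simplex are irrelevant. *)
Definition DZ1 : set (vertex K -> vertex K -> 'M[R]_d) :=
  [set Om | [/\ forall i, Om i i = 1%:M,
      forall i j, face [fset i; j]%fset ->
        (Om i j)^T *m Om i j = 1%:M /\ Om i j = (Om j i)^T &
      forall i j k, face [fset i; j; k]%fset ->
        frobenius (Om i j *m Om j k - Om i k) < e]].

Record cl_choice := ClChoice {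
  cl_phi : vertex K -> realization R K -> R;
  cl_iota : vertex K -> nat;
  cl_phiP : subordinate_partition cl_phi;
  cl_iota_inj : injective cl_iota;
  cl_iota_gt0 : forall v, (0 < cl_iota v)%N }.

Variables (ch : cl_choice) (Om : vertex K -> vertex K -> 'M[R]_d).

(** Row [r] (counted from 1) and column [l] of [Phi_i(y)]. The coefficient
    [cl_phi ch j y] vanishes for [y] outside the star of [j]. *)
Definition cl_frame (i : vertex K) (y : realization R K) (r : nat) (l : 'I_d) :
  R :=
  \sum_(j \in [set: vertex K])
    \sum_(k < d | r == (d * cl_iota ch j + k)%N)
      Num.sqrt (cl_phi ch j y) * (Om i j)^T k l.

(** The array [A (a, b)] is indexed from 0: its index [a] is row number a+1. *)
Definition cl_map (y : realization R K) : nat * nat -> R := fun p =>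
  \sum_(i \in [set: vertex K]) cl_phi ch i y *
    \sum_(l < d) cl_frame i y p.1.+1 l * cl_frame i y p.2.+1 l.

(** The homotopy class determined by [cl_map], seen as a map to the thickening of radius
    [sqrt 2 * e]. *)
Definition cl : set (realization R K -> thickening d (Num.sqrt 2 * e)) :=
  [set g | exists f : realization R K -> thickening d (Num.sqrt 2 * e),
    [/\ continuous f, forall y p, (val (f y) : Minf R) p = cl_map y p
      & hclass R f g]].
End Cocycles.

Arguments closest {R} d e A.
Arguments DZ1 {R} K d e.
Arguments cl {R K d} e ch Om.

(* Main.v *)
(** The bundle [E] embeds fibrewise into a trivial bundle, so it is the
    image of a continuous family [F] of orthogonal projections. On a sufficiently
    fine iterated barycentric subdivision [F] is almost constant on every closed
    star; orthonormal frames [V_i] of [F] at the vertices then have almost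
    orthogonal transitions [V_i^T V_j], and replacing these by nearby orthogonal
    matrices [Om i j] gives an approximate cocycle. For every choice of [phi] and
    [iota] the classifying matrix at [y] is close to each [Phi_i Phi_i^T], and
    stacking the maps [sqrt (phi_j y) V_j^T] sends the image of [F] injectively,
    and almost isometrically, to vectors close to the image of [Phi_i Phi_i^T].
    Composed with the closest projection this is an isomorphism from [E] to the
    image bundle. The closest-point map is continuous because a nearest projection
    [P] of a matrix [A] commutes with the symmetric part of [A], and the bound on
    the distance from [A] to [P] forces a spectral gap between the range and the
    kernel of [P]; this makes [P] unique and Lipschitz in [A]. *)

From HB Require Import structures.
Require Import Defs.
From mathcomp Require Import all_boot all_order all_algebra finmap.
From mathcomp Require Import all_classical all_reals all_analysis.
From mathcomp Require Import ring lra.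

Import Order.TTheory GRing.Theory Num.Theory.
Import numFieldNormedType.Exports.

Local Open Scope classical_set_scope.
Local Open Scope ring_scope.

Set Implicit Arguments.
Unset Strict Implicit.
Unset Printing Implicit Defensive.

(** * Frobenius inner product and orthogonal projections *)

(** The bound [3 / 8] serves the spectral gap: for the radius [r = Num.sqrt 2 * eps] it says
    [r * Num.sqrt 2 <= 3 / 4], and the missing [1 / 4] is the gap. One factor [sqrt 2] belongs to
    the thickening, the other to comparing the range of a projection with its kernel. The bundle
    comparison needs a smaller tolerance, so the cocycle is built for [e = Num.min eps (1 / 10)],
    while [eps] itself only sets the domain of the closest-point map. The direct limit topology is
    tested at each finite size. The obstacle is that a closest point could need more rows than the
    matrix it approximates; once this is excluded, all analysis takes place on matrices of one fixed
    size. The cocycle is chosen before [phi] and [iota], so the estimates can rely only on [phi_j]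
    vanishing off the star of [j]. Closed rather than open stars must be small because the embedding
    uses barycentric coordinates as weights, and their supports are the closed stars. *)

Section Frobenius.
Context {R : realType}.
Implicit Types m n p q : nat.

Definition fip m n (A B : 'M[R]_(m, n)) : R := \tr (A^T *m B).

Lemma fipE m n (A B : 'M[R]_(m, n)) : fip A B = \sum_i \sum_j A i j * B i j.
Proof.
rewrite /fip /mxtrace exchange_big /=; apply: eq_bigr => j _.
by rewrite mxE; apply: eq_bigr => i _; rewrite mxE.
Qed.

Lemma fipC m n (A B : 'M[R]_(m, n)) : fip A B = fip B A.
Proof. by rewrite !fipE; under eq_bigr do under eq_bigr do rewrite mulrC. Qed.

Lemma fipDr m n (A B C : 'M[R]_(m, n)) : fip A (B + C) = fip A B + fip A C.
Proof. by rewrite /fip mulmxDr mxtraceD. Qed.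

Lemma fipZr m n a (A B : 'M[R]_(m, n)) : fip A (a *: B) = a * fip A B.
Proof. by rewrite /fip -scalemxAr mxtraceZ. Qed.

Lemma fipNr m n (A B : 'M[R]_(m, n)) : fip A (- B) = - fip A B.
Proof. by rewrite -scaleN1r fipZr mulN1r. Qed.

Lemma fipBr m n (A B C : 'M[R]_(m, n)) : fip A (B - C) = fip A B - fip A C.
Proof. by rewrite fipDr fipNr. Qed.

Lemma fipDl m n (A B C : 'M[R]_(m, n)) : fip (A + B) C = fip A C + fip B C.
Proof. by rewrite fipC fipDr !(fipC C). Qed.

Lemma fipBl m n (A B C : 'M[R]_(m, n)) : fip (A - B) C = fip A C - fip B C.
Proof. by rewrite fipC fipBr !(fipC C). Qed.

Lemma fipZl m n a (A B : 'M[R]_(m, n)) : fip (a *: A) B = a * fip A B.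
Proof. by rewrite fipC fipZr fipC. Qed.

Lemma fip_ge0 m n (A : 'M[R]_(m, n)) : 0 <= fip A A.
Proof.
by rewrite fipE; do 2!apply: sumr_ge0 => ? _; rewrite -expr2 sqr_ge0.
Qed.

Lemma fip_eq0 m n (A : 'M[R]_(m, n)) : fip A A = 0 -> A = 0.
Proof.
rewrite fipE => A0; apply/matrixP => i j; rewrite mxE.
have sq0 k l : 0 <= A k l * A k l by rewrite -expr2 sqr_ge0.
have /(_ i isT) Ai0 := psumr_eq0P (fun k _ => sumr_ge0 _ (fun l _ => sq0 k l)) A0.
have /(_ j isT) /eqP := psumr_eq0P (fun l _ => sq0 i l) Ai0.
by rewrite mulf_eq0 orbb => /eqP.
Qed.

Lemma fip_tr m n (A B : 'M[R]_(m, n)) : fip A^T B^T = fip A B.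
Proof. by rewrite /fip trmxK mxtrace_mulC -mxtrace_tr trmx_mul trmxK. Qed.

Lemma fip_mull m n p (A : 'M[R]_(m, n)) (B : 'M[R]_(n, p)) C :
  fip (A *m B) C = fip B (A^T *m C).
Proof. by rewrite /fip trmx_mul mulmxA. Qed.

Lemma fip_mulr m n p (A : 'M[R]_(m, n)) (B : 'M[R]_(n, p)) C :
  fip (A *m B) C = fip A (C *m B^T).
Proof. by rewrite -fip_tr trmx_mul fip_mull trmxK -fip_tr trmx_mul !trmxK. Qed.

Lemma frob_ge0 m n (A : 'M[R]_(m, n)) : 0 <= frobenius A.
Proof. exact: sqrtr_ge0. Qed.

Lemma frob_sqr m n (A : 'M[R]_(m, n)) : frobenius A ^+ 2 = fip A A.
Proof. by rewrite sqr_sqrtr // fip_ge0. Qed.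

Lemma frob0 m n : frobenius (0 : 'M[R]_(m, n)) = 0.
Proof. by rewrite /frobenius mulmx0 mxtrace0 sqrtr0. Qed.

Lemma frob_eq0 m n (A : 'M[R]_(m, n)) : frobenius A = 0 -> A = 0.
Proof. by move=> A0; apply: fip_eq0; rewrite -frob_sqr A0 expr0n. Qed.

Lemma frob_gt0 m n (A : 'M[R]_(m, n)) : A != 0 -> 0 < frobenius A.
Proof.
by move=> A0; rewrite lt0r frob_ge0 andbT; apply: contra_neq A0 => /frob_eq0.
Qed.

Lemma frobN m n (A : 'M[R]_(m, n)) : frobenius (- A) = frobenius A.
Proof. by rewrite /frobenius -!/(fip _ _) fipNr fipC fipNr opprK. Qed.

Lemma frob_distC m n (A B : 'M[R]_(m, n)) : frobenius (A - B) = frobenius (B - A).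
Proof. by rewrite -frobN opprB. Qed.

Lemma frobZ m n a (A : 'M[R]_(m, n)) : frobenius (a *: A) = `|a| * frobenius A.
Proof.
by rewrite {1}/frobenius -/(fip _ _) fipZl fipZr mulrA -expr2 sqrtrM ?sqr_ge0 // sqrtr_sqr.
Qed.

Lemma frobT m n (A : 'M[R]_(m, n)) : frobenius A^T = frobenius A.
Proof. by rewrite /frobenius -!/(fip _ _) fip_tr. Qed.

(** Cauchy-Schwarz: with [a] and [b] the two norms, the squared norm of [b *: A - a *: B] equals
    [2 * a * b * (a * b - fip A B)]. *)
Lemma fip_le m n (A B : 'M[R]_(m, n)) : fip A B <= frobenius A * frobenius B.
Proof.
have [->|B0] := eqVneq B 0; first by rewrite /fip mulmx0 mxtrace0 frob0 mulr0.
have [->|A0] := eqVneq A 0.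
  by rewrite fipC /fip mulmx0 mxtrace0 frob0 mul0r.
have a0 := frob_gt0 A0; have b0 := frob_gt0 B0.
have := fip_ge0 (frobenius B *: A - frobenius A *: B).
rewrite !(fipBl, fipBr, fipZl, fipZr) -!frob_sqr (fipC B A).
move: a0 b0; move: (frobenius A) (frobenius B) (fip A B) => a b c a0 b0 h.
have h2 : 0 <= (a * b) * (a * b - c) by lra.
by move: h2; rewrite pmulr_rge0 ?mulr_gt0 // subr_ge0.
Qed.

Lemma frob_triangle m n (A B : 'M[R]_(m, n)) :
  frobenius (A + B) <= frobenius A + frobenius B.
Proof.
rewrite -(@ler_pXn2r _ 2) ?nnegrE ?addr_ge0 ?frob_ge0 // frob_sqr.
rewrite !(fipDl, fipDr) -!frob_sqr (fipC B A).
have := fip_le A B; move: (fip A B) (frobenius A) (frobenius B) => c a b; lra.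
Qed.

Lemma frobB_triangle m n (A B C : 'M[R]_(m, n)) :
  frobenius (A - C) <= frobenius (A - B) + frobenius (B - C).
Proof. by rewrite (le_trans _ (frob_triangle _ _)) // addrA subrK. Qed.

Lemma frobB_ge m n (A B : 'M[R]_(m, n)) :
  frobenius A - frobenius B <= frobenius (A - B).
Proof. by rewrite lerBlDr (le_trans _ (frob_triangle _ _)) // subrK. Qed.

Lemma frob_sum (I : Type) (r : seq I) (P : pred I) m n (A : I -> 'M[R]_(m, n)) :
  frobenius (\sum_(i <- r | P i) A i) <= \sum_(i <- r | P i) frobenius (A i).
Proof.
elim/big_rec2: _ => [|i x y _ xy]; first by rewrite frob0.
by rewrite (le_trans (frob_triangle _ _)) // lerD2l.
Qed.

Lemma frob_mul m n p (A : 'M[R]_(m, n)) (B : 'M[R]_(n, p)) :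
  frobenius (A *m B) <= frobenius A * frobenius B.
Proof.
have frobM k l (C : 'M[R]_(k, l)) : frobenius C ^+ 2 = \sum_i \sum_j C i j ^+ 2.
  by rewrite frob_sqr fipE.
rewrite -(@ler_pXn2r _ 2) ?nnegrE ?mulr_ge0 ?frob_ge0 // exprMn !frobM.
rewrite mulr_suml; apply: ler_sum => i _.
rewrite exchange_big /= mulr_sumr; apply: ler_sum => j _.
have := fip_le (row i A)^T (col j B).
(* Cauchy-Schwarz is one-sided here; the negated row supplies the lower bound needed to square the
   entry. *)
have := fip_le (- (row i A)^T) (col j B).
have -> : fip (- (row i A)^T) (col j B) = - fip (row i A)^T (col j B).
  by rewrite fipC fipNr fipC.
rewrite frobN => h1 h2.
have -> : (A *m B) i j = fip (row i A)^T (col j B).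
  rewrite fipE mxE; apply: eq_bigr => k _.
  by rewrite big_ord1 !mxE.
have <- : frobenius (row i A)^T ^+ 2 = \sum_j A i j ^+ 2.
  by rewrite frobT frobM big_ord1; apply: eq_bigr => k _; rewrite mxE.
have <- : frobenius (col j B) ^+ 2 = \sum_k B k j ^+ 2.
  by rewrite frobM; apply: eq_bigr => k _; rewrite big_ord1 mxE.
have := frob_ge0 (row i A)^T; have := frob_ge0 (col j B).
move: h1 h2; move: (fip _ _) (frobenius _) (frobenius _) => c a b; nra.
Qed.

Lemma frob_isom m n p (V : 'M[R]_(m, n)) (X : 'M[R]_(n, p)) :
  V^T *m V = 1%:M -> frobenius (V *m X) = frobenius X.
Proof. by move=> VV; rewrite /frobenius trmx_mul mulmxA -(mulmxA X^T) VV mulmx1. Qed.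

(** Pythagoras for the splitting of [X] into [P *m X] and [X - P *m X]. *)
Lemma frob_proj m p (P : 'M[R]_m) (X : 'M[R]_(m, p)) :
  P^T = P -> P *m P = P -> frobenius (P *m X) <= frobenius X.
Proof.
move=> PT PP; rewrite -(@ler_pXn2r _ 2) ?nnegrE ?frob_ge0 // !frob_sqr.
have -> : fip X X = fip (P *m X) (P *m X) + fip (X - P *m X) (X - P *m X).
  rewrite !(fipBl, fipBr) (fipC (P *m X) X).
  suff -> : fip (P *m X) (P *m X) = fip X (P *m X) by ring.
  by rewrite fip_mull PT mulmxA PP.
by rewrite lerDl fip_ge0.
Qed.

Lemma frob_coisom m n p (V : 'M[R]_(m, n)) (X : 'M[R]_(m, p)) :
  V^T *m V = 1%:M -> frobenius (V^T *m X) <= frobenius X.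
Proof.
move=> VV; rewrite -(frob_isom _ VV) mulmxA frob_proj //.
  by rewrite trmx_mul trmxK.
by rewrite mulmxA -(mulmxA V) VV mulmx1.
Qed.

Lemma frob_isomr m n p (V : 'M[R]_(m, n)) (X : 'M[R]_(p, n)) :
  V^T *m V = 1%:M -> frobenius (X *m V^T) = frobenius X.
Proof. by move=> VV; rewrite -frobT trmx_mul trmxK frob_isom // frobT. Qed.

Lemma frob_coisomr m n p (V : 'M[R]_(m, n)) (X : 'M[R]_(p, m)) :
  V^T *m V = 1%:M -> frobenius (X *m V) <= frobenius X.
Proof. by move=> VV; rewrite -frobT trmx_mul -[leRHS]frobT frob_coisom. Qed.

Lemma frob_entry m n (A : 'M[R]_(m, n)) i j : `|A i j| <= frobenius A.
Proof.
rewrite -(@ler_pXn2r _ 2) ?nnegrE ?normr_ge0 ?frob_ge0 // frob_sqr fipE.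
rewrite real_normK ?num_real // (bigD1 i) //= (bigD1 j) //= -expr2 -addrA lerDl.
by rewrite addr_ge0 // sumr_ge0 // => *; rewrite ?sumr_ge0 // => *; rewrite -expr2 sqr_ge0.
Qed.

Lemma frame_rank n r (V : 'M[R]_(n, r)) : V^T *m V = 1%:M -> \rank V = r.
Proof.
move=> VV; apply/eqP; rewrite eqn_leq rank_leq_col /=.
by rewrite -{1}(mxrank1 R r) -VV mxrankM_maxr.
Qed.

Lemma frame_mul_rank n r (V : 'M[R]_(n, r)) :
  V^T *m V = 1%:M -> \rank (V *m V^T) = r.
Proof.
move=> VV; transitivity (\rank V); last exact: frame_rank.
apply/eqP; rewrite eqn_leq mxrankM_maxl /=.
have {1}-> : V = V *m V^T *m V by rewrite -mulmxA VV mulmx1.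
exact: mxrankM_maxl.
Qed.

(** Induction on the rank: a normalised nonzero column [u] of [P] is fixed by [P], and
    [P - u *m u^T] is an orthogonal projection of smaller rank whose frame is orthogonal to [u]. *)
Lemma proj_frame n (P : 'M[R]_n) : P^T = P -> P *m P = P ->
  exists r (V : 'M[R]_(n, r)), V^T *m V = 1%:M /\ V *m V^T = P.
Proof.
have [k] := ubnP (\rank P); elim: k => // k IHk in P *.
rewrite ltnS => Pk PT PP.
have [->|P0] := eqVneq P 0.
  exists 0, 0; split; last by rewrite mul0mx.
  by apply/matrixP => -[].
have [i Pi0] : exists i, col i P != 0.
  apply/existsP; apply: contraNT P0; rewrite negb_exists => /forallP P0.
  apply/eqP/matrixP => a i; have := P0 i; rewrite negbK => /eqP/matrixP/(_ a ord0).
  by rewrite !mxE.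
pose u := (frobenius (col i P))^-1 *: col i P.
have u1 : u^T *m u = 1%:M.
  apply/matrixP => a b; rewrite !ord1 [RHS]mxE eqxx mulr1n.
  have -> : (u^T *m u) ord0 ord0 = fip u u by rewrite /fip /mxtrace big_ord1.
  rewrite fipZl fipZr -frob_sqr; have := frob_gt0 Pi0.
  by move: (frobenius _) => c c0; field; rewrite gt_eqF.
have Pu : P *m u = u.
  by rewrite /u colE -scalemxAr mulmxA PP.
have uP : u^T *m P = u^T by rewrite -{1}PT -trmx_mul Pu.
pose P' := P - u *m u^T.
have P'T : P'^T = P' by rewrite linearB /= trmx_mul trmxK PT.
have P'u : P' *m u = 0 by rewrite mulmxBl Pu -mulmxA u1 mulmx1 subrr.
have P'P : P' *m P = P' by rewrite mulmxBl PP -mulmxA uP.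
have P'P' : P' *m P' = P' by rewrite mulmxBr P'P mulmxA P'u mul0mx subr0.
(* Otherwise the row spaces agree, [P = X *m P'], and [P' *m u = 0] would give [u = P *m u = 0]. *)
have rk : (\rank P' < k)%N.
  apply: leq_trans Pk; rewrite ltnNge; apply/negP => rk.
  have P'leP : (P' <= P)%MS by rewrite -P'P submxMl.
  have /submxP[X PX] : (P <= P')%MS by rewrite -(mxrank_leqif_sup P'leP) eqn_leq rk mxrankS.
  have u0 : u = 0 by rewrite -Pu PX -mulmxA P'u mulmx0.
  by have := matrix_nonzero1 R 0; rewrite -u1 u0 mulmx0 eqxx.
have [r [V [VV VP]]] := IHk _ rk P'T P'P'.
have uV : u^T *m V = 0.
  by rewrite -[V]mulmx1 -VV !mulmxA -(mulmxA u^T) VP -P'T -trmx_mul P'u trmx0 mul0mx.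
exists (1 + r)%N, (row_mx u V); split.
  rewrite tr_row_mx mul_col_row u1 VV uV -[V^T *m u]trmxK trmx_mul trmxK uV trmx0.
  by rewrite -scalar_mx_block.
by rewrite tr_row_mx mul_row_col VP addrC subrK.
Qed.

Lemma frame_trace n r (V : 'M[R]_(n, r)) :
  V^T *m V = 1%:M -> \tr (V *m V^T) = r%:R.
Proof. by move=> VV; rewrite mxtrace_mulC VV mxtrace1. Qed.

Lemma proj_trace n (P : 'M[R]_n) :
  P^T = P -> P *m P = P -> \tr P = (\rank P)%:R.
Proof.
move=> PT PP; have [r [V [VV <-]]] := proj_frame PT PP.
by rewrite frame_trace // frame_mul_rank.
Qed.

(** The trace, unlike the rank, is linear and continuous, as compactness of [Grn d] and the block
    computations require. *)
Lemma Grn_traceP d n (P : 'M[R]_n) :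
  Grn d P <-> [/\ P^T = P, P *m P = P & \tr P = d%:R].
Proof.
split=> -[PT PP].
  by move=> rP; split => //; rewrite proj_trace // rP.
by rewrite proj_trace // => /eqP; rewrite eqr_nat => /eqP.
Qed.

Lemma Grn_frame d n (P : 'M[R]_n) : Grn d P ->
  exists V : 'M[R]_(n, d), V^T *m V = 1%:M /\ V *m V^T = P.
Proof.
move=> [PT PP rP]; have [r [V [VV VP]]] := proj_frame PT PP.
have rd : r = d by rewrite -rP -VP frame_mul_rank.
by subst r; exists V.
Qed.

Lemma frame_Grn d n (V : 'M[R]_(n, d)) : V^T *m V = 1%:M -> Grn d (V *m V^T).
Proof.
move=> VV; split; first by rewrite trmx_mul trmxK.
  by rewrite mulmxA -(mulmxA V) VV mulmx1.
exact: frame_mul_rank.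
Qed.

Lemma Grn_fip d n (P Q : 'M[R]_n) : Grn d P -> Grn d Q ->
  frobenius (P - Q) ^+ 2 = 2 * (d%:R - fip P Q).
Proof.
move=> /Grn_traceP[PT PP tP] /Grn_traceP[QT QQ tQ].
rewrite frob_sqr !(fipBl, fipBr) (fipC Q P) /(fip P P) /(fip Q Q) PT QT PP QQ tP tQ.
ring.
Qed.

(** The right side squared minus the left side squared is [2 * |U^T W - 1|^2]. This is the origin of
    the [sqrt 2] in the radius of the thickening. *)
Lemma frame_dist d n (U W : 'M[R]_(n, d)) : U^T *m U = 1%:M -> W^T *m W = 1%:M ->
  frobenius (U *m U^T - W *m W^T) <= Num.sqrt 2 * frobenius (U - W).
Proof.
move=> UU WW.
rewrite -(@ler_pXn2r _ 2) ?nnegrE ?mulr_ge0 ?sqrtr_ge0 ?frob_ge0 //.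
rewrite (Grn_fip (frame_Grn UU) (frame_Grn WW)) exprMn sqr_sqrtr //.
rewrite ler_pM2l // frob_sqr !(fipBl, fipBr).
have fU : fip U U = d%:R by rewrite /fip UU mxtrace1.
have fW : fip W W = d%:R by rewrite /fip WW mxtrace1.
rewrite fU fW (fipC W U).
have -> : fip (U *m U^T) (W *m W^T) = fip (U^T *m W) (U^T *m W).
  by rewrite fip_mull mulmxA [RHS]fip_mulr.
have := fip_ge0 (U^T *m W - 1%:M); rewrite !(fipBl, fipBr).
have f1 : fip (1%:M : 'M[R]_d) 1%:M = d%:R by rewrite /fip trmx1 mulmx1 mxtrace1.
have f2 : fip 1%:M (U^T *m W) = fip U W by rewrite /fip trmx1 mul1mx.
by rewrite f1 (fipC _ 1%:M) f2 => h; lra.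
Qed.
End Frobenius.

(** * The nearest projection *)

Section ClosestProjection.
Context {R : realType}.
Implicit Types (d m : nat).

Lemma fip_delta m n (A : 'M[R]_(m, n)) i j : fip A (delta_mx i j) = A i j.
Proof.
rewrite fipE (bigD1 i) //= (bigD1 j) //= mxE !eqxx mulr1 !big1 ?addr0 //.
  by move=> k ki; apply: big1 => l _; rewrite mxE (negPf ki) mulr0.
by move=> l lj; rewrite mxE (negPf lj) andbF mulr0.
Qed.

Lemma cV_unit m (u : 'cV[R]_m) : u != 0 ->
  exists2 c, c != 0 & fip (c *: u) (c *: u) = 1.
Proof.
move=> u0; have c0 := frob_gt0 u0; exists (frobenius u)^-1.
  by rewrite invr_eq0 gt_eqF.
rewrite fipZl fipZr -frob_sqr; move: c0; move: (frobenius _) => c c0.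
by field; rewrite gt_eqF.
Qed.

Lemma cV_dot m (u w : 'cV[R]_m) : u^T *m w = (fip u w)%:M.
Proof.
apply/matrixP => a b; rewrite !ord1 [RHS]mxE eqxx mulr1n.
by rewrite /fip /mxtrace big_ord1.
Qed.

(** Rotates the unit vector [u] of the range towards the unit vector [w] of the kernel; [1 + t ^+ 2]
    is the squared norm of [u + t *: w]. *)
Lemma Grn_rotate d m (P : 'M[R]_m) (u w : 'cV[R]_m) (t : R) : Grn d P ->
  P *m u = u -> P *m w = 0 -> fip u u = 1 -> fip w w = 1 ->
  Grn d (P - u *m u^T + (1 + t ^+ 2)^-1 *: ((u + t *: w) *m (u + t *: w)^T)).
Proof.
move=> /Grn_traceP[PT PP tP] Pu Pw u1 w1.
have c0 : 1 + t ^+ 2 != 0 by rewrite gt_eqF // ltr_wpDr ?sqr_ge0.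
have uw : fip u w = 0 by rewrite -Pu fip_mull PT Pw /fip mulmx0 mxtrace0.
set v := u + t *: w; set c := (1 + t ^+ 2)^-1.
have v1 : fip v v = 1 + t ^+ 2.
  rewrite !(fipDl, fipDr, fipZl, fipZr) (fipC w) uw u1 w1; ring.
set Q := P - u *m u^T.
have QT : Q^T = Q by rewrite linearB /= trmx_mul trmxK PT.
have uP : u^T *m P = u^T by rewrite -{1}PT -trmx_mul Pu.
have Qu : Q *m u = 0 by rewrite mulmxBl Pu -mulmxA cV_dot u1 mulmx1 subrr.
have Qw : Q *m w = 0.
  by rewrite mulmxBl Pw -mulmxA cV_dot uw raddf0 mulmx0 subrr.
have Qv : Q *m v = 0 by rewrite mulmxDr Qu -scalemxAr Qw scaler0 addr0.
have vQ : v^T *m Q = 0 by rewrite -QT -trmx_mul Qv trmx0.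
have QQ : Q *m Q = Q.
  by rewrite {2}/Q mulmxBr mulmxA Qu mul0mx subr0 mulmxBl PP -mulmxA uP.
have tQ : \tr Q = d%:R - 1.
  by rewrite linearB /= tP mxtrace_mulC cV_dot u1 mxtrace1.
clearbody v Q; apply/Grn_traceP; split.
- by rewrite linearD /= linearZ /= trmx_mul trmxK QT.
- rewrite mulmxDl !mulmxDr QQ -!scalemxAr -!scalemxAl.
  rewrite [Q *m (v *m _)]mulmxA Qv mul0mx scaler0 addr0.
  rewrite -[v *m v^T *m Q]mulmxA vQ mulmx0 scaler0 add0r.
  rewrite mulmxA -[v *m v^T *m v]mulmxA cV_dot v1 mul_mx_scalar -scalemxAl.
  by rewrite !scalerA; congr (_ + _ *: _); rewrite /c; field.
- by rewrite mxtraceD mxtraceZ tQ mxtrace_mulC cV_dot v1 mxtrace_scalar mulVf // subrK.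
Qed.

(** The first-order condition at an extremum: near [t = 0] a nonzero linear term, of either sign,
    outweighs a quadratic one. *)
Lemma quad_ge0_eq0 (m k : R) : (forall t, t * m <= t ^+ 2 * k) -> m = 0.
Proof.
move=> h; have c0 : 0 < `|k| + 1 by rewrite ltr_wpDl.
(* With [c = |k| + 1], this value of [t] gives [m^2 * c <= m^2 * k], while [k < c]. *)
have := h (m / (`|k| + 1)); set c := `|k| + 1 in c0 *.
have kc : k < c by rewrite /c (le_lt_trans (ler_norm _)) // ltrDl.
rewrite -(ler_pM2r (exprn_gt0 2 c0)).
have -> : m / c * m * c ^+ 2 = m ^+ 2 * c by field; rewrite gt_eqF.
have -> : (m / c) ^+ 2 * k * c ^+ 2 = m ^+ 2 * k by field; rewrite gt_eqF.
move=> h2; apply/eqP; rewrite -sqrf_eq0 eq_le sqr_ge0 andbT.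
have: m ^+ 2 * (c - k) <= 0 by lra.
by rewrite pmulr_lle0 // subr_gt0.
Qed.

Definition nearest d m (A P : 'M[R]_m) :=
  Grn d P /\ forall Q, Grn d Q -> frobenius (A - P) <= frobenius (A - Q).

Lemma Grn_fip_diag d m (P : 'M[R]_m) : Grn d P -> fip P P = d%:R.
Proof. by move=> /Grn_traceP[PT PP tP]; rewrite /fip PT PP. Qed.

(** All members of [Grn d] have squared norm [d], so minimising the distance to [A] is maximising
    [fip A]. *)
Lemma frob_le_fip d m (A P Q : 'M[R]_m) : Grn d P -> Grn d Q ->
  (frobenius (A - P) <= frobenius (A - Q)) = (fip A Q <= fip A P).
Proof.
move=> GP GQ.
rewrite -(@ler_pXn2r _ 2) ?nnegrE ?frob_ge0 // !frob_sqr !(fipBl, fipBr).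
rewrite (fipC P A) (fipC Q A) (Grn_fip_diag GP) (Grn_fip_diag GQ).
by apply/idP/idP => h; lra.
Qed.

(* First variation along the rotation of [u] towards [w]. *)
Lemma nearest_orth d m (A P : 'M[R]_m) (u w : 'cV[R]_m) : nearest d A P ->
  P *m u = u -> P *m w = 0 -> fip (A + A^T) (u *m w^T) = 0.
Proof.
move=> [GP minP].
have unit_case (u' w' : 'cV[R]_m) : P *m u' = u' -> P *m w' = 0 -> fip u' u' = 1 ->
    fip w' w' = 1 -> fip (A + A^T) (u' *m w'^T) = 0.
  move=> Pu Pw u1 w1.
  apply: (@quad_ge0_eq0 _ (fip A (u' *m u'^T) - fip A (w' *m w'^T))) => t.
  have GQ := Grn_rotate t GP Pu Pw u1 w1.
  have := minP _ GQ; rewrite (frob_le_fip _ GP GQ).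
  have c0 : 0 < 1 + t ^+ 2 by rewrite ltr_wpDr ?sqr_ge0.
  rewrite fipDr fipBr fipZr.
  have -> : (u' + t *: w')^T = u'^T + t *: w'^T by rewrite linearD /= linearZ.
  rewrite mulmxDl !mulmxDr -!scalemxAl -!scalemxAr !(fipDr, fipZr).
  have -> : fip (A + A^T) (u' *m w'^T) = fip A (u' *m w'^T) + fip A (w' *m u'^T).
    by rewrite fipDl -(fip_tr A^T) trmxK trmx_mul trmxK.
  move: (fip A P) (fip A (u' *m u'^T)) (fip A (u' *m w'^T)) (fip A (w' *m u'^T))
    (fip A (w' *m w'^T)) => p a x y b.
  move: c0; set s := 1 + _ => s0 h.
  have {}h : s^-1 * (a + t * x + (t * y + t * (t * b))) <= a by lra.
  have : a + t * x + (t * y + t * (t * b)) <= s * a.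
    by move: h; rewrite ler_pdivrMl.
  rewrite /s => h'; lra.
move=> Pu Pw.
have [->|u0] := eqVneq u 0; first by rewrite mul0mx /fip mulmx0 mxtrace0.
have [->|w0] := eqVneq w 0; first by rewrite trmx0 mulmx0 /fip mulmx0 mxtrace0.
have [c c0 cu] := cV_unit u0; have [e e0 ew] := cV_unit w0.
have := unit_case (c *: u) (e *: w).
rewrite -!scalemxAr Pu Pw scaler0 => /(_ erefl erefl cu ew)/eqP.
rewrite linearZ /= -scalemxAl -scalemxAr scalerA fipZr mulf_eq0.
by rewrite mulf_eq0 (negPf c0) (negPf e0) => /eqP.
Qed.

Lemma nearest_comm d m (A P : 'M[R]_m) : nearest d A P ->
  P *m (A + A^T) = (A + A^T) *m P.
Proof.
move=> nP; have [PT PP _] := nP.1; set S := A + A^T.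
have ST : S^T = S by rewrite /S linearD /= trmxK addrC.
have PS : P *m S *m (1%:M - P) = 0.
  apply/matrixP => i j; rewrite [RHS]mxE.
  have : fip (P *m S *m (1%:M - P)) (delta_mx i j) = 0.
    rewrite fip_mulr fip_mull PT linearB /= trmx1 PT.
    (* A matrix unit is a product of two basis vectors; [P] sends one into its range and [1 - P]
       sends the other into its kernel, the situation of [nearest_orth]. *)
    rewrite -(mul_delta_mx (ord0 : 'I_1)) -mulmxA mulmxA.
    have -> : delta_mx (ord0 : 'I_1) j *m (1%:M - P) = ((1%:M - P) *m delta_mx j ord0)^T.
      by rewrite trmx_mul trmx_delta [(_ - _)^T]linearB /= trmx1 PT.
    apply: (nearest_orth nP); first by rewrite mulmxA PP.
    by rewrite mulmxA mulmxBr mulmx1 PP subrr mul0mx.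
  by rewrite fip_delta.
have : P *m S = P *m S *m P.
  by apply/eqP; rewrite -subr_eq0 -{1}[P *m S]mulmx1 -mulmxBr PS.
move=> /[dup] e /(congr1 trmx); rewrite !trmx_mul PT ST => ->.
by rewrite mulmxA -e.
Qed.

Lemma fip_sym m (A M : 'M[R]_m) : M^T = M -> fip (A + A^T) M = 2 * fip A M.
Proof.
by move=> MT; rewrite fipDl -(fip_tr A^T) trmxK MT -mulr2n mulr_natl.
Qed.

Lemma frob_mulT m p (X : 'M[R]_(m, p)) : frobenius (X *m X^T) <= fip X X.
Proof. by rewrite -frob_sqr expr2 (le_trans (frob_mul _ _)) // frobT. Qed.

(* The difference of the Rayleigh quotients of [A] on the range and on the
   kernel of [P] is at least [1 - sqrt 2 * r >= 1 / 4]. *)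
Lemma nearest_rayleigh d m p (A P : 'M[R]_m) (X Y : 'M[R]_(m, p)) r :
  Grn d P -> frobenius (A - P) <= r -> r * Num.sqrt 2 <= 3 / 4 ->
  P *m X = X -> P *m Y = 0 ->
  fip X X * fip Y Y / 4 <= fip Y Y * fip A (X *m X^T) - fip X X * fip A (Y *m Y^T).
Proof.
move=> [PT PP _] AP r34 PX PY.
have XY : X^T *m Y = 0 by rewrite -PX trmx_mul PT -mulmxA PY mulmx0.
have fPX : fip P (X *m X^T) = fip X X by rewrite fipC fip_mulr trmxK PX.
have fPY : fip P (Y *m Y^T) = 0.
  by rewrite fipC fip_mulr trmxK PY /fip mulmx0 mxtrace0.
have fXY : fip (Y *m Y^T) (X *m X^T) = 0.
  rewrite fip_mull mulmxA -[Y^T *m X]trmxK trmx_mul trmxK XY trmx0 mul0mx.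
  by rewrite /fip mulmx0 mxtrace0.
have := frob_mulT X; have := frob_mulT Y; have := fip_ge0 X; have := fip_ge0 Y.
have := frob_ge0 (X *m X^T); have := frob_ge0 (Y *m Y^T).
(* The weights balance the two terms of [D]: each has norm at most [a * b] and they are orthogonal,
   so [|D| <= sqrt 2 * a * b], while [fip P D = - (a * b)]. *)
set a := fip X X; set b := fip Y Y; set D := a *: (Y *m Y^T) - b *: (X *m X^T).
move=> y0 x0 b0 a0 yb xa; have ab0 : 0 <= a * b by rewrite mulr_ge0.
have Dab : frobenius D <= Num.sqrt 2 * (a * b).
  rewrite -(@ler_pXn2r _ 2) ?nnegrE ?mulr_ge0 ?sqrtr_ge0 ?frob_ge0 //.
  rewrite frob_sqr !(fipBl, fipBr, fipZl, fipZr) (fipC (X *m X^T) (Y *m Y^T)) fXY.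
  have s2 : (Num.sqrt 2 : R) ^+ 2 = 2 by rewrite sqr_sqrtr.
  rewrite -(frob_sqr (Y *m _)) -(frob_sqr (X *m _)) exprMn s2.
  have h1 : (a * frobenius (Y *m Y^T)) ^+ 2 <= (a * b) ^+ 2.
    by rewrite lerXn2r ?nnegrE ?mulr_ge0 // ler_wpM2l.
  have h2 : (b * frobenius (X *m X^T)) ^+ 2 <= (a * b) ^+ 2.
    by rewrite lerXn2r ?nnegrE ?mulr_ge0 // mulrC ler_wpM2r.
  by rewrite !exprMn in h1 h2 *; lra.
have : fip (A - P) D <= 3 / 4 * (a * b).
  rewrite (le_trans (fip_le _ _)) //.
  rewrite (le_trans (ler_pM (frob_ge0 _) (frob_ge0 _) AP Dab)) //.
  by rewrite mulrA ler_wpM2r.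
rewrite fipBl !(fipBr, fipZr) fPX fPY -/a; lra.
Qed.

(** [X *m X^T] is what [P] loses in passing to [Q] and [Y *m Y^T] what is gained, both of trace
    [d - fip P Q]. Since [A + A^T] commutes with [P], the mixed blocks of [Q] contribute nothing to
    [fip A Q], and the Rayleigh bound controls the rest. *)
Lemma nearest_gap d m (A P Q : 'M[R]_m) r : nearest d A P -> Grn d Q ->
  frobenius (A - P) <= r -> r * Num.sqrt 2 <= 3 / 4 ->
  (d%:R - fip P Q) / 4 <= fip A P - fip A Q.
Proof.
move=> nP GQ AP r34; have SP := nearest_comm nP.
have [GP _] := nP; have [PT PP _] := GP; have [QT QQ _] := GQ.
pose X := P *m (1%:M - Q); pose Y := (1%:M - P) *m Q.
have PX : P *m X = X by rewrite mulmxA PP.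
have PY : P *m Y = 0 by rewrite mulmxA mulmxBr mulmx1 PP subrr mul0mx.
have cT (B : 'M[R]_m) : B^T = B -> (1%:M - B)^T = 1%:M - B.
  by move=> BT; rewrite linearB /= trmx1 BT.
have cc (B : 'M[R]_m) : B *m B = B -> (1%:M - B) *m (1%:M - B) = 1%:M - B.
  by move=> BB; rewrite mulmxBr mulmx1 mulmxBl mul1mx BB subrr subr0.
have XX : X *m X^T = P *m (1%:M - Q) *m P.
  by rewrite /X trmx_mul PT cT // mulmxA -(mulmxA P) cc.
have YY : Y *m Y^T = (1%:M - P) *m Q *m (1%:M - P).
  by rewrite /Y trmx_mul QT cT // mulmxA -(mulmxA _ Q Q) QQ.
have PQE : fip P Q = \tr (P *m Q) by rewrite /fip PT.
have tP : \tr P = d%:R by have /Grn_traceP[] := GP.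
have tQ : \tr Q = d%:R by have /Grn_traceP[] := GQ.
set t := d%:R - fip P Q.
have Xt : fip X X = t.
  rewrite -fip_tr /fip trmxK XX mxtrace_mulC mulmxA PP mulmxBr mulmx1 linearB /=.
  by rewrite tP /t PQE.
have Yt : fip Y Y = t.
  rewrite -fip_tr /fip trmxK YY mxtrace_mulC mulmxA cc // mulmxBl mul1mx linearB /=.
  by rewrite tQ /t PQE.
have t0 : 0 <= t by rewrite -Xt fip_ge0.
have APQ : fip A (X *m X^T) - fip A (Y *m Y^T) = fip A P - fip A Q.
  apply: (@mulfI _ 2); first by [].
  have sym (Z : 'M[R]_m) : (Z *m Z^T)^T = Z *m Z^T by rewrite trmx_mul trmxK.
  rewrite !mulrBr -(fip_sym A (sym X)) -(fip_sym A (sym Y)).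
  rewrite -(fip_sym A PT) -(fip_sym A QT).
  set S := A + A^T in SP *.
  have ST : S^T = S by rewrite /S linearD /= trmxK addrC.
  have SPP B E : E *m E = E -> E *m S = S *m E ->
      fip S (E *m B *m E) = fip S (B *m E).
    move=> EE ES; rewrite /fip ST !mulmxA mxtrace_mulC [in RHS]mxtrace_mulC.
    by rewrite !mulmxA ES -(mulmxA S) EE.
  rewrite XX YY !SPP ?cc //; last by rewrite mulmxBl mulmxBr mul1mx mulmx1 SP.
  rewrite -!fipBr; congr fip.
  by rewrite mulmxBl mulmxBr mul1mx mulmx1 opprB addrA subrK.
(* For [t = 0] the factor cannot be cancelled; there minimality of [P] gives the claim. *)
rewrite -APQ; move: t0; rewrite le_eqVlt => /orP[/eqP<-|t0].
  by rewrite mul0r APQ subr_ge0 -(frob_le_fip _ GP GQ) nP.2.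
  
have := nearest_rayleigh GP AP r34 PX PY; rewrite Xt Yt -mulrBr -mulrA ler_pM2l //.
Qed.

(** Adding the gap inequalities at [A] and at [A'] gives [|P - P'|^2 / 4 <= fip (A - A') (P - P')];
    Cauchy-Schwarz then yields the factor 4. *)
Lemma nearest_lipschitz d m (A A' P P' : 'M[R]_m) r : 
  nearest d A P -> frobenius (A - P) <= r -> 
  nearest d A' P' -> frobenius (A' - P') <= r -> r * Num.sqrt 2 <= 3 / 4 ->
  frobenius (P - P') <= 4 * frobenius (A - A').
Proof.
move=> nP AP nP' AP' r34.
have := nearest_gap nP nP'.1 AP r34; have := nearest_gap nP' nP.1 AP' r34.
have := Grn_fip nP.1 nP'.1; have := fip_le (A - A') (P - P').
rewrite !(fipBl, fipBr) (fipC P' P).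
have := frob_ge0 (P - P'); rewrite le_eqVlt => /orP[/eqP<-|p0].
  by rewrite mulr_ge0 ?frob_ge0.
move=> h1 h2 h3 h4; rewrite -(ler_pM2r p0) -expr2; lra.
Qed.

Lemma nearest_unique d m (A P P' : 'M[R]_m) r : nearest d A P -> nearest d A P' ->
  frobenius (A - P) <= r -> r * Num.sqrt 2 <= 3 / 4 -> P = P'.
Proof.
move=> nP nP' AP r34; have AP' := le_trans (nP'.2 _ nP.1) AP.
have := nearest_lipschitz nP AP nP' AP' r34; rewrite subrr frob0 mulr0 => h.
by apply/eqP; rewrite -subr_eq0; apply/eqP/frob_eq0/eqP; rewrite eq_le h frob_ge0.
Qed.

Definition mx_widen n k (A : 'M[R]_n) : 'M[R]_(n + k) := block_mx A 0 0 0.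

(* A nearest projection cannot see directions on which [A] vanishes: there the
   Rayleigh quotient of [A] is [0], but on the range it is at least [1 - r]. *)
Lemma nearest_widen d n k (A : 'M[R]_n) (P : 'M[R]_(n + k)) r :
  nearest d (mx_widen k A) P -> frobenius (mx_widen k A - P) <= r ->
  r < 1 -> exists2 P', Grn d P' & P = mx_widen k P'.
Proof.
move=> nP AP r1; have SP := nearest_comm nP.
have [PT PP _] := nP.1.
pose E : 'M[R]_(n + k) := block_mx 0 0 0 1%:M.
set B := mx_widen k A in nP AP SP.
have BT : B^T = mx_widen k A^T by rewrite /B /mx_widen tr_block_mx !trmx0.
have BE : (B + B^T) *m E = 0.
  rewrite BT /B /mx_widen add_block_mx mulmx_block.
  by rewrite !(mulmx0, mul0mx, addr0, block_mx0).
(* The columns of [X] include the projections of the added coordinate directions; [B + B^T] kills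
   these directions and, commuting with [P], kills [X] too. *)
pose X := P *m E.
have BX : (B + B^T) *m X = 0 by rewrite /X mulmxA -SP -mulmxA BE mulmx0.
have fBX : fip B (X *m X^T) = 0.
  have sX : (X *m X^T)^T = X *m X^T by rewrite trmx_mul trmxK.
  apply: (@mulfI _ 2); rewrite ?pnatr_eq0 // mulr0 -(fip_sym B sX).
  by rewrite fipC fip_mulr trmxK BX /fip mulmx0 mxtrace0.
have fPX : fip P (X *m X^T) = fip X X.
  by rewrite fipC fip_mulr trmxK /X mulmxA PP.
have X0 : fip X X = 0.
  have := fip_le (P - B) (X *m X^T); rewrite fipBl fBX fPX subr0.
  rewrite frob_distC => h.
  have := le_trans h (ler_pM (frob_ge0 _) (frob_ge0 _) AP (frob_mulT X)).
  have := fip_ge0 X; move: (fip X X) => x x0 xr.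
  apply/eqP; rewrite eq_le x0 andbT; have : (1 - r) * x <= 0 by lra.
  by rewrite pmulr_rle0 // subr_gt0.
have {}X0 : P *m E = 0 by apply: fip_eq0.
have [ur0 dr0] : ursubmx P = 0 /\ drsubmx P = 0.
  move: X0; rewrite -[P]submxK mulmx_block !(mulmx0, mulmx1, add0r).
  by rewrite -[0 in RHS]block_mx0 => /eq_block_mx[_ + _]; rewrite !block_mxKur !block_mxKdr.
have dl0 : dlsubmx P = 0 by rewrite -PT -trmx_ursub ur0 trmx0.
have PE : P = mx_widen k (ulsubmx P).
  by rewrite /mx_widen -{1}[P]submxK ur0 dr0 dl0.
exists (ulsubmx P) => //; apply/Grn_traceP.
have /Grn_traceP[_ _ tP] := nP.1; split.
- by rewrite trmx_ulsub PT.
- move: PP; rewrite {1 2 3}PE /mx_widen mulmx_block !(mulmx0, addr0) => /eq_block_mx[].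
  by [].
- by rewrite -tP {2}PE /mx_widen mxtrace_block mxtrace0 addr0.
Qed.
End ClosestProjection.

(** * Limits of matrices and compactness *)

Section MatrixTopology.
Context {R : realType}.

Section Limits.
Context {T : Type} (F : set_system T) {FF : Filter F}.

Lemma cvg_mx m n (f : T -> 'M[R]_(m, n)) (A : 'M[R]_(m, n)) :
  (forall i j, f x i j @[x --> F] --> A i j) -> f x @[x --> F] --> A.
Proof.
move=> fA S [P AP PS]; apply: filterS PS _.
apply: filter_forall => i; apply: filter_forall => j.
exact: fA i j _ (AP i j).
Qed.

Lemma cvg_entry m n (f : T -> 'M[R]_(m, n)) (A : 'M[R]_(m, n)) i j :
  f x @[x --> F] --> A -> f x i j @[x --> F] --> A i j.
Proof.
move=> fA; apply: (cvg_comp _ (fun M : 'M[R]_(m, n) => M i j) fA).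
exact: coord_continuous.
Qed.

Lemma cvg_rsum (I : Type) (r : seq I) (P : pred I) (f : I -> T -> R) (a : I -> R) :
  (forall i, P i -> f i x @[x --> F] --> a i) ->
  \sum_(i <- r | P i) f i x @[x --> F] --> \sum_(i <- r | P i) a i.
Proof. by move=> fa; apply: cvg_big => //; exact: add_continuous. Qed.

Lemma cvg_rprod (I : Type) (r : seq I) (P : pred I) (f : I -> T -> R) (a : I -> R) :
  (forall i, P i -> f i x @[x --> F] --> a i) ->
  \prod_(i <- r | P i) f i x @[x --> F] --> \prod_(i <- r | P i) a i.
Proof. by move=> fa; apply: cvg_big => //; exact: mul_continuous. Qed.

Lemma cvg_mulmx m n p (f : T -> 'M[R]_(m, n)) (g : T -> 'M[R]_(n, p))
    (A : 'M[R]_(m, n)) (B : 'M[R]_(n, p)) :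
  f x @[x --> F] --> A -> g x @[x --> F] --> B ->
  f x *m g x @[x --> F] --> A *m B.
Proof.
move=> fA gB; apply: cvg_mx => i j; rewrite mxE.
under eq_cvg do rewrite mxE.
apply: cvg_rsum => k _; apply: cvgM; exact: cvg_entry.
Qed.

Lemma cvg_trmx m n (f : T -> 'M[R]_(m, n)) (A : 'M[R]_(m, n)) :
  f x @[x --> F] --> A -> (f x)^T @[x --> F] --> A^T.
Proof.
move=> fA; apply: cvg_mx => i j; rewrite mxE.
under eq_cvg do rewrite mxE.
exact: cvg_entry.
Qed.

Lemma cvg_mxsum (I : Type) (r : seq I) (P : pred I) m n
    (f : I -> T -> 'M[R]_(m, n)) (a : I -> 'M[R]_(m, n)) :
  (forall i, P i -> f i x @[x --> F] --> a i) ->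
  \sum_(i <- r | P i) f i x @[x --> F] --> \sum_(i <- r | P i) a i.
Proof.
move=> fa; apply: cvg_mx => i j; rewrite summxE.
under eq_cvg do rewrite summxE.
by apply: cvg_rsum => k /fa; exact: cvg_entry.
Qed.

Lemma cvg_scalemx m n (a : T -> R) (f : T -> 'M[R]_(m, n)) (c : R)
    (A : 'M[R]_(m, n)) :
  a x @[x --> F] --> c -> f x @[x --> F] --> A ->
  a x *: f x @[x --> F] --> c *: A.
Proof.
move=> ac fA; apply: cvg_mx => i j; rewrite mxE.
under eq_cvg do rewrite mxE.
by apply: cvgM => //; exact: cvg_entry.
Qed.

Lemma cvg_det n (f : T -> 'M[R]_n) (A : 'M[R]_n) :
  f x @[x --> F] --> A -> \det (f x) @[x --> F] --> \det A.
Proof.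
move=> fA; rewrite /determinant; apply: cvg_rsum => s _.
by apply: cvgM; [exact: cvg_cst|apply: cvg_rprod => i _; exact: cvg_entry].
Qed.

Lemma cvg_adj n (f : T -> 'M[R]_n) (A : 'M[R]_n) :
  f x @[x --> F] --> A -> \adj (f x) @[x --> F] --> \adj A.
Proof.
move=> fA; apply: cvg_mx => i j; rewrite mxE.
under eq_cvg do rewrite mxE.
apply: cvgM; [exact: cvg_cst|apply: cvg_det; apply: cvg_mx => k l].
rewrite !mxE; under eq_cvg do rewrite !mxE.
exact: cvg_entry.
Qed.

(** [invmx] is defined by cases, but it is given by the adjugate formula wherever the determinant is
    nonzero, hence near [A]. *)
Lemma cvg_invmx n (f : T -> 'M[R]_n) (A : 'M[R]_n) : A \in unitmx ->
  f x @[x --> F] --> A -> invmx (f x) @[x --> F] --> invmx A.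
Proof.
move=> uA fA; have dA : \det A != 0 by rewrite -unitfE -unitmxE.
have nd : \forall x \near F, \det (f x) != 0.
  exact: cvgr_neq0 (cvg_det fA) dA.
have -> : invmx A = (\det A)^-1 *: \adj A by rewrite /invmx uA.
apply: cvg_trans (cvg_scalemx (cvgV dA (cvg_det fA)) (cvg_adj fA)).
apply: near_eq_cvg; apply: filterS nd => x dx.
by rewrite /invmx unitmxE unitfE dx.
Qed.

Lemma cvg_fip m n (f g : T -> 'M[R]_(m, n)) (A B : 'M[R]_(m, n)) :
  f x @[x --> F] --> A -> g x @[x --> F] --> B ->
  fip (f x) (g x) @[x --> F] --> fip A B.
Proof.
move=> fA gB; rewrite /fip; apply: cvg_rsum => i _.
by apply: cvg_entry; apply: cvg_mulmx => //; exact: cvg_trmx.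
Qed.

Lemma cvg_mxB m n (f g : T -> 'M[R]_(m, n)) (A B : 'M[R]_(m, n)) :
  f x @[x --> F] --> A -> g x @[x --> F] --> B ->
  f x - g x @[x --> F] --> A - B.
Proof.
move=> fA gB; apply: cvg_mx => i j; rewrite !mxE.
under eq_cvg do rewrite !mxE.
by apply: cvgB; exact: cvg_entry.
Qed.

Lemma cvg_frob m n (f : T -> 'M[R]_(m, n)) (A : 'M[R]_(m, n)) :
  f x @[x --> F] --> A -> frobenius (f x) @[x --> F] --> frobenius A.
Proof.
move=> fA; apply: (cvg_comp _ (@Num.sqrt R) (cvg_fip fA fA)).
exact: sqrt_continuous.
Qed.

Lemma cvg_frobB m n (f g : T -> 'M[R]_(m, n)) (A B : 'M[R]_(m, n)) :
  f x @[x --> F] --> A -> g x @[x --> F] --> B ->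
  frobenius (f x - g x) @[x --> F] --> frobenius (A - B).
Proof. by move=> fA gB; apply: cvg_frob; exact: cvg_mxB. Qed.
End Limits.

Lemma frob_continuous m n : continuous (@frobenius R m n).
Proof. move=> A; apply: (@cvg_frob _ (nbhs A) _ _ _ id A); exact: cvg_id. Qed.

Lemma frob_nbhs m n (A : 'M[R]_(m, n)) (e : R) : 0 < e ->
  \forall B \near A, frobenius (B - A) < e.
Proof.
move=> e0; have c : frobenius (B - A) @[B --> A] --> (0 : R).
  rewrite -(frob0 m n) -(subrr A).
  by apply: (@cvg_frobB _ (nbhs A) _ _ _ id (fun=> A)); [exact: cvg_id|exact: cvg_cst].
exact: cvgr_lt c _ e0.
Qed.

Lemma nbhs_frob m n (A : 'M[R]_(m, n)) (S : set 'M[R]_(m, n)) :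
  nbhs A S -> exists2 e, 0 < e & forall B, frobenius (B - A) < e -> S B.
Proof.
move=> /nbhs_ballP[e e0 eS]; exists e => // B BA; apply: eS; split => // i j.
rewrite /ball /= (le_lt_trans _ BA) // distrC.
by have := frob_entry (B - A) i j; rewrite !mxE.
Qed.

Lemma frob_bounded_compact m n c : compact [set A : 'M[R]_(m, n) | frobenius A <= c].
Proof.
pose S := [set v : 'rV[R]_(m * n) | forall i, `[- c, c]%classic (v ord0 i)].
have cS : compact S.
  by apply: (@rV_compact _ _ (fun=> `[- c, c]%classic)) => _; exact: segment_compact.
have cv : continuous (@vec_mx R m n).
  move=> v; apply: (@cvg_mx _ (nbhs v) _ _ _ (@vec_mx R m n)) => i j; rewrite mxE.
  under eq_cvg do rewrite mxE.
  exact: coord_continuous.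
have cT : compact (vec_mx @` S).
  by apply: continuous_compact => //; exact: continuous_subspaceT.
apply: subclosed_compact cT _.
  exact: (closed_comp (fun x _ => @frob_continuous m n x) (@closed_le _ c)).
move=> A Ac; exists (mxvec A); last exact: mxvecK.
move=> k; case/mxvec_indexP: k => i j; rewrite mxvecE /= in_itv /= -ler_norml.
exact: le_trans (frob_entry A i j) Ac.
Qed.

Lemma closed_eqfun (X : topologicalType) m n (f g : X -> 'M[R]_(m, n)) :
  continuous f -> continuous g -> closed [set x | f x = g x].
Proof.
move=> cf cg.
have -> : [set x | f x = g x] = (fun x => frobenius (f x - g x)) @^-1` [set x | x <= 0].
  apply/seteqP; split=> x /=; first by move=> ->; rewrite subrr frob0.
  move=> h; apply/eqP; rewrite -subr_eq0; apply/eqP/frob_eq0/eqP.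
  by rewrite eq_le h frob_ge0.
apply: closed_comp (@closed_le _ 0) => x _.
exact: (cvg_frobB (cf x) (cg x)).
Qed.

Lemma Grn_compact d n : compact [set A : 'M[R]_n | Grn d A].
Proof.
apply: (subclosed_compact _ (@frob_bounded_compact n n (Num.sqrt d%:R))).
  have -> : [set A : 'M[R]_n | Grn d A] = [set A | A^T = A] `&` [set A | A *m A = A] `&`
      (fun A => \tr A) @^-1` [set x | x = d%:R].
    apply/seteqP; split=> A /=; first by move=> /Grn_traceP[AT AA tA].
    by move=> [[AT AA] tA]; apply/Grn_traceP.
  have cid (A : 'M[R]_n) : id x @[x --> A] --> A by exact: cvg_id.
  apply: closedI; last first.
    apply: (closed_comp _ (@closed_eq _ _)) => A _.
    apply: (@cvg_rsum _ (nbhs A) _ _ _ _ (fun i (A : 'M[R]_n) => A i i)) => i _.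
    exact: coord_continuous.
  apply: closedI; apply: closed_eqfun => A.
  - by apply: (@cvg_trmx _ (nbhs A) _ _ _ id); exact: cid.
  - exact: cid.
  - by apply: (@cvg_mulmx _ (nbhs A) _ _ _ _ id id); exact: cid.
  - exact: cid.
by move=> A /= GA; rewrite /frobenius -/(fip A A) (Grn_fip_diag GA).
Qed.

Lemma nearest_exists d n (A : 'M[R]_n) : (exists P : 'M[R]_n, Grn d P) ->
  exists P, nearest d A P.
Proof.
move=> [P0 GP0].
have [||P] := @compact_EVT_min _ R (fun P : 'M[R]_n => frobenius (A - P)) _ _
  (@Grn_compact d n).
- by exists P0.
- apply: continuous_subspaceT => P.
  by apply: (@cvg_frobB _ (nbhs P) _ _ _ (fun=> A) id); [exact: cvg_cst|exact: cvg_id].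
rewrite inE /= => GP minP; exists P; split=> // Q GQ.
by apply: minP; rewrite inE.
Qed.

(* [C |-> |C^T C - 1|] is positive on the compact set of matrices of bounded norm
   at distance at least [z] from the orthogonal group. *)
Lemma near_orthogonal d (z : R) : 0 < z -> exists2 e, 0 < e &
  forall C : 'M[R]_d, frobenius (C^T *m C - 1%:M) < e ->
    exists2 Q : 'M[R]_d, Q^T *m Q = 1%:M & frobenius (Q - C) < z.
Proof.
move=> z0; pose far := [set C : 'M[R]_d | forall Q : 'M[R]_d,
  Q^T *m Q = 1%:M -> z <= frobenius (Q - C)].
pose g (C : 'M[R]_d) := frobenius (C^T *m C - 1%:M).
have cg : continuous g.
  move=> C; apply: (@cvg_frobB _ (nbhs C) _ _ _ (fun C => C^T *m C) (fun=> 1%:M)).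
    apply: (@cvg_mulmx _ (nbhs C) _ _ _ _ trmx id); last exact: cvg_id.
    by apply: (@cvg_trmx _ (nbhs C) _ _ _ id); exact: cvg_id.
  exact: cvg_cst.
have clf : closed far.
  have -> : far = \bigcap_(Q in [set Q : 'M[R]_d | Q^T *m Q = 1%:M])
     ((fun C => frobenius (Q - C)) @^-1` [set x | z <= x]).
    by apply/seteqP; split=> C /= fC Q QQ; exact: fC.
  apply: closed_bigI => Q _; apply: closed_comp (@closed_ge _ z) => C _.
  by apply: (@cvg_frobB _ (nbhs C) _ _ _ (fun=> Q) id); [exact: cvg_cst|exact: cvg_id].
(* [|C|^2] is the trace of [C^T C], at most [d + sqrt d] once [|C^T C - 1| <= 1]. Keeping the
   threshold below 1 therefore confines [C] to a compact ball. *)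
pose c : R := Num.sqrt (Num.sqrt d%:R + d%:R).
have small_bound C : g C <= 1 -> frobenius C <= c.
  move=> gC1; rewrite /frobenius ler_wsqrtr //.
  have f1 (M : 'M[R]_d) : fip 1%:M M = \tr M by rewrite /fip trmx1 mul1mx.
  have n1 : frobenius (1%:M : 'M[R]_d) = Num.sqrt d%:R.
    by rewrite /frobenius trmx1 mul1mx mxtrace1.
  have := fip_le 1%:M (C^T *m C - 1%:M).
  rewrite n1 f1 linearB /= mxtrace1 lerBlDr => /le_trans; apply.
  by rewrite lerD2r ler_piMr ?sqrtr_ge0.
have [far0|/nonemptyPn far0] := pselect (far `&` [set C | frobenius C <= c] !=set0).
  have cK := compact_closedI (@frob_bounded_compact d d c) clf.
  rewrite setIC in cK.
  have [C0 ] := @compact_EVT_min _ R g _ far0 cK (continuous_subspaceT cg).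
  rewrite inE => -[farC0 _] minC0.
  have gC0 : 0 < g C0.
    rewrite lt0r frob_ge0 andbT; apply/eqP => /frob_eq0/eqP; rewrite subr_eq0 => /eqP.
    by move=> /farC0; rewrite subrr frob0 leNgt z0.
  exists (Num.min (g C0) 1); first by rewrite lt_min gC0 ltr01.
  move=> C; rewrite lt_min => /andP[gC gC1]; apply: contrapT => nQ.
  have : g C0 <= g C; last by rewrite leNgt gC.
  apply: minC0; rewrite inE; split; last exact: small_bound (ltW gC1).
  by move=> Q QQ; rewrite leNgt; apply/negP => QC; apply: nQ; exists Q.
exists 1 => // C gC1; apply: contrapT => nQ.
suff : (far `&` [set C | frobenius C <= c]) C by rewrite far0.
split; last exact: small_bound (ltW gC1).
by move=> Q QQ; rewrite leNgt; apply/negP => QC; apply: nQ; exists Q.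
Qed.
End MatrixTopology.

(** * Homotopy classes *)

Section Homotopy.
Context {R : realType}.

Lemma continuous_pair (X Y Z : topologicalType) (f : X -> Y) (g : X -> Z) :
  continuous f -> continuous g -> continuous (fun x => (f x, g x)).
Proof. by move=> cf cg x; exact: (cvg_pair (cf x) (cg x)). Qed.

Lemma homotopic_refl (X Y : topologicalType) (f : X -> Y) :
  continuous f -> homotopic R f f.
Proof.
move=> cf; exists (fun p => f p.1); split => //.
apply: continuous_subspaceT => p; apply: continuous_comp; last exact: cf.
exact: cvg_fst.
Qed.

Lemma homotopic_compl (X Y Z : topologicalType) (f g : X -> Y) (q : Y -> Z) :
  continuous q -> homotopic R f g -> homotopic R (q \o f) (q \o g).
Proof.
move=> cq [H [cH H0 H1]]; exists (q \o H); split=> [|x|x] /=.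
- by move=> p; apply: (@continuous_comp (subspace _) Y Z H q); [exact: cH|exact: cq].
- by rewrite H0.
- by rewrite H1.
Qed.

Lemma within_comp (X Y Z : topologicalType) (A : set X) (B : set Y)
    (f : X -> Y) (g : Y -> Z) :
  {within A, continuous f} -> {within B, continuous g} ->
  (forall x, A x -> B (f x)) -> {within A, continuous (g \o f)}.
Proof.
move=> /subspace_continuousP cf /subspace_continuousP cg AB.
apply/subspace_continuousP => x Ax; apply: cvg_trans (cg _ (AB _ Ax)).
move=> S /= gS; have := cf x Ax _ gS; rewrite /nbhs /= => h.
have {}h : within A (nbhs x) (fun z => B (f z) -> S (g (f z))) by exact: h.
rewrite /within /= in h *; apply: filterS h => z Sz Az.
exact: Sz Az (AB _ Az).
Qed.

Lemma homotopic_compr (W X Y : topologicalType) (f g : X -> Y) (h : W -> X) :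
  continuous h -> homotopic R f g -> homotopic R (f \o h) (g \o h).
Proof.
move=> ch [H [cH H0 H1]]; exists (fun p => H (h p.1, p.2)); split=> [|x|x] /=.
- have ch' : continuous (fun p : W * R => (h p.1, p.2)).
    apply: continuous_pair => p; last exact: cvg_snd.
    by apply: continuous_comp; [exact: cvg_fst|exact: ch].
  by apply: (within_comp (continuous_subspaceT ch') cH) => -[x t] [].
- by rewrite H0.
- by rewrite H1.
Qed.

Lemma closed_setTX (X : topologicalType) (A : set R) :
  closed A -> closed ([set: X] `*` A).
Proof.
move=> cA; rewrite (_ : _ `*` _ = snd @^-1` A); last by apply/seteqP; split=> p // [].
by apply: closed_comp cA => p _; exact: cvg_snd.
Qed.

Lemma homotopic_trans (X Y : topologicalType) (f g k : X -> Y) :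
  homotopic R f g -> homotopic R g k -> homotopic R f k.
Proof.
move=> [H [cH H0 H1]] [G [cG G0 G1]].
pose K (p : X * R) := if p.2 <= 2^-1 then H (p.1, 2 * p.2) else G (p.1, 2 * p.2 - 1).
have half : 2 * 2^-1 = 1 :> R by rewrite divff.
exists K; split=> [|x|x]; last 2 first.
- by rewrite /K /= invr_ge0 ler0n mulr0 H0.
- rewrite /K /= ifF.
    by rewrite (_ : 2 * 1 - 1 = 1) ?G1 //; lra.
  by apply/negbTE; rewrite -ltNge invf_lt1 // ltr1n.
have -> : [set: X] `*` `[0, 1]%classic =
    ([set: X] `*` `[0, 2^-1]%classic) `|` ([set: X] `*` `[(2^-1 : R), 1]%classic).
  apply/seteqP; split=> -[x t] /=; rewrite !in_itv /=.
    by move=> [_ /andP[t0 t1]]; have [] := leP t 2^-1 => h; [left|right];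
      split => //; rewrite ?t0 ?t1 ?h ?(ltW h).
  have h1 : (2^-1 : R) <= 1 by rewrite invf_le1 // ler1n.
  have h0 : (0 : R) <= 2^-1 by rewrite invr_ge0.
  by move=> [[_ /andP[a b]]|[_ /andP[a b]]]; split => //;
   rewrite ?a ?b ?(le_trans a _) ?(le_trans b) ?(le_trans h0).
have cont2 (c : R) : continuous (fun p : X * R => (p.1, 2 * p.2 - c)).
  apply: continuous_pair => p; first exact: cvg_fst.
  by apply: cvgB; [apply: cvgM; [exact: cvg_cst|exact: cvg_snd]|exact: cvg_cst].
apply: withinU_continuous.
- by apply: closed_setTX; exact: itv_closed.
- by apply: closed_setTX; exact: itv_closed.
- apply: (@subspace_eq_continuous _ _ _ (H \o (fun p => (p.1, 2 * p.2 - 0)))).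
    move=> [x t]; rewrite inE /= => -[_]; rewrite in_itv /= => /andP[_ t2].
    by rewrite /from_subspace /K /= t2 subr0.
  apply: (within_comp (continuous_subspaceT (cont2 0)) cH) => -[x t] /= [_].
  rewrite !in_itv /= subr0 => /andP[t0 t1]; split=> //.
  by apply/andP; split; lra.
- apply: (@subspace_eq_continuous _ _ _ (G \o (fun p => (p.1, 2 * p.2 - 1)))).
    move=> [x t]; rewrite inE /= => -[_]; rewrite in_itv /= => /andP[t2 _].
    rewrite /from_subspace /K /=; case: ifPn => // t2'.
    have -> : t = 2^-1 by apply/eqP; rewrite eq_le t2 t2'.
    by rewrite half subrr G0 H1.
  apply: (within_comp (continuous_subspaceT (cont2 1)) cG) => -[x t] /= [_].
  rewrite !in_itv /= => /andP[t0 t1]; split=> //.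
  by apply/andP; split; lra.
Qed.

(** Both operators are unions over all representatives; transitivity of homotopy collapses them to
    the class of one composite. *)
Lemma hpull_hpush (B X Y Z : topologicalType) (h : B -> X) (q : Y -> Z) (f : X -> Y) :
  continuous h -> continuous q -> continuous f ->
  hpull R h (hpush R q (hclass R f)) = hclass R (q \o f \o h).
Proof.
move=> ch cq cf.
have cqf : continuous (q \o f) by move=> x; apply: continuous_comp; [exact: cf|exact: cq].
apply/seteqP; split=> [g|g [cg fg]].
  move=> [g2 [g1 [cg1 fg1] [cg2 g12]] [cg g2g]]; split=> //.
  apply: homotopic_trans g2g; apply: homotopic_compr => //.
  apply: homotopic_trans g12; exact: homotopic_compl.
exists (q \o f); last by split.
exists f; split=> //; exact: homotopic_refl.
Qed.
End Homotopy.

(** * The closest-point map on infinite matrices *)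

Section Padding.
Context {R : realType}.

Lemma fsbig_nat_ord n (f : nat -> R) : (forall a, (n <= a)%N -> f a = 0) ->
  \sum_(a \in [set: nat]) f a = \sum_(i < n) f i.
Proof.
move=> f0; rewrite fsbig_ord; apply/esym/fsbig_widen => // a /=.
by move=> [_ /negP]; rewrite -leqNgt => /f0.
Qed.

Lemma pad_mxE n (A : 'M[R]_n) (i j : 'I_n) : pad_mx A (i : nat, j : nat) = A i j.
Proof. by rewrite /= /pad_mx_fun /= !valK. Qed.

Lemma pad_mx_out n (A : 'M[R]_n) a b : ~~ ((a < n) && (b < n))%N -> pad_mx A (a, b) = 0.
Proof.
rewrite /= /pad_mx_fun /=; have [an|an] := ltnP a n; last by rewrite insubF // ltnNge an.
by move=> /= /negbTE bn; case: insub => // i; rewrite insubF.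
Qed.

Lemma pad_vecE n (x : 'cV[R]_n) (i : 'I_n) : pad_vec x i = x i ord0.
Proof. by rewrite /= /pad_vec_fun /= valK. Qed.

Lemma pad_vec_out n (x : 'cV[R]_n) a : (n <= a)%N -> pad_vec x a = 0.
Proof. by move=> na; rewrite /= /pad_vec_fun insubF // ltnNge na. Qed.

Lemma fsarray_ext (T : Type) (x y : fsarray R T) : (forall t, x t = y t) -> x = y.
Proof. by move=> xy; apply: val_inj; apply/funext. Qed.

Lemma pad_mx_eq n (A : 'M[R]_n) (x : Minf R) :
  (forall i j : 'I_n, x (i : nat, j : nat) = A i j) ->
  (forall a b, ~~ ((a < n) && (b < n))%N -> x (a, b) = 0) -> x = pad_mx A.
Proof.
move=> xA x0; apply: fsarray_ext => -[a b].
have [/andP[an bn]|ab] := boolP ((a < n) && (b < n))%N.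
  by rewrite (xA (Ordinal an) (Ordinal bn)) (pad_mxE A (Ordinal an) (Ordinal bn)).
by rewrite x0 // pad_mx_out.
Qed.

Lemma pad_mxB n (A B : 'M[R]_n) : pad_mx A - pad_mx B = pad_mx (A - B).
Proof.
apply: pad_mx_eq => [i j|a b ab].
  by rewrite -[LHS]/(pad_mx A _ - pad_mx B _) !pad_mxE !mxE.
by rewrite -[LHS]/(pad_mx A _ - pad_mx B _) !pad_mx_out ?subrr.
Qed.

Lemma frobenius_inf_pad n (A : 'M[R]_n) : frobenius_inf (pad_mx A) = frobenius A.
Proof.
rewrite /frobenius_inf /frobenius -/(fip A A) fipE; congr Num.sqrt.
rewrite (@fsbig_nat_ord n) => [|b nb]; last first.
  apply: fsbig1 => a _; rewrite pad_mx_out ?mul0r //.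
  by rewrite negb_and -!leqNgt nb orbT.
rewrite exchange_big; apply: eq_bigr => b _.
rewrite (@fsbig_nat_ord n) => [|a na]; last first.
  by rewrite pad_mx_out ?mul0r // negb_and -leqNgt na.
by apply: eq_bigr => a _; rewrite pad_mxE.
Qed.

Lemma pad_mx_widen n k (A : 'M[R]_n) : pad_mx (mx_widen k A) = pad_mx A.
Proof.
apply/esym/pad_mx_eq => [i j|a b]; last first.
  by move=> ab; rewrite pad_mx_out //; apply: contra ab => /andP[? ?];
     rewrite !ltn_addr.
case: (split_ordP i) => i' ->; case: (split_ordP j) => j' ->.
- by rewrite /mx_widen block_mxEul -(pad_mxE A).
- rewrite /mx_widen block_mxEur pad_mx_out ?mxE // negb_and -!leqNgt /=.
  by rewrite leq_addr orbT.
- by rewrite /mx_widen block_mxEdl pad_mx_out ?mxE // negb_and -!leqNgt /= leq_addr.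
- by rewrite /mx_widen block_mxEdr pad_mx_out ?mxE // negb_and -!leqNgt /= leq_addr.
Qed.

Lemma mx_widenB n k (A B : 'M[R]_n) :
  mx_widen k A - mx_widen k B = mx_widen k (A - B).
Proof. by rewrite /mx_widen opp_block_mx add_block_mx !subr0. Qed.

Lemma frob_widen n k (A : 'M[R]_n) : frobenius (mx_widen k A) = frobenius A.
Proof. by rewrite -!frobenius_inf_pad pad_mx_widen. Qed.

Lemma Grn_widen d n k (A : 'M[R]_n) : Grn d A -> Grn d (mx_widen k A).
Proof.
move=> /Grn_traceP[AT AA tA]; apply/Grn_traceP; rewrite /mx_widen; split.
- by rewrite tr_block_mx !trmx0 AT.
- by rewrite mulmx_block !mulmx0 !mul0mx !addr0 AA.
- by rewrite mxtrace_block mxtrace0 addr0.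
Qed.

Lemma Gr_inj d : injective (@Gr_val R d).
Proof.
move=> [x xP] [y yP] /= xy; subst y; congr MkGr; exact: Prop_irrelevance.
Qed.

Lemma Gr_stageE d n (P : 'M[R]_n) (GP : Grn d P) :
  exists Q : @Gr R d, Gr_val Q = pad_mx P.
Proof. by exists (MkGr (ex_intro _ n (ex_intro2 _ _ P GP erefl))). Qed.

(** The point lives at a size [m] unrelated to [n]; taking [k = m] brings it to a size that also
    contains the matrices under study. *)
Lemma Gr_lift d n (Q : @Gr R d) : exists k (Q' : 'M[R]_(n + k)),
  Grn d Q' /\ Gr_val Q = pad_mx Q'.
Proof.
case: Q => x [m [Q GQ xE]] /=; exists m; rewrite addnC.
by exists (mx_widen n Q); split; [exact: Grn_widen|rewrite pad_mx_widen].
Qed.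

(** * The closest point across matrix sizes *)

Section Closest.
Variables (d : nat) (e : R).
Hypothesis e34 : e * Num.sqrt 2 <= 3 / 4.

(** [nearest_widen] applies only to distances bounded by a number below 1. *)
Let e1 : e < 1.
Proof.
have s1 : 1 <= Num.sqrt 2 :> R by rewrite -{1}sqrtr1 ler_wsqrtr // ler1n.
have [e0|e0] := leP e 0; first exact: le_lt_trans e0 ltr01.
have : e <= e * Num.sqrt 2 by rewrite ler_pMr.
by move: e34 => h1 h2; lra.
Qed.

(** A competitor within [e] at a larger size forces the optimum there to be within [e] as well,
    hence to be a padded matrix of size [n]. *)
Lemma nearest_stable n (A : 'M[R]_n) k (Q : 'M[R]_(n + k)) :
  Grn d Q -> frobenius (mx_widen k A - Q) < e ->
  exists2 P, nearest d A P & frobenius (A - P) < e /\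
    nearest d (mx_widen k A) (mx_widen k P).
Proof.
move=> GQ AQ; have [P1 nP1] := @nearest_exists _ d _ (mx_widen k A) (ex_intro _ _ GQ).
have AP1 : frobenius (mx_widen k A - P1) < e := le_lt_trans (nP1.2 _ GQ) AQ.
have [P GP P1E] := nearest_widen nP1 (ltW AP1) e1.
exists P; last by rewrite -P1E -(frob_widen k) -mx_widenB -P1E.
split=> // P' GP'.
rewrite -(frob_widen k) -[leRHS](frob_widen k) -!mx_widenB -P1E.
exact/nP1.2/Grn_widen.
Qed.

(** Reduces the minimisation over all sizes to the one at the size of [A], where compactness and the
    Lipschitz bound are available. *)
Lemma closest_stage n (A : 'M[R]_n) (t : thickening d e) : val t = pad_mx A ->
  exists2 P, nearest d A P & frobenius (A - P) < e /\ Gr_val (closest d e t) = pad_mx P.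
Proof.
move=> tA; have [P0] := set_mem (valP t); rewrite tA.
have [k [Q [GQ ->]]] := Gr_lift n P0.
rewrite -(pad_mx_widen k) pad_mxB frobenius_inf_pad => AQ.
have [P nP [AP _]] := nearest_stable GQ AQ; exists P => //; split=> //.
have [GP minP] := nP.
(* A competitor at distance at least [e] loses to [P]; a nearer one is beaten by a projection of
   size [n], hence by [P]. *)
have far m (S : 'M[R]_(n + m)) : Grn d S ->
    frobenius (A - P) <= frobenius (mx_widen m A - S).
  move=> GS; have [AS|/(le_trans (ltW AP))//] := ltP (frobenius (mx_widen m A - S)) e.
  have [P' [GP' _] [_ [_ min']]] := nearest_stable GS AS.
  rewrite (le_trans (minP _ GP')) // -(frob_widen m) -mx_widenB.
  exact: min'.
have [P1 P1E] := Gr_stageE GP.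
suff : closest d e t = P1 by move=> ->.
(* [closest] is a [get], which would return a default value if no minimiser existed; existence and
   uniqueness together pin it down. *)
apply: get_unique => [|S Smin]; last first.
  have [m [S' [GS' SE]]] := Gr_lift n S; apply: Gr_inj; rewrite P1E SE -(pad_mx_widen m P).
  congr pad_mx.
  have nPm : nearest d (mx_widen m A) (mx_widen m P).
    split=> [|T GT]; first exact: Grn_widen.
    by rewrite mx_widenB frob_widen; exact: far.
  apply/esym/(nearest_unique nPm _ _ e34); last first.
    by rewrite mx_widenB frob_widen ltW.
  split=> // T GT; apply: le_trans (nPm.2 _ GT).
  have := Smin P1; rewrite tA SE P1E -(pad_mx_widen m A) -(pad_mx_widen m P).
  by rewrite !pad_mxB !frobenius_inf_pad.
move=> S /=; have [m [S' [GS' SE]]] := Gr_lift n S.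
rewrite tA P1E SE pad_mxB frobenius_inf_pad -(pad_mx_widen m A) pad_mxB.
by rewrite frobenius_inf_pad; exact: far.
Qed.

Lemma closest_continuous : continuous (closest d e : thickening d e -> Gr R d).
Proof.
apply/continuousP => U oU.
(* The thickening has the subspace topology, so the preimage must be the trace of an open set of
   [Minf R]. The preimage itself, seen in [Minf R], is open at every size. *)
exists [set x : Minf R | exists t : thickening d e, val t = x /\ U (closest d e t)].
  move=> n; rewrite openE => A /= [t [tA Ut]].
  have [P nP [AP cP]] := closest_stage tA.
  have [V oV VU] := oU n.
  have stage (S : 'M[R]_n) (c : Gr R d) : Grn d S -> Gr_val c = pad_mx S ->
      V S = U c.
    move=> GS cS; pose x : @Grn R d n := exist _ S (mem_set GS).
    have -> : c = Gr_stage x by apply: Gr_inj.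
    exact: (congr1 (@^~ x) VU).
  have VP : V P by rewrite (stage P _ nP.1 cP).
  have [z z0 zV] := nbhs_frob (open_nbhs_nbhs (conj oV VP)).
  (* The first radius compensates the Lipschitz constant 4, the second keeps [B] in the
     thickening. *)
  have m0 : 0 < Num.min (z / 4) (e - frobenius (A - P)).
    by rewrite lt_min divr_gt0 //= subr_gt0.
  apply: filterS (frob_nbhs A m0) => B; rewrite lt_min => /andP[B1 B2].
  have tB : pad_mx B \in thickening d e.
    rewrite inE; exists (closest d e t); rewrite cP pad_mxB frobenius_inf_pad.
    by rewrite (le_lt_trans (frobB_triangle _ A _)) // -ltrBrDr.
  pose t' : thickening d e := exist (fun x => x \in thickening d e) _ tB.
  exists t'; split=> //.
  have [P' nP' [AP' cP']] := @closest_stage n B t' erefl.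
  rewrite -(stage P' _ nP'.1 cP'); apply: zV.
  rewrite (le_lt_trans (nearest_lipschitz nP' (ltW AP') nP (ltW AP) e34)) //.
  by rewrite mulrC -ltr_pdivlMr.
apply/seteqP; split=> t /=; last by exists t.
by move=> [t' [/val_inj -> ]].
Qed.
End Closest.
End Padding.

(** * Topology of geometric realizations *)

Section FinalTopology.
Context (I : Type) (X : I -> topologicalType) (T : choiceType).
Variable f : forall i, X i -> T.

Lemma final_inj_continuous i : continuous (@f i : X i -> final_topology f).
Proof. by apply/continuousP => U oU; exact: oU. Qed.

Lemma final_continuous (Y : topologicalType) (g : final_topology f -> Y) :
  (forall i, continuous (g \o @f i)) -> continuous g.
Proof.
move=> cg; apply/continuousP => U oU.
change (@final_open _ _ _ f (g @^-1` U)) => i.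
exact: (proj1 (@continuousP (X i) Y (g \o @f i)) (cg i) U oU).
Qed.
End FinalTopology.

Section RealizationTopology.
Context {R : realType} {K : simplicial_complex}.
Implicit Types (s : {fset vertex K}) (v : vertex K).

Lemma bary_inj : injective (@bary R K).
Proof. move=> [x xP] [y yP] /= xy; subst y; congr MkReal; exact: Prop_irrelevance. Qed.

Lemma bary_continuous v : continuous (fun y : realization R K => y v).
Proof.
apply: final_continuous => s x.
apply: (@continuous_comp (simplex (val s)) {ptws vertex K -> R} R set_val (fun f => f v)).
  exact: initial_continuous.
exact: (@proj_continuous _ (fun _ => R) v).
Qed.

Lemma simplex_compact s : compact (simplex s : set {ptws vertex K -> R}).
Proof.
have cp v : continuous (fun f : {ptws vertex K -> R} => f v).
  exact: (@proj_continuous _ (fun _ => R) v).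
have c01 := @tychonoff (vertex K) (fun _ => R : topologicalType) (fun _ => `[0, 1]%classic)
  (fun _ => @segment_compact R 0 1).
apply: subclosed_compact c01 _.
  pose ev v (f : {ptws vertex K -> R}) : R := f v.
  have -> : simplex s =
     (\bigcap_(v in [set: vertex K]) ev v @^-1` [set r : R | 0 <= r]) `&`
     (\bigcap_(v in [set v | v \notin s]) ev v @^-1` [set r : R | r = 0]) `&`
     (fun f : {ptws vertex K -> R} => \sum_(v <- s) f v) @^-1` [set r : R | r = 1].
    apply/seteqP; split=> x /=.
      by move=> [x0 xs x1]; split=> //; split=> // v _; exact: x0.
    by move=> [[x0 xs] x1]; split=> // v; exact: x0.
  apply: closedI; first apply: closedI.
  - apply: closed_bigI => v _; apply: closed_comp (@closed_ge _ 0) => x _; exact: cp.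
  - apply: closed_bigI => v _; apply: closed_comp (@closed_eq _ 0) => x _; exact: cp.
  - apply: closed_comp (@closed_eq _ 1) => x _.
    apply: (@cvg_rsum _ _ (nbhs x) _ _ _ _ (fun v (f : {ptws vertex K -> R}) => f v)) => v _.
    exact: cp.
move=> x [x0 xs x1] v /=; rewrite in_itv /= x0 /=.
have [vs|/xs->//] := boolP (v \in s).
rewrite -x1 (big_fsetD1 v) //= lerDl; apply: sumr_ge0 => w _; exact: x0.
Qed.

Lemma simplex_image_compact s : face s ->
  compact [set y : realization R K | simplex s y].
Proof.
move=> fs.
pose x0 := pselect (exists y : realization R K, simplex s y).
case: x0 => [[y0 y0s]|n0]; last first.
  rewrite (_ : mkset _ = set0); first exact: compact0.
  by apply/seteqP; split=> y //= ys; apply: n0; exists y.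
pose s' : @face K := exist (fun s => s \in @face K) s (mem_set fs).
(* [of_simplex] is defined on a subtype; [y0] is the default value that extends it to all functions,
   hence the separate case without any point. *)
pose g : {ptws vertex K -> R} -> realization R K := valL_ y0 (@of_simplex R K s').
have cg : {within simplex s, continuous g}.
  apply/(@subspace_valL_continuousP' _ (simplex s)).
  exact: (@final_inj_continuous _ _ _ (@of_simplex R K) s').
have -> : [set y : realization R K | simplex s y] = g @` simplex s.
  have gE x (xs : simplex s x) :
      g x = @of_simplex R K s' (exist (fun x => x \in simplex s) x (mem_set xs)).
    rewrite /g /valL_ /= oinv_set_val.
    by rewrite (insubT (fun x => x \in simplex s) (mem_set xs)).
  apply/seteqP; split=> [y ys|_ [x xs <-]] /=.
    by exists (y : _ -> _) => //; rewrite gE; apply: bary_inj.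
  by rewrite gE.
apply: continuous_compact => //; exact: simplex_compact.
Qed.

Variable W : {fset vertex K}.
Hypothesis WT : forall v, v \in W.

Lemma realization_compact : compact [set: realization R K].
Proof.
pose C s := if pselect (face s) then [set y : realization R K | simplex s y] else set0.
have -> : [set: realization R K] = \big[setU/set0]_(s <- fpowerset W) C s.
  apply/seteqP; split=> // y _.
  have [s fs ys] := baryP y.
  rewrite -bigcup_seq; exists s; last by rewrite /C; case: pselect.
  by rewrite /= fpowersetE; apply/fsubsetP => v _; exact: WT.
apply: bigsetU_compact => s _; rewrite /C.
case: pselect => fs; last exact: compact0.
exact: simplex_image_compact.
Qed.

(* On a finite complex the direct limit topology is that of the coordinates: closed
   sets are compact, so their images in coordinate space are closed. *)
Lemma nbhs_bary (y : realization R K) (O : set (realization R K)) : nbhs y O ->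
  exists2 r : R, 0 < r & forall z : realization R K,
    (forall v, `|z v - y v| < r) -> O z.
Proof.
rewrite nbhsE => -[P [oP Py] PO].
pose e (z : realization R K) : 'cV[R]_#|{: W}| := \col_i z (val (enum_val i)).
have ce : continuous e.
  move=> z; apply: (@cvg_mx _ _ (nbhs z) _ _ _ e) => i j; rewrite mxE.
  under eq_cvg do rewrite mxE.
  exact: bary_continuous.
have einj z z' : e z = e z' -> z = z'.
  move=> /matrixP ez; apply: bary_inj; apply/funext => v.
  have := ez (enum_rank [` WT v]%fset) ord0; rewrite !mxE enum_rankK.
  by [].
have cC : compact (~` P).
  apply: (subclosed_compact _ realization_compact) => //; exact: open_closedC.
have clC : closed (e @` (~` P)).
  apply: compact_closed; first exact: norm_hausdorff.
  by apply: continuous_compact => //; exact: continuous_subspaceT.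
have : nbhs (e y) (~` (e @` (~` P))).
  apply: open_nbhs_nbhs; split; first exact: closed_openC.
  by move=> [z Oz /einj zy]; apply: Oz; rewrite zy.
move=> /nbhs_ballP[r r0 rO]; exists r => // z zy; apply: PO; apply: contrapT => Oz.
have := rO (e z) _; apply; last by exists z.
by split=> // i j; rewrite /ball /= !mxE distrC; exact: zy.
Qed.

Lemma continuous_bary (X : topologicalType) (g : X -> realization R K) :
  (forall v, continuous (fun x => g x v)) -> continuous g.
Proof.
move=> cg x O /nbhs_bary[r r0 rO].
have : \forall z \near x, forall v : W, `|g z (val v) - g x (val v)| < r.
  apply: filter_forall => v.
  by have /cvgr_distC_lt := cg (val v) x; apply.
apply: filterS => z zr; apply: rO => v; exact: (zr [` WT v]%fset).
Qed.
End RealizationTopology.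

(** * Decomposition of a function into layers *)

Section Layers.
Context {R : realType} {V : finType}.
Implicit Types (tau : {set V} -> R) (x : V -> R) (s : {set V}).

(* In the barycentric subdivision a point [y] with coordinates [y s] corresponds to
   [tau s = y s / #|s|]; then [layer_sum tau] gives its coordinates in the original
   complex. *)
Definition layered tau :=
  [/\ forall s, 0 <= tau s, tau finset.set0 = 0 &
      forall s t, tau s != 0 -> tau t != 0 -> (s \subset t) || (t \subset s)].

Definition layer_sum tau v : R := \sum_(s : {set V} | v \in s) tau s.

Definition supp x : {set V} := finset (fun v => x v != 0).

Lemma layer_sum_ge tau s v : layered tau -> v \in s -> tau s <= layer_sum tau v.
Proof.
move=> [t0 _ _] vs; rewrite /layer_sum (bigD1 s) //= lerDl.
by apply: sumr_ge0 => t _.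
Qed.

Lemma layered_sub tau s : layered tau -> tau s != 0 -> s \subset supp (layer_sum tau).
Proof.
move=> lt ts; apply/fintype.subsetP => v vs; rewrite inE gt_eqF //.
apply: lt_le_trans (layer_sum_ge lt vs).
by case: lt => t0 _ _; rewrite lt0r ts t0.
Qed.

Lemma layer_mass tau : \sum_v layer_sum tau v = \sum_(s : {set V}) #|s|%:R * tau s.
Proof.
rewrite /layer_sum (exchange_big_dep predT) //=; apply: eq_bigr => s _.
by rewrite sumr_const mulr_natl.
Qed.

(** The sets of nonzero weight form a chain whose largest member is the support. A vertex of it
    outside the second largest set lies in no other layer, so the sum there is the top weight
    alone. *)
Lemma layered_top tau : layered tau -> supp (layer_sum tau) != finset.set0 ->
  0 < tau (supp (layer_sum tau)) /\
  exists2 v, v \in supp (layer_sum tau) & layer_sum tau v = tau (supp (layer_sum tau)).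
Proof.
move=> lt; have [t0 te tc] := lt; set S := supp _ => S0.
have max_in (P : pred {set V}) s0 : tau s0 != 0 -> P s0 ->
    exists2 s, (tau s != 0) && P s & forall t, tau t != 0 -> P t -> t \subset s.
  move=> ts0 Ps0.
  pose Q s := (tau s != 0) && P s.
  have Q0 : Q s0 by rewrite /Q ts0.
  case: (@arg_maxnP _ s0 Q (fun s : {set V} => #|s|) Q0) => s /andP[ts Ps] smax.
  exists s; first by rewrite ts.
  move=> t tt Pt; have /orP[//|st] := tc _ _ tt ts.
  have := smax t; rewrite /Q tt Pt => /(_ isT) ts_le.
  by have /eqP -> : s == t by rewrite eqEcard st.
have /set0Pn[v0] := S0; rewrite inE => v0S.
have [s1 ts1 v0s1] : exists2 s, tau s != 0 & v0 \in s.
  apply: contrapT => ns; move/eqP: v0S; apply; apply: big1 => s v0s.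
  by apply/eqP/negPn/negP => ts; apply: ns; exists s.
have [top /andP[ttop _] topmax] := max_in predT s1 ts1 isT.
have SE : S = top.
  apply/eqP; rewrite finset.eqEsubset layered_sub // andbT.
  apply/fintype.subsetP => v; rewrite inE; apply: contraNT => vtop.
  apply/eqP/big1 => s vs; apply/eqP/negPn/negP => ts.
  by move/negP: vtop; apply; exact: (fintype.subsetP (topmax s ts isT)).
rewrite SE; split; first by rewrite lt0r ttop t0.
have topE v : v \in top -> (forall s, v \in s -> s != top -> tau s = 0) ->
    layer_sum tau v = tau top.
  move=> vt rest; rewrite /layer_sum (bigD1 top) //= big1 ?addr0 // => s /andP[vs st].
  exact: rest.
have [[s2 [ts2 s2top]]|none] := pselect (exists s2, tau s2 != 0 /\ s2 != top).
  have [s3 /andP[ts3 s3top] max3] := max_in (fun s => s != top) s2 ts2 s2top.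
  have /subsetPn[v vtop vs3] : ~~ (top \subset s3).
    apply: contra s3top => ts; rewrite finset.eqEsubset ts andbT.
    exact: topmax.
  exists v => //; apply: topE => // s vs st; apply/eqP/negPn/negP => ts.
  by move/negP: vs3; apply; exact: (fintype.subsetP (max3 s ts st)).
have vtop : v0 \in top by rewrite -SE inE.
exists v0 => //; apply: topE => // s vs st; apply/eqP/negPn/negP => ts.
by apply: none; exists s.
Qed.

Lemma layered0 tau : layered tau -> supp (layer_sum tau) = finset.set0 ->
  forall s, tau s = 0.
Proof.
move=> lt S0 s; apply/eqP/negPn/negP => ts.
have := layered_sub lt ts; rewrite S0 finset.subset0 => /eqP s0.
by move/eqP: ts; apply; rewrite s0; case: lt.
Qed.

Lemma layer_drop tau T : layered tau ->
  layered (fun s => if s == T then 0 else tau s) /\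
  forall v, layer_sum (fun s => if s == T then 0 else tau s) v =
    layer_sum tau v - (if v \in T then tau T else 0).
Proof.
move=> [t0 te tc]; split.
  split=> [s||s t]; [by case: ifP|by case: ifP|].
  by case: ifP; rewrite ?eqxx //; case: ifP; rewrite ?eqxx // => _ _; exact: tc.
move=> v; rewrite /layer_sum; case: ifPn => vT.
  rewrite [X in _ = X - _](bigD1 T) //= addrAC subrr add0r (bigD1 T) //= eqxx add0r.
  by apply: eq_bigr => s /andP[_ /negbTE->].
rewrite subr0; apply: eq_bigr => s vs; case: eqP => // sT.
by rewrite -sT vs in vT.
Qed.

(* The top layer has the support of the sum as its set and the least positive value
   of the sum as its weight, so layers can be peeled off one by one. *)
Lemma layer_inj tau tau' : layered tau -> layered tau' ->
  layer_sum tau =1 layer_sum tau' -> tau =1 tau'.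
Proof.
have [n] := ubnP #|supp (layer_sum tau)|.
elim: n => // n IHn in tau tau' *; rewrite ltnS => Sn lt lt' tt'.
have ltE : layer_sum tau = layer_sum tau' by apply/funext.
have [S0|S0] := eqVneq (supp (layer_sum tau)) finset.set0.
  by move=> s; rewrite (layered0 lt) // (layered0 lt') // -ltE.
have [] := layered_top lt S0; set T := supp _ in Sn S0 * => tT [v vT vE].
have [] := @layered_top tau' lt'; rewrite -ltE // -/T => t'T [v' v'T v'E].
have TT : tau T = tau' T.
  apply/eqP; rewrite eq_le -{1}v'E -{2}vE layer_sum_ge //= ltE.
  exact: layer_sum_ge.
have [ld ldE] := layer_drop T lt; have [ld' ldE'] := layer_drop T lt'.
move=> s; have [->//|sT] := eqVneq s T.
have := IHn _ _ _ ld ld' _ s; rewrite (negbTE sT); apply.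
  apply: leq_trans Sn; apply: proper_card; apply/properP; split.
    apply/fintype.subsetP => w; rewrite !inE ldE; apply: contraNN => /eqP w0.
    by rewrite w0; case: ifP; rewrite ?inE ?w0 ?eqxx ?subrr.
  by exists v => //; rewrite inE ldE vT vE subrr eqxx.
by move=> w; rewrite ldE ldE' TT ltE.
Qed.

(** Greedy construction: the least positive value of [x] becomes the weight of its support;
    subtracting it leaves a strictly smaller support, and all further layers lie inside that one. *)
Lemma layer_surj x : (forall v, 0 <= x v) ->
  exists2 tau, layered tau & forall v, layer_sum tau v = x v.
Proof.
have [n] := ubnP #|supp x|; elim: n => // n IHn in x *; rewrite ltnS => xn x0.
have [S0|/set0Pn[v0 v0S]] := eqVneq (supp x) finset.set0.
  exists (fun=> 0); first by split=> // s t; rewrite eqxx.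
  move=> v; rewrite /layer_sum big1 //; apply/esym/eqP/negPn/negP => xv.
  by have := finset.in_set0 v; rewrite -S0 inE xv.
set T := supp x in v0S *.
case: (@Order.TotalTheory.arg_minP _ _ _ v0 (fun v => v \in T) x v0S) => v vT vmin.
have xv0 : 0 < x v by rewrite lt0r x0 andbT; move: vT; rewrite inE.
pose x' w := x w - (if w \in T then x v else 0).
have x'0 w : 0 <= x' w.
  by rewrite /x'; case: ifPn => [/vmin|_]; rewrite ?subr0 ?subr_ge0.
have x'T w : w \notin T -> x' w = 0.
  by move=> wT; rewrite /x' (negbTE wT) subr0; move: wT; rewrite inE negbK => /eqP.
have x'v : x' v = 0 by rewrite /x' vT subrr.
have sT : supp x' \proper T.
  apply/properP; split.
    by apply/fintype.subsetP => w; rewrite [in X in X -> _]inE; apply: contraNT => /x'T ->.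
  by exists v => //; rewrite inE x'v eqxx.
have [tau lt tE] := IHn x' (leq_trans (proper_card sT) xn) x'0.
have tEx : layer_sum tau = x' by apply/funext.
have sub s : tau s != 0 -> s \subset T.
  move=> ts; apply: fintype.subset_trans (fintype.proper_sub sT).
  by have := layered_sub lt ts; rewrite tEx.
have tT : tau T = 0.
  apply/eqP/negPn/negP => tT; have := layered_sub lt tT; rewrite tEx => Ts.
  by have := fintype.proper_sub_trans sT Ts; rewrite fintype.properxx.
have [t0 te tc] := lt.
exists (fun s => if s == T then x v else tau s).
  split=> [s||s t].
  - by case: ifP => // _; exact: ltW.
  - by case: eqP => // T0; rewrite -T0 inE in v0S.
  - case: (eqVneq s T) => [->|sT']; case: (eqVneq t T) => [->|tT'].
    + by rewrite fintype.subxx.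
    + by move=> _ /sub ->; rewrite orbT.
    + by move=> /sub ->.
    + exact: tc.
move=> w; transitivity (x' w + (if w \in T then x v else 0)); last by rewrite subrK.
rewrite -tE /layer_sum; case: ifPn => wT.
  rewrite (bigD1 T) //= eqxx [in RHS](bigD1 T) //= tT add0r addrC; congr (_ + _).
  by apply: eq_bigr => s /andP[_ /negbTE->].
rewrite addr0; apply: eq_bigr => s ws; case: eqP => // sTE.
by rewrite -sTE ws in wT.
Qed.
End Layers.

(** * Finite complexes and barycentric subdivision *)

Lemma continuous_rsum (R : realType) (X : topologicalType) (I : Type) (r : seq I)
    (P : pred I) (f : I -> X -> R) :
  (forall i, P i -> continuous (f i)) -> continuous (fun x => \sum_(i <- r | P i) f i x).
Proof. by move=> cf x; apply: (@cvg_rsum _ _ (nbhs x)) => i Pi; exact: cf. Qed.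

Lemma sum_fset (R : realType) (T : finType) (s : {fset T}) (x : T -> R) :
  (forall v, v \notin s -> x v = 0) -> \sum_(v <- s) x v = \sum_v x v.
Proof.
move=> xs; rewrite [RHS](bigID (fun v => v \in s)) /= [X in _ + X]big1 ?addr0; last exact: xs.
rewrite -[RHS]big_filter; apply: perm_big; apply: uniq_perm.
- exact: fset_uniq.
- by rewrite filter_uniq // index_enum_uniq.
- by move=> v; rewrite mem_filter mem_index_enum andbT.
Qed.

Lemma fsbig_finType (R : realType) (T : finType) (x : T -> R) :
  \sum_(v \in [set: T]) x v = \sum_v x v.
Proof.
rewrite (@fsbigTE _ _ _ _ [fset v in T]%fset) => [|v]; last by rewrite inE.
by apply: sum_fset => v; rewrite inE.
Qed.

(** Boolean faces on a finite vertex type make the faces a finite type, so the barycentric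
    subdivision is again of this kind and can be iterated. *)
Record fcomplex := FComplex {
  fvert : finType;
  fface : {set fvert} -> bool;
  fface1 : forall v, fface (finset.set1 v);
  fface0 : fface finset.set0 = false;
  ffaceS : forall s t : {set fvert},
    fface s -> t \subset s -> t != finset.set0 -> fface t }.

Definition fset_finset (V : finType) (s : {fset V}) : {set V} := finset (fun v => v \in s).

Section ComplexOf.
Variable K : fcomplex.

Definition sc_face : set {fset fvert K} := [set s | fface (fset_finset s)].

Fact sc_face_vertex (v : fvert K) : sc_face [fset v]%fset.
Proof.
rewrite /sc_face /= (_ : fset_finset _ = finset.set1 v) ?fface1 //.
by apply/finset.setP => w; rewrite !inE.
Qed.

Fact sc_face_nonempty : ~ sc_face fset0.
Proof.
rewrite /sc_face /= (_ : fset_finset _ = finset.set0); first by rewrite fface0.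
by apply/finset.setP => w; rewrite !inE.
Qed.

Fact sc_face_sub (s t : {fset fvert K}) :
  sc_face s -> (t `<=` s)%fset -> t != fset0 -> sc_face t.
Proof.
move=> fs /fsubsetP ts /fset0Pn[v vt]; apply: (ffaceS fs).
  by apply/fintype.subsetP => w; rewrite !inE; exact: ts.
by apply/set0Pn; exists v; rewrite inE.
Qed.

Definition sc_of : simplicial_complex :=
  SimplicialComplex sc_face_vertex sc_face_nonempty sc_face_sub.

Context {R : realType}.

Lemma real_ge0 (y : realization R sc_of) (v : fvert K) : 0 <= y v.
Proof. by have [s _ []] := baryP y. Qed.

Lemma real_sum (y : realization R sc_of) : \sum_(v : fvert K) y v = 1.
Proof. by have [s _ [_ ys <-]] := baryP y; rewrite sum_fset. Qed.

Lemma real_supp (y : realization R sc_of) : fface (supp (y : fvert K -> R)).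
Proof.
have [s fs [y0 ys y1]] := baryP y; apply: (ffaceS fs).
  apply/fintype.subsetP => v; rewrite !inE; apply: contraNT => /ys.
  by move=> ->.
apply/negP => /eqP S0; have := real_sum y; rewrite big1 => [/eqP|v _].
  by rewrite eq_sym oner_eq0.
by have := finset.in_set0 v; rewrite -S0 inE => /negbFE/eqP.
Qed.

Fact real_mk_subproof (x : fvert K -> R) : (forall v, 0 <= x v) ->
  \sum_v x v = 1 -> fface (supp x) ->
  exists2 s, @face sc_of s & simplex s (x : vertex sc_of -> R).
Proof.
move=> x0 x1 fx; exists [fset v in supp x]%fset.
  rewrite /= /sc_face /= (_ : fset_finset _ = supp x) //.
  by apply/finset.setP => v; rewrite !inE.
have xs v : v \notin [fset v in supp x]%fset -> x v = 0.
  by rewrite !inE negbK => /eqP.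
by split=> //; rewrite sum_fset.
Qed.

Definition real_mk (x : fvert K -> R) x0 x1 fx : realization R sc_of :=
  MkReal (@real_mk_subproof x x0 x1 fx).

Lemma continuous_sc (X : topologicalType) (g : X -> realization R sc_of) :
  (forall v : fvert K, continuous (fun x => g x v)) -> continuous g.
Proof.
by apply: (@continuous_bary R sc_of [fset v in fvert K]%fset) => v; rewrite inE.
Qed.

Lemma sc_compact : compact [set: realization R sc_of].
Proof.
by apply: (@realization_compact R sc_of [fset v in fvert K]%fset) => v; rewrite inE.
Qed.

Lemma real_hausdorff : hausdorff_space (realization R sc_of).
Proof.
move=> p q cpq; apply: bary_inj; apply/funext => v.
apply: (@norm_hausdorff _ R) => A B pA qB.
have [z [Az Bz]] := cpq _ _ (@bary_continuous R sc_of v p A pA)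
  (@bary_continuous R sc_of v q B qB).
by exists (z v).
Qed.
End ComplexOf.

Lemma compact_bij_homeo (X Y : topologicalType) (f : X -> Y) (k : Y -> X) :
  compact [set: X] -> hausdorff_space Y -> continuous f -> cancel f k -> cancel k f ->
  continuous k.
Proof.
move=> cX hY cf fk kf; apply/continuous_closedP => C clC.
have -> : k @^-1` C = f @` C.
  apply/seteqP; split=> [y Cy|_ [x Cx <-]]; last by rewrite /= fk.
  by exists (k y).
apply: compact_closed => //; apply: continuous_compact.
  exact: continuous_subspaceT.
exact: subclosed_compact cX _.
Qed.

Section Subdivision.
Variable K : fcomplex.
Local Notation V := (fvert K).

Definition sd_vert := {s : {set V} | fface s}.

Definition sd_face (c : {set sd_vert}) : bool :=
  (c != finset.set0) &&
  [forall s in c, forall t in c, (val s \subset val t) || (val t \subset val s)].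

Fact sd_face1 (v : sd_vert) : sd_face (finset.set1 v).
Proof.
apply/andP; split; first by apply/set0Pn; exists v; rewrite inE.
apply/forall_inP => s; rewrite inE => /eqP->; apply/forall_inP => t.
by rewrite inE => /eqP->; rewrite fintype.subxx.
Qed.

Fact sd_face0 : sd_face finset.set0 = false.
Proof. by rewrite /sd_face eqxx. Qed.

Fact sd_faceS (s t : {set sd_vert}) :
  sd_face s -> t \subset s -> t != finset.set0 -> sd_face t.
Proof.
move=> /andP[_ /forall_inP cs] /fintype.subsetP ts t0; rewrite /sd_face t0 /=.
apply/forall_inP => a at_; apply/forall_inP => b bt.
by have /forall_inP := cs a (ts _ at_); apply; exact: ts.
Qed.

Definition sd : fcomplex := FComplex sd_face1 sd_face0 sd_faceS.

Context {R : realType}.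

Lemma card_face_gt0 (s : sd_vert) : 0 < #|val s|%:R :> R.
Proof.
rewrite ltr0n card_gt0; apply/negP => /eqP s0.
by have := valP s; rewrite s0 fface0.
Qed.

Definition sd_layer (y : fvert sd -> R) (s : {set V}) : R :=
  if (insub s : option sd_vert) is Some s' then y s' / #|s|%:R else 0.

Lemma sd_layerE (y : fvert sd -> R) (s : sd_vert) :
  sd_layer y (val s) = y s / #|val s|%:R.
Proof. by rewrite /sd_layer valK. Qed.

Lemma sd_layer_neq0 (y : fvert sd -> R) s : sd_layer y s != 0 ->
  exists2 s' : sd_vert, val s' = s & y s' != 0.
Proof.
rewrite /sd_layer; case: insubP => [s' _ s'E|]; last by rewrite eqxx.
rewrite mulf_eq0 negb_or => /andP[ys _].
by exists s'.
Qed.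

Lemma layered_sd (y : realization R (sc_of sd)) : layered (sd_layer y).
Proof.
split.
- move=> s; rewrite /sd_layer; case: insubP => // s' _ _.
  by rewrite divr_ge0 // real_ge0.
- apply/eqP/negPn/negP => /sd_layer_neq0[s' s'0 _].
  by have := valP s'; rewrite s'0 fface0.
- move=> _ _ /sd_layer_neq0[s <- ys] /sd_layer_neq0[t <- yt].
  have /andP[_ /forall_inP h] := real_supp y.
  have sS : s \in supp (y : fvert sd -> R) by rewrite inE.
  by have /forall_inP := h s sS; apply; rewrite inE.
Qed.

Lemma sum_faces (P : pred {set V}) (F : {set V} -> R) :
  (forall s, ~~ fface s -> F s = 0) ->
  \sum_(s | P s) F s = \sum_(s : sd_vert | P (val s)) F (val s).
Proof.
move=> F0; rewrite (bigID (fun s => fface s)) /= [X in _ + X]big1 ?addr0; last first.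
  by move=> s /andP[_ /F0].
rewrite (reindex_omap (val : sd_vert -> {set V}) insub) /=; last first.
  by move=> s /andP[_ fs]; rewrite insubT.
by apply: eq_bigl => s; rewrite valK eqxx andbT (valP s) andbT.
Qed.

Lemma sd_layer_face (y : fvert sd -> R) s : ~~ fface s -> sd_layer y s = 0.
Proof. by move=> nf; rewrite /sd_layer insubF //; exact: negbTE. Qed.

Lemma sd_layer_sum (y : fvert sd -> R) v :
  layer_sum (sd_layer y) v = \sum_(s : sd_vert | v \in val s) y s / #|val s|%:R.
Proof.
rewrite /layer_sum sum_faces => [|s]; last exact: sd_layer_face.
by apply: eq_bigr => s _; rewrite sd_layerE.
Qed.

Lemma sd_layer_mass (y : fvert sd -> R) :
  \sum_v layer_sum (sd_layer y) v = \sum_(s : sd_vert) y s.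
Proof.
rewrite layer_mass (@sum_faces predT) => [|s /sd_layer_face ->]; last by rewrite mulr0.
apply: eq_bigr => s _; rewrite sd_layerE mulrC divfK // gt_eqF //.
exact: card_face_gt0.
Qed.

Lemma sum1_supp (x : V -> R) : \sum_v x v = 1 -> supp x != finset.set0.
Proof.
move=> x1; apply/negP => /eqP S0; move: x1; rewrite big1 => [/eqP|v _].
  by rewrite eq_sym oner_eq0.
by have := finset.in_set0 v; rewrite -S0 inE => /negbFE/eqP.
Qed.

Lemma sd_map_ge0 (y : realization R (sc_of sd)) v : 0 <= layer_sum (sd_layer y) v.
Proof. by apply: sumr_ge0 => s _; have [] := layered_sd y. Qed.

Lemma sd_map_sum (y : realization R (sc_of sd)) : \sum_v layer_sum (sd_layer y) v = 1.
Proof. by rewrite sd_layer_mass; exact: (real_sum y). Qed.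

Lemma sd_map_supp (y : realization R (sc_of sd)) : fface (supp (layer_sum (sd_layer y))).
Proof.
have [t0 _] := layered_top (layered_sd y) (sum1_supp (sd_map_sum y)).
have [|s <- _] := @sd_layer_neq0 y (supp (layer_sum (sd_layer y))).
  by rewrite gt_eqF.
exact: valP.
Qed.

(** Written from the subdivision to the original complex, the direction in which it is linear in the
    coordinates; the inverse comes from bijectivity and its continuity from compactness. *)
Definition sd_map (y : realization R (sc_of sd)) : realization R (sc_of K) :=
  real_mk (sd_map_ge0 y) (sd_map_sum y) (sd_map_supp y).

Lemma sd_map_continuous : continuous sd_map.
Proof.
apply: continuous_sc => v.
rewrite (_ : (fun _ => _) = fun y : realization R (sc_of sd) =>
  \sum_(s : sd_vert | v \in val s) y s / #|val s|%:R); last first.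
  by apply/funext => y; exact: sd_layer_sum.
apply: continuous_rsum => s _ y.
by apply: cvgM (@bary_continuous R (sc_of sd) s y) _; apply: cvg_cst.
Qed.

Lemma sd_map_inj : injective sd_map.
Proof.
move=> y z /(congr1 (@bary R _)) /= yz; apply: bary_inj; apply/funext => s.
have := layer_inj (layered_sd y) (layered_sd z) (fun v => congr1 (@^~ v) yz) (val s).
rewrite !sd_layerE; apply: mulIf; rewrite invr_eq0 gt_eqF //.
exact: card_face_gt0.
Qed.

Lemma sd_map_surj (x : realization R (sc_of K)) : exists y, sd_map y = x.
Proof.
have [tau lt tE] := layer_surj (real_ge0 x).
have tEx : layer_sum tau = x by apply/funext.
have face_tau s : tau s != 0 -> fface s.
  move=> ts; apply: (ffaceS (real_supp x)).
    by have := layered_sub lt ts; rewrite tEx.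
  by apply: contraNN ts => /eqP ->; case: lt => _ -> _.
have ntau s : ~~ fface s -> tau s = 0.
  by move=> nf; apply/eqP/negPn/negP => /face_tau fs; rewrite fs in nf.
pose y (s : fvert sd) : R := #|val s|%:R * tau (val s).
have [t0 te tc] := lt.
have y0 s : 0 <= y s by rewrite mulr_ge0.
have y1 : \sum_s y s = 1.
  rewrite -(real_sum x) -tEx layer_mass (@sum_faces predT) // => s /ntau ->.
  by rewrite mulr0.
have yn0 s : y s != 0 -> tau (val s) != 0.
  by rewrite mulf_eq0 negb_or => /andP[].
have fy : sd_face (supp y).
  apply/andP; split.
    apply/negP => /eqP S0; move: y1; rewrite big1 => [/eqP|s _].
      by rewrite eq_sym oner_eq0.
    by have := finset.in_set0 s; rewrite -S0 inE => /negbFE/eqP.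
  apply/forall_inP => s; rewrite inE => /yn0 ys.
  by apply/forall_inP => t; rewrite inE => /yn0 yt; exact: tc.
exists (@real_mk sd R y y0 y1 fy); apply: bary_inj; apply/funext => v /=.
rewrite -tE; congr layer_sum; apply/funext => s.
have [fs|nf] := boolP (fface s); last by rewrite sd_layer_face // ntau.
pose s' : sd_vert := exist _ s fs.
rewrite -[s]/(val s') sd_layerE /y mulrC mulKf // gt_eqF //; exact: card_face_gt0.
Qed.

Lemma sd_homeomorphism : exists2 g : realization R (sc_of K) -> realization R (sc_of sd),
  homeomorphism g & forall (x : realization R (sc_of K)) (v : V),
    x v = \sum_(s : sd_vert | v \in val s) g x s / #|val s|%:R.
Proof.
have [g gK] := choice sd_map_surj.
have Kg : cancel sd_map g by move=> y; apply: sd_map_inj; rewrite gK.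
exists g; last by move=> x v; rewrite -{1}(gK x) /= sd_layer_sum.
split; last by exists sd_map; split => //; exact: sd_map_continuous.
apply: (compact_bij_homeo _ _ sd_map_continuous) => //.
  exact: sc_compact.
exact: real_hausdorff.
Qed.

(** * Mesh of the barycentric subdivision *)

Section Mesh.
Context {I : Type} (m : nat).
Hypothesis Km : forall s : {set V}, fface s -> (#|s| <= m.+1)%N.

Lemma sd_card (c : {set sd_vert}) : sd_face c -> (#|c| <= m.+1)%N.
Proof.
move=> /andP[_ /forall_inP cc].
have cardK (s : sd_vert) : (#|val s|.-1 < m.+1)%N.
  by have := Km (valP s); case: #|val s| => // k; exact: ltnW.
(* Along a chain the cardinality is injective; faces are nonempty, so the predecessors of their
   cardinalities range over [m + 1] values. *)
pose f (s : sd_vert) : 'I_m.+1 := Ordinal (cardK s).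
have finj : {in c &, injective f}.
  move=> s t sc tc /(congr1 val) /= st; apply: val_inj.
  have s0 := card_face_gt0 s; have t0 := card_face_gt0 t; rewrite !ltr0n in s0 t0.
  have {}st : #|val s| = #|val t| by rewrite -(prednK s0) -(prednK t0) st.
  have /forall_inP/(_ t tc)/orP[h|h] := cc s sc.
    by apply/eqP; rewrite finset.eqEcard h st leqnn.
  by apply/esym/eqP; rewrite finset.eqEcard h st leqnn.
by rewrite -(card_in_imset finj) (leq_trans (max_card _)) // card_ord.
Qed.

(** [p v] is the position of [v] in a space with coordinates indexed by [I]; the mesh is measured in
    the sup norm. *)
Definition mesh_le (p : V -> I -> R) D := forall s, fface s ->
  forall v w, v \in s -> w \in s -> forall i, `|p v i - p w i| <= D.

Definition sd_pos (p : V -> I -> R) (s : sd_vert) i : R :=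
  (\sum_(v in val s) p v i) / #|val s|%:R.

(* For faces [s] and [t] with [s] contained in [t], the difference of the averages of
   [p] is an average of differences over pairs, among which those on the diagonal of
   [s] vanish. *)
Lemma sd_mesh p D : mesh_le p D ->
  forall c, sd_face c -> forall s t, s \in c -> t \in c -> forall i,
  `|sd_pos p s i - sd_pos p t i| <= D * (m%:R / m.+1%:R).
Proof.
move=> pD c /andP[_ /forall_inP cc] s t sc tc i.
wlog st : s t sc tc / val s \subset val t.
  by move=> h; have /forall_inP/(_ t tc)/orP[st|ts] := cc s sc; [|rewrite distrC]; exact: h.
have s0 := card_face_gt0 s; have t0 := card_face_gt0 t.
have D0 : 0 <= D.
  have : val t != finset.set0 by rewrite -card_gt0 -(ltr0n R).
  move=> /set0Pn[v vt].
  by have := pD _ (valP t) v v vt vt i; rewrite subrr normr0.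
set a := #|val s|%:R in s0; set b := #|val t|%:R in t0.
have -> : sd_pos p s i - sd_pos p t i =
    (\sum_(v in val s) \sum_(w in val t) (p v i - p w i)) / (a * b).
  rewrite /sd_pos -/a -/b.
  have inner v : \sum_(w in val t) (p v i - p w i) = p v i * b - \sum_(w in val t) p w i.
    by rewrite sumrB sumr_const -mulr_natr.
  rewrite [in RHS](eq_bigr _ (fun v _ => inner v)) sumrB -mulr_suml.
  rewrite [X in _ = (_ - X) / _]sumr_const -mulr_natr -/a.
  by field; rewrite !gt_eqF.
have le1 v : v \in val s -> `|\sum_(w in val t) (p v i - p w i)| <= (b - 1) * D.
  move=> vs; have vt := fintype.subsetP st v vs.
  rewrite (bigD1 v) //= subrr add0r (le_trans (ler_norm_sum _ _ _)) //.
  apply: (@le_trans _ _ (\sum_(w in val t | w != v) D)).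
    by apply: ler_sum => w /andP[wt _]; exact: (pD _ (valP t)).
  have bE : b = 1 + #|val t :\ v|%:R by rewrite /b (finset.cardsD1 v) vt natrD.
  rewrite sumr_const -mulr_natl ler_wpM2r // bE addrC addKr ler_nat subset_leq_card //.
  by apply/fintype.subsetP => w; rewrite !inE => /andP[-> ->].
rewrite normrM [X in _ * X <= _]ger0_norm ?invr_ge0 ?mulr_ge0 // ?(ltW s0) ?(ltW t0) //.
rewrite ler_pdivrMr ?mulr_gt0 // (le_trans (ler_norm_sum _ _ _)) //.
apply: (@le_trans _ _ (\sum_(v in val s) (b - 1) * D)); first exact: ler_sum.
rewrite sumr_const -[X in X <= _]mulr_natl -/a.
(* [(b - 1) / b] increases with [b], so [b <= m + 1] bounds it by the contraction factor
   [m / (m + 1)]. *)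
have bm : b <= m.+1%:R by rewrite ler_nat; exact: Km (valP t).
have m0 : 0 < m.+1%:R :> R by rewrite ltr0n.
have -> : D * (m%:R / m.+1%:R) * (a * b) = a * D * (b * m%:R / m.+1%:R) by ring.
rewrite [X in X <= _](_ : _ = a * D * (b - 1)); last by ring.
rewrite ler_wpM2l ?mulr_ge0 ?(ltW s0) //.
rewrite ler_pdivlMr //; move: bm; rewrite -natr1 => bm; nra.
Qed.

(** A vertex of the subdivision sits at the barycentre of its face, so positions extend to the same
    map before and after subdivision. Original coordinates can thus be read off after any number of
    steps. *)
Lemma sd_pos_sum p (g : realization R (sc_of K) -> realization R (sc_of sd)) :
  (forall (x : realization R (sc_of K)) (v : V),
    x v = \sum_(s : sd_vert | v \in val s) g x s / #|val s|%:R) ->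
  forall x i, \sum_(s : sd_vert) g x s * sd_pos p s i = \sum_v x v * p v i.
Proof.
move=> gE x i; under [RHS]eq_bigr do rewrite gE mulr_suml.
rewrite (exchange_big_dep predT) //=; apply: eq_bigr => s _.
by rewrite /sd_pos mulrCA mulr_suml; apply: eq_bigr => v _; rewrite mulrC.
Qed.
End Mesh.
End Subdivision.

(** * Fine triangulations *)

Lemma homeomorphism_comp (X Y Z : topologicalType) (f : X -> Y) (g : Y -> Z) :
  homeomorphism f -> homeomorphism g -> homeomorphism (g \o f).
Proof.
move=> [cf [f' [cf' ff' f'f]]] [cg [g' [cg' gg' g'g]]]; split.
  by move=> x; apply: continuous_comp; [exact: cf|exact: cg].
exists (f' \o g'); split.
- by move=> x; apply: continuous_comp; [exact: cg'|exact: cf'].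
- exact: can_comp.
- exact: can_comp.
Qed.

(** * Reduction to finitely many vertices *)

Section FiniteReduction.
Context {R : realType} {K : simplicial_complex}.

Lemma vertex_point (v : vertex K) : exists y : realization R K,
  forall w, y w = (w == v)%:R.
Proof.
have sv : simplex [fset v]%fset ((fun w => (w == v)%:R) : vertex K -> R).
  split=> [w|w|].
  - by rewrite ler0n.
  - by rewrite inE => /negbTE ->.
  - by rewrite big_seq_fset1 eqxx.
by exists (MkReal (ex_intro2 _ _ _ (face_vertex v) sv)).
Qed.

Lemma bary_exists_gt0 (y : realization R K) : exists v, 0 < y v.
Proof.
have [s _ [y0 _ y1]] := baryP y; apply: contrapT => ny.
have /eqP := y1; rewrite big1 ?(eq_sym 0) ?oner_eq0 // => v _.
apply/eqP; rewrite eq_le y0 andbT leNgt; apply/negP => yv.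
by apply: ny; exists v.
Qed.

(** Finitely many open stars cover, obtained from the near-covering form of compactness with the
    filter of large finite sets. The point at a vertex lies in no open star but its own, so every
    vertex is among them. *)
Lemma compact_finite_vertices : compact [set: realization R K] ->
  exists W : {fset vertex K}, forall v, v \in W.
Proof.
move=> /compact_near_coveringP cK.
pose F : set_system {fset vertex K} :=
  fun P => exists s0 : {fset vertex K}, forall s, (s0 `<=` s)%fset -> P s.
have FF : Filter F.
  split; first by exists fset0.
    move=> P Q [s sP] [t tQ]; exists (s `|` t)%fset => u su; split.
      by apply: sP; exact: fsubset_trans (fsubsetUl _ _) su.
    by apply: tQ; exact: fsubset_trans (fsubsetUr _ _) su.
  by move=> P Q PQ [s sP]; exists s => u /sP /PQ.
have [|W WP] := cK _ F (fun s (y : realization R K) => exists2 w, w \in s & 0 < y w) FF.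
  move=> y _; have [w yw] := bary_exists_gt0 y.
  have yw' : nbhs y [set z : realization R K | 0 < z w].
    apply: open_nbhs_nbhs; split=> //.
    apply: (open_comp (f := fun z : realization R K => z w) _ (@open_gt _ 0)) => z _.
    exact: bary_continuous.
  exists ([set z : realization R K | 0 < z w], [set s : {fset vertex K} | w \in s]).
    split=> //=; exists [fset w]%fset => s /fsubsetP; apply; exact: fset11.
  by move=> [z s] /= [zw ws]; exists w.
exists W => v; have [y yE] := vertex_point v.
have [w wW] := WP W (fsubset_refl W) y I; rewrite yE.
by case: eqP => [<-//|_]; rewrite ltxx.
Qed.

Variable W : {fset vertex K}.
Hypothesis WT : forall v, v \in W.

Let img (s : {set W}) : {fset vertex K} := [fset val x | x in s]%fset.

Let in_img (s : {set W}) (x : W) : (val x \in img s) = (x \in s).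
Proof. by apply/imfsetP/idP => [[y ys /val_inj ->]//|xs]; exists x. Qed.

Definition finite_face (s : {set W}) : bool := `[< face (img s) >].

Fact finite_face1 (v : W) : finite_face (finset.set1 v).
Proof.
apply/asboolP; rewrite (_ : img _ = [fset val v]%fset); first exact: face_vertex.
apply/fsetP => w; rewrite -[w]/(val [` WT w]%fset) in_img !inE.
by apply/eqP/eqP => [->//|/val_inj].
Qed.

Fact finite_face0 : finite_face finset.set0 = false.
Proof.
apply/negP => /asboolP; rewrite (_ : img _ = fset0); first exact: face_nonempty.
by apply/fsetP => w; rewrite -[w]/(val [` WT w]%fset) in_img !inE.
Qed.

Fact finite_faceS (s t : {set W}) :
  finite_face s -> t \subset s -> t != finset.set0 -> finite_face t.
Proof.
move=> /asboolP fs /fintype.subsetP ts /set0Pn[x xt]; apply/asboolP.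
apply: (face_sub fs).
  apply/fsubsetP => w; rewrite -[w]/(val [` WT w]%fset) !in_img; exact: ts.
by apply/fset0Pn; exists (val x); rewrite in_img.
Qed.

Definition finite_complex : fcomplex := FComplex finite_face1 finite_face0 finite_faceS.

Lemma finite_homeomorphism :
  exists g : realization R K -> realization R (sc_of finite_complex),
  homeomorphism g.
Proof.
pose f (y : realization R K) (x : fvert finite_complex) : R := y (val x).
have f0 y x : 0 <= f y x by have [s _ [y0 _ _]] := baryP y; exact: y0.
have f1 y : \sum_x f y x = 1.
  have [s fs [y0 ys <-]] := baryP y; rewrite -(big_seq_fsetE _ _ predT) /=.
  by apply/esym/big_fset_incl; [apply/fsubsetP => v _; exact: WT|move=> x _ /ys].
have ff y : fface (supp (f y)).
  have [s fs [y0 ys y1]] := baryP y; apply/asboolP; apply: (face_sub fs).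
    apply/fsubsetP => w; rewrite -[w]/(val [` WT w]%fset) in_img inE /f.
    by apply: contraNT => /ys ->.
  have [w yw] := bary_exists_gt0 y.
  by apply/fset0Pn; exists w; rewrite -[w]/(val [` WT w]%fset) in_img inE gt_eqF.
pose g y : realization R (sc_of finite_complex) := real_mk (f0 y) (f1 y) (ff y).
pose k0 (z : realization R (sc_of finite_complex)) (v : vertex K) : R :=
  z ([` WT v]%fset : fvert finite_complex).
have k0P z : exists2 s, face s & simplex s (k0 z).
  have /asboolP fz := real_supp z.
  exists (img (supp (z : fvert finite_complex -> R))) => //.
  have zs v : v \notin img (supp (z : fvert finite_complex -> R)) -> k0 z v = 0.
    by rewrite -[v in X in X -> _]/(val [` WT v]%fset) in_img inE negbK => /eqP.
  split=> // [v|]; first exact: real_ge0.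
  rewrite -(real_sum z) (big_fset_incl _ _ (B := W)) /=.
  - rewrite big_seq_fsetE; apply: eq_bigr => x _; rewrite /k0; congr (z _).
    exact: val_inj.
  - by apply/fsubsetP => v _; exact: WT.
  - by move=> v _ /zs.
pose k z := MkReal (k0P z).
exists g; split.
  by apply: continuous_sc => v; exact: bary_continuous.
exists k; split.
- apply: (continuous_bary WT) => v.
  exact: (@bary_continuous R (sc_of finite_complex)).
- by move=> y; apply: bary_inj; apply/funext.
- move=> z; apply: bary_inj; apply/funext => x /=; rewrite /f /k /= /k0; congr (z _).
  exact: val_inj.
Qed.
End FiniteReduction.

Lemma sd_iter (R : realType) (I : Type) (m n : nat) (K : fcomplex)
    (p : fvert K -> I -> R) (D : R) :
  (forall s : {set fvert K}, fface s -> (#|s| <= m.+1)%N) -> mesh_le p D ->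
  exists (K' : fcomplex) (g : realization R (sc_of K) -> realization R (sc_of K'))
    (p' : fvert K' -> I -> R),
    [/\ homeomorphism g, mesh_le p' (D * (m%:R / m.+1%:R) ^+ n) &
      forall x i, \sum_(v : fvert K') g x v * p' v i = \sum_(v : fvert K) x v * p v i].
Proof.
elim: n K p D => [|n IHn] K p D Km pD.
  exists K, id, p; split=> //; last by rewrite expr0 mulr1.
  by split; [|exists id; split] => // x; exact: cvg_id.
have [g hg gE] := @sd_homeomorphism K R.
have IH := IHn (sd K) (sd_pos p) (D * (m%:R / m.+1%:R)) (@sd_card K R m Km) (sd_mesh Km pD).
have [K' [g' [p' [hg' p'D p'E]]]] := IH.
exists K', (g' \o g), p'; split.
- exact: homeomorphism_comp.
- by rewrite exprS mulrA.
- by move=> x i; rewrite /= p'E (sd_pos_sum _ gE).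
Qed.

Lemma exists_geom_lt (R : realType) (q d : R) : 0 <= q < 1 -> 0 < d ->
  exists n, q ^+ n < d.
Proof.
move=> /andP[q0 q1] d0.
have c : (fun n => q ^+ n) @ \oo --> (0 : R) by apply: cvg_expr; rewrite ger0_norm.
have /cvgr_lt /(_ _ d0) [n _ /(_ n (leqnn n)) h] := c.
by exists n.
Qed.

(** [B] carries no metric; differences of barycentric coordinates take the place of distances. *)
Lemma lebesgue_number (R : realType) (K : fcomplex) (B : topologicalType)
    (h : B -> realization R (sc_of K)) (U : B -> set B) :
  compact [set: B] -> homeomorphism h -> (forall b, nbhs b (U b)) ->
  exists2 d : R, 0 < d & forall b, exists b0, forall b',
    (forall v : fvert K, `|h b' v - h b v| < d) -> U b0 b'.
Proof.
move=> /compact_near_coveringP cB [ch [k [ck hk kh]]] nU.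
have cbary v : continuous (fun b => h b (v : fvert K)).
  move=> b; apply: (continuous_comp (g := fun y : realization R (sc_of K) => y v)).
    exact: ch.
  exact: (@bary_continuous R (sc_of K) v).
have WT : forall v : vertex (sc_of K), v \in [fset v in fvert K]%fset.
  by move=> v; rewrite inE.
pose P (d : R) b := exists b0, forall b',
  (forall v : fvert K, `|h b' v - h b v| < d) -> U b0 b'.
have : \forall d \near (0 : R)^'+, [set: B] `<=` P d.
  apply: cB => b _.
  have Ub : nbhs (h b) (k @^-1` (U b)) by apply: ck; rewrite hk.
  have [r r0 rU] := nbhs_bary WT Ub.
  (* Halving [r] leaves room for the triangle inequality from [b'] through [b1] to [b]. *)
  exists ([set b' | forall v : fvert K, `|h b' v - h b v| < r / 2], [set d | d < r / 2]).
    split=> /=; last by apply: nbhs_right_lt; rewrite divr_gt0.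
    apply: filter_forall => v.
    by have /cvgr_distC_lt := cbary v b; apply; rewrite divr_gt0.
  move=> [b1 d] /= [b1b dr]; exists b => b' b'b1.
  rewrite -(hk b'); apply: rU => v.
  rewrite -[h b' v](subrK (h b1 v)) -addrA (le_lt_trans (ler_normD _ _)) //.
  by rewrite (splitr r) ltrD // (lt_trans (b'b1 v)).
move=> dP; have PF : ProperFilter ((0 : R)^'+) by exact: at_right_proper_filter.
have [d [dP' d0]] := @filter_ex _ _ PF _ (filterI dP (nbhs_right_gt (0 : R))).
by exists d => // b; exact: dP'.
Qed.

Lemma triangulable_finite (R : realType) (B : topologicalType) :
  compact [set: B] -> triangulable R B ->
  exists (K : fcomplex) (h : B -> realization R (sc_of K)), homeomorphism h.
Proof.
move=> cB [K [h hh]]; have [ch [k [ck hk kh]]] := hh.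
have cK : compact [set: realization R K].
  have -> : [set: realization R K] = h @` [set: B].
    by apply/seteqP; split=> // y _; exists (k y).
  by apply: continuous_compact => //; exact: continuous_subspaceT.
have [W WT] := compact_finite_vertices cK.
have [g hg] := @finite_homeomorphism R K W WT.
by exists (finite_complex WT), (g \o h); exact: homeomorphism_comp.
Qed.

(** The support of [y] is a face containing [v], and the position of [y] is a convex combination of
    the positions of its vertices. *)
Lemma star_le (R : realType) (I : Type) (K : fcomplex) (p : fvert K -> I -> R) D
    (y : realization R (sc_of K)) (v : fvert K) i :
  mesh_le p D -> 0 < y v -> `|\sum_(w : fvert K) y w * p w i - p v i| <= D.
Proof.
move=> pD yv.
have -> : \sum_(w : fvert K) y w * p w i - p v i =
    \sum_(w : fvert K) y w * (p w i - p v i).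
  under [RHS]eq_bigr do rewrite mulrBr.
  by rewrite sumrB -mulr_suml (real_sum y) mul1r.
rewrite (le_trans (ler_norm_sum _ _ _)) // -[leRHS]mul1r -(real_sum y) mulr_suml.
apply: ler_sum => w _; rewrite normrM (ger0_norm (real_ge0 y w)).
have [->|yw] := eqVneq (y w) 0; first by rewrite !mul0r.
rewrite ler_wpM2l ?real_ge0 //; apply: (pD _ (real_supp y)); rewrite inE //.
by rewrite gt_eqF.
Qed.

Theorem fine_triangulation (R : realType) (B : topologicalType) (U : B -> set B) :
  compact [set: B] -> triangulable R B -> (forall b, nbhs b (U b)) ->
  exists (K : fcomplex) (h : B -> realization R (sc_of K)), homeomorphism h /\
    forall v : fvert K, exists b, closure [set b' | 0 < h b' v] `<=` U b.
Proof.
move=> cB tB nU; have [K [h hh]] := triangulable_finite cB tB.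
have [d d0 dU] := lebesgue_number cB hh nU.
(* The vertices start at the unit vectors, so that the position of a point is its list of
   coordinates in [K] and the initial mesh is 1. The number of vertices crudely bounds the size of a
   face. *)
pose m := #|fvert K|; pose p (v w : fvert K) : R := (v == w)%:R.
have Km (s : {set fvert K}) : fface s -> (#|s| <= m.+1)%N.
  by move=> _; rewrite ltnW // ltnS max_card.
have p1 : mesh_le p 1.
  move=> s _ v w _ _ i; rewrite /p.
  by case: eqP; case: eqP => _ _; rewrite ?subrr ?subr0 ?sub0r ?normrN ?normr1 ?normr0.
have q01 : 0 <= (m%:R / m.+1%:R : R) < 1.
  by rewrite divr_ge0 //= ltr_pdivrMr ?ltr0n // mul1r ltr_nat.
have [n nd] := exists_geom_lt q01 (divr_gt0 d0 (ltr0n R 2)).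
have [K' [g [p' [hg p'D p'E]]]] := sd_iter n Km p1.
have gE b i : \sum_(v : fvert K') g (h b) v * p' v i = h b i.
  rewrite p'E (bigD1 i) //= /p eqxx mulr1 big1 ?addr0 // => v vi.
  by rewrite (negbTE vi) mulr0.
have hgh := homeomorphism_comp hh hg.
exists K', (g \o h); split=> // v.
have [_ [k [_ _ kh]]] := hgh.
have [y yE] := @vertex_point R (sc_of K') v.
(* The Lebesgue ball is centred at the point of [B] over the vertex [v]. The weak bound [d / 2]
   passes to the closure of the star; strictness comes from the bound at the centre. *)
have [b bU] := dU (k y); exists b => b' cb'; apply: bU => i.
have near_v b1 : 0 < g (h b1) v -> `|h b1 i - p' v i| <= d / 2.
  move=> b1v; rewrite -gE (le_trans (star_le i p'D b1v)) // mul1r; exact: ltW.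
have cb : `|h b' i - p' v i| <= d / 2.
  have cl : closed [set b1 | `|h b1 i - p' v i| <= d / 2].
    apply: (closed_comp (f := fun b1 => `|h b1 i - p' v i|) _ (@closed_le _ (d / 2))) => b1 _.
    apply: cvg_norm; apply: cvgB; last exact: cvg_cst.
    apply: (continuous_comp (g := fun y : realization R (sc_of K) => y i)).
      by have [ch _] := hh; exact: ch.
    exact: (@bary_continuous R (sc_of K) i).
  by apply: cl; apply: closureS cb' => b1; exact: near_v.
have cv : `|h (k y) i - p' v i| < d / 2.
  rewrite -gE; have -> : g (h (k y)) = y := kh y.
  rewrite (le_lt_trans (star_le i p'D _)) ?mul1r //.
  by rewrite yE eqxx.
rewrite -[h b' i](subrK (p' v i)) -addrA (le_lt_trans (ler_normD _ _)) //.
by rewrite (splitr d) ler_ltD // distrC.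
Qed.

Lemma cl_choice_exists (R : realType) (K : fcomplex) : inhabited (cl_choice R (sc_of K)).
Proof.
(* The barycentric coordinates do not have closed support in the stars; truncating
   them below a threshold less than [1 / #|fvert K|] does. *)
pose c : R := (#|fvert K|.*2.+1%:R)^-1.
have c0 : 0 < c by rewrite invr_gt0 ltr0n.
pose psi (v : fvert K) (y : realization R (sc_of K)) : R := Num.max 0 (y v - c).
pose tot y : R := \sum_(v : fvert K) psi v y.
have psi0 v y : 0 <= psi v y by rewrite le_max lexx.
have tot0 y : 0 < tot y.
  rewrite lt0r sumr_ge0 ?andbT //; apply/negP => /eqP /psumr_eq0P tot_0.
  have yc (v : fvert K) : y v <= c.
    have := tot_0 (fun v _ => psi0 v y) v isT; rewrite /psi => h.
    have : y v - c <= Num.max 0 (y v - c) by rewrite le_max lexx orbT.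
    by rewrite h subr_le0.
  have : \sum_(v : fvert K) y v <= #|fvert K|%:R * c.
    rewrite mulr_natl -sumr_const; exact: ler_sum.
  rewrite (real_sum y) leNgt ltr_pdivrMr ?ltr0n // mul1r ltr_nat.
  by rewrite ltnS -addnn leq_addr.
have cpsi v : continuous (psi v).
  move=> y; apply: (@continuous_max R _ (fun=> 0)
    (fun y : realization R (sc_of K) => y v - c)).
    exact: cst_continuous.
  by apply: (cvgB (@bary_continuous R (sc_of K) v y)); exact: cvg_cst.
have ctot : continuous tot by apply: continuous_rsum => v _; exact: cpsi.
have phiP : subordinate_partition (fun (v : vertex (sc_of K)) y => psi v y / tot y).
  split.
  - move=> v y; apply: (cvgM (cpsi v y)).
    by apply: (cvgV _ (ctot y)); rewrite gt_eqF.
  - by move=> v y; rewrite divr_ge0 // ltW.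
  - move=> y; exists setT; first exact: filterT.
    exact: (@finite_finset (fvert K)).
  - move=> y; rewrite (@fsbig_finType _ (fvert K)) -mulr_suml divff // gt_eqF //.
    exact: tot0.
  - move=> v y cy; apply: (@lt_le_trans _ _ c) => //.
    have cl : closed [set y : realization R (sc_of K) | c <= y v].
      apply: (closed_comp (f := fun y : realization R (sc_of K) => y v) _
        (@closed_ge _ c)) => z _.
      exact: (@bary_continuous R (sc_of K) v).
    apply: cl; apply: closureS cy => z /=; rewrite /psi.
    case: (leP 0 (z v - c)) => [|/ltW h]; first by rewrite subr_ge0.
    by rewrite mul0r eqxx.
constructor.
apply: (@ClChoice R (sc_of K) _ (fun v : fvert K => (enum_rank v).+1) phiP) => //.
by move=> v w [] /val_inj /enum_rank_inj.
Qed.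

(** * Bundle maps into trivial bundles *)

Section Selectors.
Context {R : realType} (N d : nat).

(** Left multiplication by [sel o] places a block of [d] rows at row [o]. Free offsets allow for
    gaps between blocks, which an arbitrary [iota] produces. *)
Definition sel (o : nat) : 'M[R]_(N, d) := \matrix_(a, k) ((a : nat) == o + k)%N%:R.

Lemma sel_mulE m o (X : 'M[R]_(d, m)) a l :
  (sel o *m X) a l = \sum_(k < d | (a : nat) == (o + k)%N) X k l.
Proof.
rewrite mxE [RHS]big_mkcond; apply: eq_bigr => k _.
by rewrite mxE; case: ifP; rewrite ?mul1r ?mul0r.
Qed.

Lemma sel_tr_mul o o' : (forall k k' : 'I_d, (o + k == o' + k')%N -> False) ->
  (sel o)^T *m sel o' = 0.
Proof.
move=> oo'; apply/matrixP => k k'; rewrite !mxE big1 // => a _; rewrite !mxE.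
case: eqP => [->|_]; last by rewrite mul0r.
by case: eqP => [/eqP/oo'|_]; rewrite ?mulr0.
Qed.

Lemma sel_tr_mul1 o : (o + d <= N)%N -> (sel o)^T *m sel o = 1%:M.
Proof.
move=> oN; apply/matrixP => k k'; rewrite !mxE.
have ok : (o + k < N)%N by rewrite (leq_trans _ oN) // ltn_add2l.
rewrite (bigD1 (Ordinal ok)) //= !mxE eqxx mul1r eqn_add2l big1 ?addr0 // => a ak.
rewrite !mxE; case: eqP => [ao|_]; last by rewrite mul0r.
by move/eqP: ak; case; exact: val_inj.
Qed.

Context (T : finType) (o : T -> nat).
Hypothesis o_inj : forall j j' (k k' : 'I_d), (o j + k == o j' + k')%N -> j = j'.
Hypothesis o_le : forall j, (o j + d <= N)%N.

(** Used with weights 1 for the embedding of [E], and with weights [sqrt phi_j] for [cl_Phi] and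
    [cl_lift]. *)
Definition stack m (a : T -> R) (X : T -> 'M[R]_(d, m)) : 'M[R]_(N, m) :=
  \sum_j a j *: (sel (o j) *m X j).

Lemma stack_mul m p a b (X : T -> 'M[R]_(d, m)) (Y : T -> 'M[R]_(d, p)) :
  (stack a X)^T *m stack b Y = \sum_j (a j * b j) *: ((X j)^T *m Y j).
Proof.
rewrite /stack [X in X *m _]linear_sum mulmx_suml; apply: eq_bigr => j _.
rewrite mulmx_sumr (bigD1 j) //= big1 ?addr0 => [|i ij].
  rewrite [(_ *: _)^T]linearZ /= -scalemxAl -scalemxAr scalerA trmx_mul mulmxA.
  by rewrite -(mulmxA (X j)^T) sel_tr_mul1 // mulmx1.
rewrite [(_ *: _)^T]linearZ /= -scalemxAl -scalemxAr trmx_mul mulmxA -(mulmxA (X j)^T).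
rewrite sel_tr_mul ?mulmx0 ?mul0mx ?scaler0 // => k k' /o_inj ji.
by rewrite ji eqxx in ij.
Qed.

Lemma sel_tr_stack m a (X : T -> 'M[R]_(d, m)) j :
  (sel (o j))^T *m stack a X = a j *: X j.
Proof.
rewrite /stack mulmx_sumr (bigD1 j) //= big1 ?addr0 => [|i ij].
  by rewrite -scalemxAr mulmxA sel_tr_mul1 // mul1mx.
rewrite -scalemxAr mulmxA sel_tr_mul ?mul0mx ?scaler0 // => k k' /o_inj ji.
by rewrite ji eqxx in ij.
Qed.

Lemma stack_mulr m p a (X : T -> 'M[R]_(d, m)) (Y : 'M[R]_(m, p)) :
  stack a X *m Y = stack a (fun j => X j *m Y).
Proof.
rewrite /stack mulmx_suml; apply: eq_bigr => j _.
by rewrite -scalemxAl mulmxA.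
Qed.

Lemma stackB m a (X Y : T -> 'M[R]_(d, m)) :
  stack a X - stack a Y = stack a (fun j => X j - Y j).
Proof.
by rewrite /stack -sumrB; apply: eq_bigr => j _; rewrite -scalerBr mulmxBr.
Qed.

(** The blocks are disjoint, so the squared norm is the average of the squared block norms with
    weights [phi j]. *)
Lemma frob_stack m (phi : T -> R) c (X : T -> 'M[R]_(d, m)) :
  (forall j, 0 <= phi j) -> \sum_j phi j = 1 -> 0 <= c ->
  (forall j, phi j != 0 -> frobenius (X j) <= c) ->
  frobenius (stack (fun j => Num.sqrt (phi j)) X) <= c.
Proof.
move=> phi0 phi1 c0 Xc; rewrite -(@ler_pXn2r _ 2) ?nnegrE ?frob_ge0 //.
rewrite frob_sqr /fip stack_mul raddf_sum /=.
rewrite -[leRHS]mul1r -phi1 mulr_suml; apply: ler_sum => j _.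
rewrite mxtraceZ -expr2 sqr_sqrtr // -/(fip (X j) (X j)) -frob_sqr.
have [->|pj] := eqVneq (phi j) 0; first by rewrite !mul0r.
by rewrite ler_wpM2l // lerXn2r ?nnegrE ?frob_ge0 // Xc.
Qed.
End Selectors.

(** * Local frames of a bundle and their projections *)

Section LocalFrames.
Context {R : realType}.

Lemma gram_unitmx n d (M : 'M[R]_(n, d)) :
  (forall u : 'cV[R]_d, M *m u = 0 -> u = 0) -> M^T *m M \in unitmx.
Proof.
move=> M0; rewrite -row_free_unit -kermx_eq0; apply/eqP/row_matrixP => i.
rewrite row0; set r := row i _.
have rM : r *m (M^T *m M) = 0 by rewrite /r -row_mul mulmx_ker row0.
apply: trmx_inj; rewrite trmx0; apply: M0; apply: fip_eq0.
rewrite fip_mull mulmxA /fip trmxK.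
have -> : M^T *m M *m r^T = 0.
  by apply: trmx_inj; rewrite !trmx_mul !trmxK trmx0.
by rewrite mulmx0 mxtrace0.
Qed.

(** The Moore-Penrose inverse when the columns are independent: [M *m left_inv M] is the orthogonal
    projection onto the column space, and it varies continuously with [M]. *)
Definition left_inv n d (M : 'M[R]_(n, d)) : 'M[R]_(d, n) := invmx (M^T *m M) *m M^T.

Lemma left_invK n d (M : 'M[R]_(n, d)) : M^T *m M \in unitmx -> left_inv M *m M = 1%:M.
Proof. by move=> uM; rewrite /left_inv -mulmxA mulVmx. Qed.

Lemma Grn_left_inv n d (M : 'M[R]_(n, d)) : M^T *m M \in unitmx -> Grn d (M *m left_inv M).
Proof.
move=> uM; apply/Grn_traceP; split.
- rewrite /left_inv !trmx_mul trmxK trmx_inv trmx_mul trmxK mulmxA.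
  by [].
- by rewrite -mulmxA (mulmxA (left_inv M)) left_invK // mul1mx.
- by rewrite mxtrace_mulC left_invK // mxtrace1.
Qed.

(** If [P] fixes the columns of [M], its inner product with [M *m left_inv M] is the trace [d], so
    their distance vanishes. *)
Lemma Grn_fix_eq n d (M : 'M[R]_(n, d)) (P : 'M[R]_n) : M^T *m M \in unitmx ->
  Grn d P -> P *m M = M -> P = M *m left_inv M.
Proof.
move=> uM GP PM; have GM := Grn_left_inv uM.
apply/eqP; rewrite -subr_eq0; apply/eqP/frob_eq0/eqP; rewrite -sqrf_eq0.
have [PT _ _] := GP; have /Grn_traceP[_ _ tM] := GM.
by rewrite (Grn_fip GP GM) /fip PT mulmxA PM tM subrr mulr0.
Qed.

Lemma cvg_left_inv (T : Type) (F : set_system T) {FF : Filter F} n d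
    (f : T -> 'M[R]_(n, d)) (M : 'M[R]_(n, d)) : M^T *m M \in unitmx ->
  f x @[x --> F] --> M -> left_inv (f x) @[x --> F] --> left_inv M.
Proof.
move=> uM fM; apply: cvg_mulmx; last exact: cvg_trmx.
by apply: cvg_invmx => //; apply: cvg_mulmx => //; exact: cvg_trmx.
Qed.

Context {B : topologicalType}.

(** The second component of a bundle monomorphism from [E] to the trivial bundle [B * R^n]. *)
Definition fmono (E : vfamily R B) n (G : total_space E -> 'cV[R]_n) :=
  [/\ continuous G,
      forall b, linear (fun w : fiber E b => G (fiber_incl w)) &
      forall x x', bundle_proj x = bundle_proj x' -> G x = G x' -> x = x'].

Section Frame.
Context (E : vfamily R B) (d n : nat) (G : total_space E -> 'cV[R]_n).
Hypothesis mG : fmono G.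
Context (U : set B) (t : B * 'cV[R]_d -> total_space E) (c : total_space E -> 'cV[R]_d).
Hypothesis oU : open U.
Hypothesis tE : local_trivialization U t c.

(** The fibrewise linear clause of a trivialization places [t (b, u)] in the image of [fiber_incl]
    over [b]. *)
Lemma triv_proj b u : U b -> bundle_proj (t (b, u)) = b.
Proof.
move=> Ub; have [_ _ _ _ /(_ b Ub)[L ->]] := tE.
by have [+ _ _] := fiber_incl_bij E b; apply.
Qed.

Lemma triv_continuous b u : U b -> {for (b, u), continuous t}.
Proof.
move=> Ub; have [ct _ _ _ _] := tE.
have oW : open (U `*` [set: 'cV[R]_d]).
  rewrite (_ : _ `*` _ = fst @^-1` U); last by apply/seteqP; split=> p // [].
  by apply: open_comp oU => p _; exact: cvg_fst.
by move: ct; rewrite continuous_open_subspace // => /(_ (b, u)); apply; rewrite inE.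
Qed.

Definition frame (b : B) : 'M[R]_(n, d) :=
  \matrix_(i, k) G (t (b, delta_mx k ord0)) i ord0.

Lemma frameE b u : U b -> frame b *m u = G (t (b, u)).
Proof.
move=> Ub; have [_ _ _ _ /(_ b Ub)[L tL]] := tE; have [_ linG _] := mG.
have linGL : linear (fun u => G (t (b, u))).
  by move=> a u1 u2; rewrite !tL linearP linG.
pose GL : {linear 'cV[R]_d -> 'cV[R]_n} := HB.pack (fun u => G (t (b, u)))
  (GRing.isLinear.Build _ _ _ _ (fun u => G (t (b, u))) linGL).
rewrite -[RHS]/(GL u) [in RHS](matrix_sum_delta u) linear_sum.
apply/matrixP => i j; rewrite ord1 mxE summxE; apply: eq_bigr => k _.
by rewrite big_ord1 linearZ /= !mxE mulrC.
Qed.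

Lemma frame_unit b : U b -> (frame b)^T *m frame b \in unitmx.
Proof.
move=> Ub; apply: gram_unitmx => u; rewrite frameE // => Gu.
have [_ _ ct _ _] := tE; rewrite -(ct b u Ub) -(ct b 0 Ub); congr c.
have [_ _ injG] := mG; apply: injG; first by rewrite !triv_proj.
by rewrite Gu -frameE // mulmx0.
Qed.

Lemma frame_continuous b : U b -> {for b, continuous frame}.
Proof.
move=> Ub; apply: (@cvg_mx _ _ (nbhs b) _ _ _ frame) => i k; rewrite mxE.
under eq_cvg do rewrite mxE.
apply: (@cvg_entry _ _ (nbhs b) _ _ (fun b => G (t (b, delta_mx k ord0)))).
have [cG _ _] := mG.
apply: (continuous_comp (f := fun b => t (b, delta_mx k ord0)) (g := G)); last exact: cG.
apply: (@continuous_comp B (B * 'cV[R]_d)%type _ 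
  (fun b => (b, delta_mx k ord0)) t); last first.
  exact: triv_continuous.
have cp : continuous (fun b0 : B => (b0, delta_mx k ord0 : 'cV[R]_d)).
  by apply: continuous_pair => x; [exact: cvg_id|exact: cvg_cst].
exact: cp.
Qed.
End Frame.
End LocalFrames.

(** * Embedding into a trivial bundle *)

Section Embedding.
Context {R : realType} {B : topologicalType}.

Lemma triv_linear (E : vfamily R B) d (U : set B) (t : B * 'cV[R]_d -> total_space E)
    (c : total_space E -> 'cV[R]_d) b :
  local_trivialization U t c -> U b -> linear (fun w : fiber E b => c (fiber_incl w)).
Proof.
move=> [_ _ ct tc tL] Ub; have [L LE] := tL b Ub.
have [incl_proj incl_inj _] := fiber_incl_bij E b.
have Lc w : L (c (fiber_incl w)) = w.
  apply: incl_inj; rewrite ?inE // -LE.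
  have pw : bundle_proj (fiber_incl w) = b := incl_proj w I.
  by rewrite -{1}pw tc // pw.
by move=> a w w'; rewrite -[w in LHS]Lc -[w' in LHS]Lc -linearP -LE ct.
Qed.

(** Barycentric coordinates act as a partition of unity: their supports, the closed stars, lie in
    trivializing sets. The local coordinates [c v], so weighted, are stacked; a vertex of positive
    weight recovers the point. *)
Lemma bundle_embedding d (E : vbundle R B d) :
  compact [set: B] -> triangulable R B ->
  exists n (G : total_space E -> 'cV[R]_n), fmono G.
Proof.
move=> cB tB.
have [U0 U0P] := choice (fun b => vbundle_trivial E b).
have nU0 b : nbhs b (U0 b).
  by have [t [c [oU Ub _]]] := U0P b; exact: open_nbhs_nbhs.
have [K [h [hh sU0]]] := fine_triangulation cB tB nU0.
have [bv bvP] := choice sU0.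
pose U v := U0 (bv v).
have triv v : exists tc : (B * 'cV[R]_d -> total_space E) * (total_space E -> 'cV[R]_d),
    open (U v) /\ local_trivialization (U v) tc.1 tc.2.
  by have [t [c [oU _ tr]]] := U0P (bv v); exists (t, c).
have [tc tcP] := choice triv.
pose c v := (tc v).2.
have hU v b : h b v != 0 -> U v b.
  move=> hb; apply: bvP; apply: subset_closure => /=.
  by rewrite lt0r hb (real_ge0 (h b) v).
pose o (v : fvert K) : nat := (d * enum_rank v)%N.
pose n := (d * #|fvert K|)%N.
have o_inj j j' (k k' : 'I_d) : (o j + k == o j' + k')%N -> j = j'.
  move=> /eqP jk; apply: enum_rank_inj; apply: val_inj => /=.
  have d0 : (0 < d)%N by exact: leq_ltn_trans (leq0n k) (ltn_ord k).
  have := congr1 (fun z => z %/ d)%N jk; rewrite /o !(mulnC d) !divnMDl //.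
  by rewrite !divn_small // !addn0.
have o_le j : (o j + d <= n)%N by rewrite /o /n -mulnSr leq_mul2l ltn_ord orbT.
pose g v (x : total_space E) : 'cV[R]_d := h (bundle_proj x) v *: c v x.
pose G (x : total_space E) : 'cV[R]_n := \sum_v sel n d (o v) *m g v x.
have GE x : G x = stack n o (fun=> 1) (fun v => g v x).
  by rewrite /stack; apply: eq_bigr => v _; rewrite scale1r.
have ch : continuous h by have [] := hh.
have chv v : continuous (fun x : total_space E => h (bundle_proj x) v).
  move=> x; apply: (continuous_comp (g := fun y : realization R (sc_of K) => y v)).
    by apply: continuous_comp; [exact: bundle_proj_continuous|exact: ch].
  exact: (@bary_continuous R (sc_of K) v).
have cg v : continuous (g v).
  move=> x; have [oU [_ cc _ _ _]] := tcP v.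
  have [Ux|Ux] := pselect (U v (bundle_proj x)).
    apply: (@cvg_scalemx _ _ (nbhs x) _ _ _ _ _ _ _ (chv v x)).
    have opU : open (@bundle_proj R B E @^-1` U v).
      by apply: open_comp oU => y _; exact: bundle_proj_continuous.
    by move: cc; rewrite continuous_open_subspace // => /(_ x); apply; rewrite inE.
  (* Off [U v] the map [c v] is arbitrary and may be discontinuous; there the weight vanishes on a
     whole neighbourhood, the complement of the closed star. *)
  have gx : g v x = 0.
    by rewrite /g; have [->|/hU//] := eqVneq (h (bundle_proj x) v) 0; rewrite scale0r.
  have : nbhs (bundle_proj x) (~` closure [set b' | 0 < h b' v]).
    apply: open_nbhs_nbhs; split; first by apply: closed_openC; exact: closed_closure.
    by move=> /bvP.
  move=> /(@bundle_proj_continuous R B E x) nx'.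
  have nx : nbhs x (@bundle_proj R B E @^-1` (~` closure [set b' | 0 < h b' v])) by exact: nx'.
  rewrite /continuous_at gx.
  have c0 : (fun=> 0 : 'cV[R]_d) @ nbhs x --> (0 : 'cV[R]_d) by exact: cvg_cst.
  apply: cvg_trans c0; apply: near_eq_cvg; apply: filterS nx => x' ncx'.
  rewrite /g; have [->|hx'] := eqVneq (h (bundle_proj x') v) 0; first by rewrite scale0r.
  case: ncx'; apply: subset_closure => /=.
  by rewrite lt0r hx' (real_ge0 (h (bundle_proj x')) v).
have cG : continuous G.
  move=> x; apply: (@cvg_mxsum _ _ (nbhs x) _ _ _ _ _ _
    (fun v x => sel n d (o v) *m g v x)) => v _.
  apply: (@cvg_mulmx _ _ (nbhs x) _ _ _ _ (fun=> sel n d (o v)) (g v)); first exact: cvg_cst.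
  exact: cg.
exists n, G; split=> //.
- move=> b a w w'; rewrite /G scaler_sumr -big_split; apply: eq_bigr => v _ /=.
  rewrite scalemxAr -mulmxDr; congr (_ *m _); rewrite /g.
  have [hw hw' hww'] : [/\ bundle_proj (fiber_incl w) = b,
      bundle_proj (fiber_incl w') = b & bundle_proj (fiber_incl (a *: w + w')) = b].
    by have [ip _ _] := fiber_incl_bij E b; split; exact: ip.
  rewrite hw hw' hww'; have [->|/hU Ub] := eqVneq (h b v) 0.
    by rewrite !scale0r scaler0 addr0.
  have -> : c v (fiber_incl (a *: w + w')) = a *: c v (fiber_incl w) + c v (fiber_incl w').
    exact: triv_linear (tcP v).2 Ub a w w'.
  by rewrite scalerDr !scalerA mulrC.
- move=> x x' xx' Gxx'.
  have [v hv] := bary_exists_gt0 (h (bundle_proj x)).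
  have := congr1 (mulmx (sel n d (o v))^T) Gxx'.
  rewrite !GE !sel_tr_stack // !scale1r /g -xx' => /scalerI.
  rewrite gt_eqF // => /(_ isT) cxx'.
  have Ux : U v (bundle_proj x) by apply: hU; rewrite gt_eqF.
  have [_ [_ _ _ tc_ _]] := tcP v.
  rewrite -(tc_ x Ux) -(tc_ x') -?xx' //.
  by rewrite /c in cxx'; rewrite cxx'.
Qed.

(** The projections are chosen pointwise, but [Grn_fix_eq] identifies them with the continuous local
    formula in terms of any frame. *)
Lemma image_projection d (E : vbundle R B d) n (G : total_space E -> 'cV[R]_n) :
  fmono G -> exists F : B -> 'M[R]_n, [/\ continuous F, forall b, Grn d (F b) &
    forall x, F (bundle_proj x) *m G x = G x].
Proof.
move=> mG.
have loc b : exists P : 'M[R]_n, Grn d P /\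
    forall x, bundle_proj x = b -> P *m G x = G x.
  have [U [t [c [oU Ub tE]]]] := vbundle_trivial E b.
  have uM := frame_unit mG tE Ub; exists (frame G t b *m left_inv (frame G t b)).
  split; first exact: Grn_left_inv.
  move=> x xb; have [_ _ _ tc _] := tE; rewrite -(tc x) xb // -(frameE mG tE) //.
  by rewrite mulmxA -(mulmxA (frame G t b)) left_invK // mulmx1.
have [F FP] := choice loc; exists F; split=> [b|b|x]; last 2 first.
- by have [] := FP b.
- by have [_] := FP (bundle_proj x); apply.
have [U [t [c [oU Ub tE]]]] := vbundle_trivial E b.
have FE b' : U b' -> F b' = frame G t b' *m left_inv (frame G t b').
  move=> Ub'; have [GF Ffix] := FP b'; apply: (Grn_fix_eq (frame_unit mG tE Ub') GF).
  apply/matrixP => i k.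
  have := Ffix (t (b', delta_mx k ord0)) (triv_proj tE _ Ub').
  rewrite -(frameE mG tE) // mulmxA => /matrixP/(_ i ord0).
  by rewrite -!colE !mxE => ->.
have cM := frame_continuous mG oU tE Ub.
have c0 : frame G t b' *m left_inv (frame G t b') @[b' --> b] --> F b.
  rewrite FE //; apply: (@cvg_mulmx _ _ (nbhs b) _ _ _ _ _ _ _ _ cM).
  exact: cvg_left_inv (frame_unit mG tE Ub) cM.
apply: cvg_trans c0; apply: near_eq_cvg.
by apply: filterS (open_nbhs_nbhs (conj oU Ub)) => b' /FE.
Qed.
End Embedding.

(** * Image bundles *)

Section ImageBundle.
Context {R : realType}.

Lemma cvg_pairT (X : Type) (F : set_system X) {FF : Filter F} (Y Z : topologicalType)
    (f : X -> Y) (g : X -> Z) (a : Y) (b : Z) :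
  f x @[x --> F] --> a -> g x @[x --> F] --> b -> (f x, g x) @[x --> F] --> (a, b).
Proof. by move=> fa gb; exact: (cvg_pair fa gb). Qed.

Definition trunc_vec N (z : Rinf R) : 'cV[R]_N := \col_(i < N) z i.

Lemma pad_vecK N : cancel (@pad_vec R N) (@trunc_vec N).
Proof. by move=> x; apply/matrixP => i j; rewrite ord1 mxE pad_vecE. Qed.

Lemma trunc_vec_linear N : linear (@trunc_vec N).
Proof. by move=> a x y; apply/matrixP => i j; rewrite !mxE. Qed.

Lemma Rinf_coord_continuous a : continuous (fun z : Rinf R => z a).
Proof.
apply: final_continuous => n x; have [an|na] := ltnP a n.
  rewrite (_ : _ \o _ = fun x : 'cV[R]_n => x (Ordinal an) ord0); last first.
    by apply/funext => y; exact: (pad_vecE y (Ordinal an)).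
  exact: coord_continuous.
rewrite (_ : _ \o _ = fun=> 0); last by apply/funext => y; exact: pad_vec_out.
exact: cst_continuous.
Qed.

Lemma trunc_vec_continuous N : continuous (@trunc_vec N).
Proof.
move=> z; apply: (@cvg_mx _ _ (nbhs z) _ _ _ (@trunc_vec N)) => i j; rewrite mxE.
under eq_cvg do rewrite mxE.
exact: Rinf_coord_continuous.
Qed.

Lemma pad_vec_continuous N : continuous (@pad_vec R N : 'cV[R]_N -> Rinf R).
Proof. exact: (@final_inj_continuous _ _ _ (@pad_vec R) N). Qed.

Lemma image_inf_pad N (P : 'M[R]_N) (z : Rinf R) :
  z \in image_inf (pad_mx P) <-> exists u : 'cV[R]_N, z = pad_vec (P *m u).
Proof.
have sumE (w : Rinf R) a : \sum_(b \in [set: nat]) pad_mx P (a, b) * w b =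
    pad_vec (P *m trunc_vec N w) a.
  rewrite (@fsbig_nat_ord _ N) => [|b nb]; last first.
    by rewrite pad_mx_out ?mul0r // negb_and -!leqNgt nb orbT.
  have [aN|Na] := ltnP a N.
    rewrite (pad_vecE _ (Ordinal aN)) mxE; apply: eq_bigr => b _.
    by rewrite (pad_mxE P (Ordinal aN) b) mxE.
  rewrite pad_vec_out // big1 // => b _; rewrite pad_mx_out ?mul0r //.
  by rewrite negb_and -!leqNgt Na.
split=> [|[u ->]]; rewrite inE /=.
  move=> [w zw]; exists (trunc_vec N w); apply: fsarray_ext => a.
  by rewrite zw sumE.
by exists (pad_vec u) => a; rewrite sumE pad_vecK.
Qed.

Context {B : topologicalType}.

(** The fibres of [E] and the ranges of [P] both have dimension [d], so the monomorphism [Th] is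
    onto the image bundle, and [left_inv] of a local frame inverts it. *)
Lemma image_family_viso d (E : vbundle R B d) (f : B -> Gr R d) N
    (P : B -> 'M[R]_N) (Th : total_space E -> 'cV[R]_N) :
  fmono Th -> (forall b, Grn d (P b)) -> (forall b, Gr_val (f b) = pad_mx (P b)) ->
  (forall x, P (bundle_proj x) *m Th x = Th x) -> viso (image_family f) E.
Proof.
move=> mTh GP fP PTh; have [cTh linTh injTh] := mTh.
have mem_image b z : z \in image_inf (f b) <-> exists u : 'cV[R]_N, z = pad_vec (P b *m u).
  by rewrite fP; exact: image_inf_pad.
have image_fix b z : z \in image_inf (f b) ->
    z = pad_vec (trunc_vec N z) /\ P b *m trunc_vec N z = trunc_vec N z.
  move=> /mem_image[u ->]; rewrite pad_vecK; split=> //.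
  by have [_ PP _] := GP b; rewrite mulmxA PP.
have loc b U (t : B * 'cV[R]_d -> total_space E) c :
    U b -> local_trivialization U t c -> forall z : 'cV[R]_N,
    P b *m z = z -> Th (t (b, left_inv (frame Th t b) *m z)) = z.
  move=> Ub tE z Pz.
  have PE : P b = frame Th t b *m left_inv (frame Th t b).
    have uM := frame_unit mTh tE Ub.
    apply: (Grn_fix_eq uM (GP b)); apply/matrixP => i k.
    have := PTh (t (b, delta_mx k ord0)); rewrite (triv_proj tE _ Ub).
    rewrite -(frameE mTh tE) // mulmxA => /matrixP/(_ i ord0).
    by rewrite -!colE !mxE => ->.
  by rewrite -(frameE mTh tE) // mulmxA -PE Pz.
have exF (p : image_total f) : exists x : total_space E,
    bundle_proj x = (val p).1 /\ Th x = trunc_vec N (val p).2.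
  have [_ Pz] := image_fix _ _ (set_mem (valP p)).
  have [U [t [c [oU Ub tE]]]] := vbundle_trivial E (val p).1.
  exists (t ((val p).1, left_inv (frame Th t (val p).1) *m trunc_vec N (val p).2)).
  split; first by rewrite (triv_proj tE _ Ub).
  exact: (loc _ _ _ _ Ub tE).
have [F FP] := choice exF.
have memk x : (bundle_proj x, pad_vec (Th x)) \in image_total f.
  by rewrite inE; apply/mem_image; exists (Th x); rewrite PTh.
pose k (x : total_space E) : image_total f := exist _ (bundle_proj x, pad_vec (Th x)) (memk x).
have kF p : k (F p) = p.
  apply: val_inj => /=; have [-> ->] := FP p.
  have [<- _] := image_fix _ _ (set_mem (valP p)).
  exact/esym/surjective_pairing.
have Fk x : F (k x) = x.
  by have [px Tx] := FP (k x); apply: injTh; rewrite ?px ?Tx //= pad_vecK.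
have ck : continuous k.
  apply: (@continuous_comp_initial _ _ _ set_val) => x.
  apply: (@continuous_pair _ _ _ (@bundle_proj R B E) (fun x => pad_vec (Th x) : Rinf R)).
    exact: bundle_proj_continuous.
  move=> {}x; apply: continuous_comp; [exact: cTh|exact: pad_vec_continuous].
(* [F] comes from a choice; injectivity of [Th] forces it to agree locally with the continuous map
   [t \o g]. *)
have cF : continuous F.
  move=> p; have [U [t [c [oU Ub tE]]]] := vbundle_trivial E (val p).1.
  have cval : continuous (val : image_total f -> B * Rinf R) by exact: initial_continuous.
  pose b_ (q : image_total f) : B := (val q).1.
  pose z_ (q : image_total f) : 'cV[R]_N := trunc_vec N (val q).2.
  have cb : continuous b_.
    move=> q; apply: (@continuous_comp (image_total f) (B * Rinf R)%type B val fst).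
      exact: cval.
    exact: cvg_fst.
  have cz : continuous z_.
    move=> q; apply: (@continuous_comp (image_total f) (Rinf R) _
      (fun p => (val p).2) (@trunc_vec N)).
      apply: (@continuous_comp (image_total f) (B * Rinf R)%type (Rinf R) val snd).
        exact: cval.
      exact: cvg_snd.
    exact: trunc_vec_continuous.
  pose g q : B * 'cV[R]_d := (b_ q, left_inv (frame Th t (b_ q)) *m z_ q).
  have FE q : U (b_ q) -> F q = t (g q).
    move=> Uq; have [pq Tq] := FP q; apply: injTh.
      by rewrite (triv_proj tE _ Uq).
    rewrite Tq (loc _ _ _ _ Uq tE) //.
    by have [] := image_fix _ _ (set_mem (valP q)).
  have cM : frame Th t (b_ q) @[q --> p] --> frame Th t (b_ p).
    exact: (cvg_comp _ _ (cb p) (frame_continuous mTh oU tE Ub)).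
  pose u_ q : 'cV[R]_d := left_inv (frame Th t (b_ q)) *m z_ q.
  have cu : u_ q @[q --> p] --> u_ p.
    exact: (cvg_mulmx (cvg_left_inv (frame_unit mTh tE Ub) cM) (cz p)).
  have cg : g q @[q --> p] --> g p.
    exact: (@cvg_pairT _ (nbhs p) _ B 'cV[R]_d b_ u_ _ _ (cb p) cu).
  have ct : t (g q) @[q --> p] --> F p.
    by rewrite FE //; exact: (cvg_comp _ _ cg (triv_continuous oU tE Ub)).
  have nU : \forall q \near p, U (b_ q) by apply: cb; exact: open_nbhs_nbhs.
  have e : \forall q \near p, t (g q) = F q.
    by apply: filterS nU => q Uq; rewrite FE.
  exact: cvg_trans (near_eq_cvg e) ct.
exists F; split; first by split=> //; exists k; split.
move=> b; have [incl_proj incl_inj incl_surj] := fiber_incl_bij E b.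
have exL (v : image_space (f b)) : exists w : fiber E b,
    fiber_incl w = F (image_incl v).
  have [pv _] := FP (image_incl v).
  by have [w _ wE] := incl_surj (F (image_incl v)) pv; exists w.
have [L LE] := choice exL.
have ThL v : Th (fiber_incl (L v)) = trunc_vec N (image_vec v).
  by rewrite LE; have [_] := FP (image_incl v).
have linL : linear L.
  move=> a v w; apply: incl_inj; rewrite ?inE //; apply: injTh.
    by rewrite !(incl_proj _ I).
  by rewrite linTh !ThL -trunc_vec_linear.
pose LL : {linear fiber (image_family f) b -> fiber E b} :=
  HB.pack L (GRing.isLinear.Build _ _ _ _ L linL).
by exists LL => v; rewrite /= LE.
Qed.
End ImageBundle.

(** * The classifying matrix *)

Section ClassifyingMatrix.
Context {R : realType} (K : fcomplex) (d : nat) (ch : cl_choice R (sc_of K)).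
Hypothesis d_gt0 : (0 < d)%N.
Local Notation V := (fvert K).
Variable Om : V -> V -> 'M[R]_d.
Local Notation phi := (cl_phi ch).

(* Rows are counted from 0 here and from 1 in [cl_frame]. *)
Definition cl_offset (j : V) : nat := (d * cl_iota ch j).-1.
(** A crude number of rows: each summand alone already bounds the end of the block of its vertex. *)
Definition cl_size : nat := (\sum_(j : V) (d * cl_iota ch j + d))%N.

Lemma cl_offsetS j : (cl_offset j).+1 = (d * cl_iota ch j)%N.
Proof. by rewrite prednK // muln_gt0 d_gt0 cl_iota_gt0. Qed.

Lemma cl_offset_inj j j' (k k' : 'I_d) :
  (cl_offset j + k == cl_offset j' + k')%N -> j = j'.
Proof.
rewrite -eqSS -!addSn !cl_offsetS => /eqP jk; apply: (@cl_iota_inj _ _ ch).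
have := congr1 (fun z => z %/ d)%N jk; rewrite !(mulnC d) !divnMDl //.
by rewrite !divn_small // !addn0.
Qed.

Lemma cl_offset_le j : (cl_offset j + d <= cl_size)%N.
Proof.
rewrite /cl_size (bigD1 j) //= (leq_trans _ (leq_addr _ _)) // leq_add2r.
exact: leq_pred.
Qed.

Definition cl_Phi (i : V) (y : realization R (sc_of K)) : 'M[R]_(cl_size, d) :=
  stack cl_size cl_offset (fun j => Num.sqrt (phi j y)) (fun j => (Om i j)^T).

Definition cl_mx (y : realization R (sc_of K)) : 'M[R]_cl_size :=
  \sum_(i : V) phi i y *: (cl_Phi i y *m (cl_Phi i y)^T).

Lemma cl_frameE i y (a : 'I_cl_size) l : cl_frame ch Om i y a.+1 l = cl_Phi i y a l.
Proof.
rewrite /cl_frame fsbig_finType /cl_Phi /stack summxE; apply: eq_bigr => j _.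
rewrite mxE sel_mulE mulr_sumr; apply: eq_bigl => k.
by rewrite -cl_offsetS addSn eqSS.
Qed.

Lemma cl_frame_out i y a l : (cl_size <= a)%N -> cl_frame ch Om i y a.+1 l = 0.
Proof.
move=> Na; rewrite /cl_frame fsbig_finType big1 // => j _; rewrite big1 // => k /eqP ak.
have := cl_offset_le j; rewrite leqNgt => /negP[].
rewrite (leq_ltn_trans Na) // -ltnS ak -cl_offsetS addSn ltnS ltn_add2l.
exact: ltn_ord.
Qed.

Lemma cl_map_pad y p : cl_map ch Om y p = pad_mx (cl_mx y) p.
Proof.
case: p => a b; rewrite /cl_map fsbig_finType -[(a, b).1]/a -[(a, b).2]/b.
have [/andP[aN bN]|abN] := boolP ((a < cl_size) && (b < cl_size))%N.
  have -> : pad_mx (cl_mx y) (a, b) = cl_mx y (Ordinal aN) (Ordinal bN).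
    exact: (pad_mxE (cl_mx y) (Ordinal aN) (Ordinal bN)).
  rewrite summxE; apply: eq_bigr => i _.
  rewrite !mxE; congr (_ * _); apply: eq_bigr => l _.
  by rewrite (cl_frameE i y (Ordinal aN)) (cl_frameE i y (Ordinal bN)) [_^T _ _]mxE.
rewrite pad_mx_out // big1 // => i _.
rewrite big1 ?mulr0 // => l _.
by move: abN; rewrite negb_and -!leqNgt => /orP[/cl_frame_out->|/cl_frame_out->];
  rewrite ?mul0r ?mulr0.
Qed.

Lemma phi_ge0 j y : 0 <= phi j y.
Proof. by have [_ + _ _ _] := cl_phiP ch; apply. Qed.

Lemma phi_sum y : \sum_(j : V) phi j y = 1.
Proof. by have [_ _ _ + _] := cl_phiP ch; move=> /(_ y); rewrite fsbig_finType. Qed.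

Lemma phi_star j y : phi j y != 0 -> 0 < y j.
Proof.
by move=> pj; have [_ _ _ _ /(_ j) st] := cl_phiP ch; apply: st; exact: subset_closure.
Qed.

Lemma phi_continuous j : continuous (phi j).
Proof. by have [+ _ _ _ _] := cl_phiP ch; apply. Qed.

Lemma sqrt_phi_continuous j : continuous (fun y => Num.sqrt (phi j y)).
Proof.
move=> y; apply: (continuous_comp (f := phi j) (g := @Num.sqrt R)).
  exact: phi_continuous.
exact: sqrt_continuous.
Qed.

Lemma stack_phi_continuous m (X : V -> 'M[R]_(d, m)) :
  continuous (fun y => stack cl_size cl_offset (fun j => Num.sqrt (phi j y)) X).
Proof.
move=> y; apply: (@cvg_mxsum _ _ (nbhs y) _ _ _ _ _ _
  (fun j y => Num.sqrt (phi j y) *: (sel cl_size d (cl_offset j) *m X j))) => j _.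
apply: (@cvg_scalemx _ _ (nbhs y) _ _ _ (fun y => Num.sqrt (phi j y)) (fun=> _)).
  exact: sqrt_phi_continuous.
exact: cvg_cst.
Qed.

Lemma cl_mx_continuous : continuous cl_mx.
Proof.
move=> y; apply: (@cvg_mxsum _ _ (nbhs y) _ _ _ _ _ _
  (fun i y => phi i y *: (cl_Phi i y *m (cl_Phi i y)^T))) => i _.
apply: (@cvg_scalemx _ _ (nbhs y) _ _ _ (phi i)); first exact: phi_continuous.
have cP : cl_Phi i z @[z --> y] --> cl_Phi i y by exact: stack_phi_continuous.
exact: (cvg_mulmx cP (cvg_trmx cP)).
Qed.

Section Estimates.
Variables (y : realization R (sc_of K)) (e : R).
Hypothesis e0 : 0 <= e.
Hypothesis Om_orth : forall i j, 0 < y i -> 0 < y j ->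
  (Om i j)^T *m Om i j = 1%:M /\ Om i j = (Om j i)^T.
Hypothesis Om_cocycle : forall i j k, 0 < y i -> 0 < y j -> 0 < y k ->
  frobenius (Om i j *m Om j k - Om i k) <= e.

Lemma stack_phi_isom m (X : V -> 'M[R]_(d, m)) :
  (forall j, 0 < y j -> (X j)^T *m X j = 1%:M) ->
  let S := stack cl_size cl_offset (fun j => Num.sqrt (phi j y)) X in
  S^T *m S = 1%:M.
Proof.
move=> X1 /=; rewrite (stack_mul cl_offset_inj cl_offset_le).
rewrite -[RHS]scale1r -[X in _ = X *: _](phi_sum y) scaler_suml; apply: eq_bigr => j _.
rewrite -expr2 sqr_sqrtr ?phi_ge0 //.
have [->|/phi_star yj] := eqVneq (phi j y) 0; first by rewrite !scale0r.
by rewrite X1.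
Qed.

Lemma Om_orthr i j : 0 < y i -> 0 < y j -> Om i j *m (Om i j)^T = 1%:M.
Proof. by move=> yi yj; apply: mulmx1C; have [] := Om_orth yi yj. Qed.

Lemma cl_Phi_isom i : 0 < y i -> (cl_Phi i y)^T *m cl_Phi i y = 1%:M.
Proof.
by move=> yi; apply: stack_phi_isom => j yj; rewrite trmxK Om_orthr.
Qed.

(** Right multiplication by [Om i k] leaves [Phi_i Phi_i^T] unchanged and aligns the two frames:
    their blocks then differ by [Om j k - Om j i *m Om i k], a cocycle defect, and [frame_dist]
    applies. *)
Lemma cl_Phi_near i k : 0 < y i -> 0 < y k ->
  frobenius (cl_Phi k y *m (cl_Phi k y)^T - cl_Phi i y *m (cl_Phi i y)^T)
    <= Num.sqrt 2 * e.
Proof.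
move=> yi yk; set O := Om i k.
have OO : O *m O^T = 1%:M := Om_orthr yi yk.
have -> : cl_Phi i y *m (cl_Phi i y)^T = (cl_Phi i y *m O) *m (cl_Phi i y *m O)^T.
  by rewrite trmx_mul mulmxA -(mulmxA (cl_Phi i y)) OO mulmx1.
have isoO : (cl_Phi i y *m O)^T *m (cl_Phi i y *m O) = 1%:M.
  rewrite trmx_mul mulmxA -(mulmxA O^T) cl_Phi_isom // mulmx1.
  by have [] := Om_orth yi yk.
apply: (le_trans (frame_dist (cl_Phi_isom yk) isoO)).
rewrite ler_wpM2l ?sqrtr_ge0 // /cl_Phi stack_mulr stackB.
apply: (frob_stack cl_offset_inj cl_offset_le) => // [j||j /phi_star yj].
- exact: phi_ge0.
- exact: phi_sum.
- have [_ <-] := Om_orth yj yk; have [_ <-] := Om_orth yj yi.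
  by rewrite frob_distC; exact: Om_cocycle.
Qed.

Lemma cl_mx_near i : 0 < y i ->
  frobenius (cl_mx y - cl_Phi i y *m (cl_Phi i y)^T) <= Num.sqrt 2 * e.
Proof.
move=> yi; set Q := _ *m _^T.
have {1}-> : Q = \sum_(k : V) phi k y *: Q by rewrite -scaler_suml phi_sum scale1r.
rewrite /cl_mx -sumrB (le_trans (frob_sum _ _ _)) //.
rewrite -[leRHS]mul1r -[X in _ <= X * _](phi_sum y) mulr_suml.
apply: ler_sum => k _; rewrite -scalerBr frobZ ger0_norm ?phi_ge0 //.
have [->|/phi_star yk] := eqVneq (phi k y) 0; first by rewrite !mul0r.
by rewrite ler_wpM2l ?phi_ge0 // cl_Phi_near.
Qed.
End Estimates.
End ClassifyingMatrix.

(** * Cocycles of nearby projections *)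

(** Gives the vertices of a face a common point in their open stars, through which nearby values of
    [F] are compared. *)
Lemma face_interior (R : realType) (K : fcomplex) (s : {set fvert K}) : fface s ->
  exists y : realization R (sc_of K), forall v : fvert K, v \in s -> 0 < y v.
Proof.
move=> fs; have s0 : 0 < #|s|%:R :> R.
  by rewrite ltr0n card_gt0; apply/negP => /eqP s0; move: fs; rewrite s0 fface0.
pose x (v : fvert K) : R := if v \in s then #|s|%:R^-1 else 0.
have x0 v : 0 <= x v by rewrite /x; case: ifP; rewrite ?invr_ge0 ?(ltW s0).
have x1 : \sum_v x v = 1.
  rewrite /x -big_mkcond sumr_const -[X in X = 1]mulr_natl divff //.
  by rewrite gt_eqF.
have fx : fface (supp x).
  rewrite (_ : supp x = s) //; apply/finset.setP => v; rewrite inE /x.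
  by case: ifP; rewrite ?eqxx // invr_eq0 gt_eqF.
by exists (real_mk x0 x1 fx) => v vs; rewrite /= /x vs invr_gt0.
Qed.

Section ApproximateCocycle.
Context {R : realType} (T : finType) (n d : nat) (V : T -> 'M[R]_(n, d))
  (adj : T -> T -> Prop).
Hypothesis VV : forall i, (V i)^T *m V i = 1%:M.
Hypothesis adjC : forall i j, adj i j -> adj j i.
Variables (e0 eta zeta : R).
Hypothesis zeta0 : 0 < zeta.
Hypothesis near_orth : forall C : 'M[R]_d, frobenius (C^T *m C - 1%:M) < e0 ->
  exists2 Q : 'M[R]_d, Q^T *m Q = 1%:M & frobenius (Q - C) < zeta.
Hypothesis eta_e0 : eta <= e0.
Hypothesis V_near : forall i j, adj i j ->
  frobenius (V i *m (V i)^T - V j *m (V j)^T) < eta.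

Lemma orthogonal_transitions : exists Om : T -> T -> 'M[R]_d,
  (forall i, Om i i = 1%:M) /\
  forall i j, adj i j -> [/\ (Om i j)^T *m Om i j = 1%:M, Om i j = (Om j i)^T &
    frobenius (Om i j - (V i)^T *m V j) < zeta].
Proof.
have exQ (ij : T * T) : exists Q : 'M[R]_d, adj ij.1 ij.2 ->
    Q^T *m Q = 1%:M /\ frobenius (Q - (V ij.1)^T *m V ij.2) < zeta.
  have [aij|naij] := pselect (adj ij.1 ij.2); last by exists 0 => /naij.
  set C := (V ij.1)^T *m V ij.2.
  have [|Q QQ QC] := near_orth (C := C); last by exists Q.
  apply: lt_le_trans eta_e0; apply: le_lt_trans (V_near aij).
  (* Near-orthogonality of [C] is closeness of the two projections, compressed by the isometry
     [V j]. *)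
  have -> : C^T *m C - 1%:M = (V ij.2)^T *m
      (V ij.1 *m (V ij.1)^T - V ij.2 *m (V ij.2)^T) *m V ij.2.
    rewrite mulmxBr mulmxBl /C trmx_mul trmxK !mulmxA VV mul1mx VV.
    by [].
  apply: le_trans (frob_coisomr _ (VV _)) _; exact: frob_coisom.
have [Q QP] := choice exQ.
(* One orientation of each pair is chosen and the other defined as its transpose, so that
   [Om i j = (Om j i)^T] holds exactly. *)
pose Om i j : 'M[R]_d := if i == j then 1%:M else
  if (enum_rank i < enum_rank j)%N then Q (i, j) else (Q (j, i))^T.
exists Om; split=> [i|i j aij]; first by rewrite /Om eqxx.
rewrite /Om (eq_sym j); case: eqVneq => [<-|ij].
  by rewrite trmx1 mulmx1 VV subrr frob0.
have [ltij|ltji|eij] := ltngtP (enum_rank i) (enum_rank j).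
- by have [QQ Qn] := QP (i, j) aij; rewrite trmxK.
- have [QQ Qn] := QP (j, i) (adjC aij); rewrite trmxK; split=> //.
    exact: mulmx1C.
  rewrite -frobT linearB /= trmxK trmx_mul trmxK.
  exact: Qn.
- by move/eqP: ij; case; apply: enum_rank_inj; exact: val_inj.
Qed.

(** Each of the three replacements of [V_i^T V_j] by [Om i j] costs [zeta]; the unmodified
    transitions have defect [V_i^T (V_j V_j^T - V_i V_i^T) V_k], which costs [eta]. *)
Lemma transitions_defect (Om : T -> T -> 'M[R]_d) i j k :
  (forall i j, adj i j -> [/\ (Om i j)^T *m Om i j = 1%:M, Om i j = (Om j i)^T &
    frobenius (Om i j - (V i)^T *m V j) < zeta]) ->
  adj i j -> adj j k -> adj i k ->
  frobenius (Om i j *m Om j k - Om i k) <= 3 * zeta + eta.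
Proof.
move=> OmP aij ajk aik.
have [_ _ nij] := OmP _ _ aij; have [Ojk _ njk] := OmP _ _ ajk.
have [_ _ nik] := OmP _ _ aik.
set C := fun i j => (V i)^T *m V j.
have -> : Om i j *m Om j k - Om i k = (Om i j - C i j) *m Om j k +
   C i j *m (Om j k - C j k) + (V i)^T *m (V j *m (V j)^T - V i *m (V i)^T) *m V k
   - (Om i k - C i k).
  have -> : (V i)^T *m (V j *m (V j)^T - V i *m (V i)^T) *m V k = C i j *m C j k - C i k.
    by rewrite mulmxBr mulmxBl /C !mulmxA VV mul1mx.
  rewrite mulmxBl mulmxBr; move: (Om i j *m _) (C i j *m _) (C i j *m _) => a b c.
  by rewrite opprB !addrA subrK subrK subrK.
have h1 : frobenius ((Om i j - C i j) *m Om j k) < zeta.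
  rewrite -[Om j k]trmxK frob_isomr // trmxK; exact: mulmx1C.
have h2 : frobenius (C i j *m (Om j k - C j k)) < zeta.
  rewrite /C -mulmxA; apply: le_lt_trans (frob_coisom _ (VV _)) _.
  by rewrite frob_isom.
have h3 : frobenius ((V i)^T *m (V j *m (V j)^T - V i *m (V i)^T) *m V k) < eta.
  apply: le_lt_trans (frob_coisomr _ (VV _)) _.
  apply: le_lt_trans (frob_coisom _ (VV _)) _.
  by rewrite frob_distC; exact: V_near.
have h4 := frob_triangle ((Om i j - C i j) *m Om j k) (C i j *m (Om j k - C j k)).
set M1 := _ *m Om j k in h1 h4 *; set M2 := C i j *m _ in h2 h4 *.
set M3 := _ *m V k in h3 *.
have h5 := frob_triangle (M1 + M2) M3.
have h6 := frob_triangle (M1 + M2 + M3) (- (Om i k - C i k)).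
rewrite frobN in h6; apply: (le_trans h6); rewrite -/(C i k) in nik; lra.
Qed.
End ApproximateCocycle.

(** * Injectivity of the comparison map *)

Section Injectivity.
Context {R : realType} (K : fcomplex) (n d : nat) (ch : cl_choice R (sc_of K)).
Hypothesis d_gt0 : (0 < d)%N.
Local Notation W := (fvert K).
Variables (V : W -> 'M[R]_(n, d)) (Om : W -> W -> 'M[R]_d).
Hypothesis VV : forall i, (V i)^T *m V i = 1%:M.
Variables (y : realization R (sc_of K)) (F : 'M[R]_n) (P : 'M[R]_(cl_size d ch)) (e : R).
Hypothesis e_le : e <= 1 / 10.
Hypothesis Om_orth : forall i j, 0 < y i -> 0 < y j ->
  (Om i j)^T *m Om i j = 1%:M /\ Om i j = (Om j i)^T.
Hypothesis Om_near : forall i j, 0 < y i -> 0 < y j ->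
  frobenius (Om i j - (V i)^T *m V j) <= e / 8.
Hypothesis Om_cocycle : forall i j k, 0 < y i -> 0 < y j -> 0 < y k ->
  frobenius (Om i j *m Om j k - Om i k) <= e / 2.
Hypothesis F_near : forall i, 0 < y i -> frobenius (F - V i *m (V i)^T) <= e / 8.
Hypothesis P_near : nearest d (cl_mx ch Om y) P.

Definition cl_lift : 'M[R]_(cl_size d ch, n) :=
  stack (cl_size d ch) (cl_offset d ch) (fun j => Num.sqrt (cl_phi ch j y)) (fun j => (V j)^T).

(* On the image of [F], [cl_lift] is close to [Phi_i V_i^T], an isometry onto the
   image of [Phi_i Phi_i^T], which in turn is close to [P]. *)
Lemma cl_lift_inj (z : 'cV[R]_n) : F *m z = z -> P *m (cl_lift *m z) = 0 -> z = 0.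
Proof.
move=> Fz PTz; have e0 : 0 <= e.
  have [i yi] := bary_exists_gt0 y.
  have := le_trans (frob_ge0 _) (F_near yi); lra.
have [i yi] := bary_exists_gt0 y.
set Phi := cl_Phi ch Om i y; set w := (V i)^T *m z.
have PhiI : Phi^T *m Phi = 1%:M by exact: cl_Phi_isom.
have GPhi := frame_Grn PhiI.
have Anear : frobenius (cl_mx ch Om y - Phi *m Phi^T) <= Num.sqrt 2 * (e / 2).
  by apply: cl_mx_near => //; rewrite divr_ge0.
(* The classifying matrix is within [sqrt 2 * e / 2] of [Phi *m Phi^T], and of [P] because [P] is
   nearest; [sqrt 2 <= 3 / 2] and [e <= 1 / 10] give [15 / 100]. *)
have PPhi : frobenius (Phi *m Phi^T - P) <= 15 / 100.
  apply: le_trans (frobB_triangle _ (cl_mx ch Om y) _) _.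
  have h1 : frobenius (Phi *m Phi^T - cl_mx ch Om y) <= Num.sqrt 2 * (e / 2).
    by rewrite frob_distC.
  have h2 := le_trans (P_near.2 _ GPhi) Anear.
  have s2 : Num.sqrt 2 <= 3 / 2 :> R.
    rewrite -(@ler_pXn2r _ 2) ?nnegrE ?sqrtr_ge0 // ?divr_ge0 // sqr_sqrtr //; lra.
  have s3 : Num.sqrt 2 * (e / 2) <= 3 / 2 * (e / 2) by rewrite ler_wpM2r // divr_ge0.
  apply: le_trans (lerD h1 h2) _; apply: le_trans (lerD s3 s3) _.
  have : forall x : R, x <= 1 / 10 ->
    3 / 2 * (x / 2) + 3 / 2 * (x / 2) <= 15 / 100 by move=> x; lra.
  exact.
have FiF : frobenius (z - V i *m w) <= e / 8 * frobenius z.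
  rewrite /w mulmxA -{1}Fz -mulmxBl (le_trans (frob_mul _ _)) //.
  by rewrite ler_wpM2r ?frob_ge0 // F_near.
have wz : (1 - e / 8) * frobenius z <= frobenius w.
  rewrite -(frob_isom w (VV i)).
  have := frobB_ge z (V i *m w); lra.
have wz' : frobenius w <= frobenius z by exact: frob_coisom.
(* Blockwise, one [e / 8] comes from replacing [z] by [V i *m w] and the other from replacing
   [(V j)^T *m V i] by [Om j i]. *)
have TPhi : frobenius (Phi *m w - cl_lift *m z) <= e / 4 * frobenius z.
  rewrite frob_distC /Phi /cl_Phi /cl_lift !stack_mulr stackB.
  apply: (frob_stack (cl_offset_inj d_gt0) (@cl_offset_le _ _ d ch)) => [j|||j /phi_star yj].
  - exact: phi_ge0.
  - exact: phi_sum.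
  - by rewrite mulr_ge0 ?frob_ge0 // divr_ge0.
  have [_ <-] := Om_orth yj yi.
  have -> : (V j)^T *m z - Om j i *m w =
     (V j)^T *m (z - V i *m w) - (Om j i - (V j)^T *m V i) *m w.
    by rewrite mulmxBr mulmxBl (mulmxA (V j)^T (V i) w) opprB addrA subrK.
  apply: le_trans (frob_triangle _ _) _; rewrite frobN.
  have h1 := le_trans (frob_coisom (z - V i *m w) (VV j)) FiF.
  have h2 := le_trans (frob_mul (Om j i - (V j)^T *m V i) w)
    (ler_pM (frob_ge0 _) (frob_ge0 _) (Om_near yj yi) wz').
  lra.
(* The term [P *m (cl_lift *m z)] vanishes by assumption, so taking norms bounds [w] too tightly for
   the lower bound [wz] unless [z = 0]. *)
have Phiw : Phi *m w = (Phi *m Phi^T - P) *m (Phi *m w) + P *m (Phi *m w - cl_lift *m z).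
  rewrite mulmxBl mulmxBr PTz subr0 subrK -(mulmxA Phi Phi^T).
  by rewrite (mulmxA Phi^T Phi w) PhiI mul1mx.
have [PT PP _] := P_near.1.
have h : frobenius w <= 15 / 100 * frobenius w + e / 4 * frobenius z.
  rewrite -{1}(frob_isom w PhiI) Phiw.
  apply: le_trans (frob_triangle _ _) _; apply: lerD.
    apply: le_trans (frob_mul _ _) _; rewrite frob_isom //.
    by rewrite ler_wpM2r ?frob_ge0.
  exact: le_trans (frob_proj _ PT PP) TPhi.
apply: frob_eq0; apply/eqP; rewrite eq_le frob_ge0 andbT.
have key (a b : R) : a <= 15 / 100 * a + e / 4 * b -> (1 - e / 8) * b <= a ->
    e * b <= 1 / 10 * b -> b <= 0.
  by move=> h1 h2 h3; lra.
by apply: (key _ _ h wz); rewrite ler_wpM2r ?frob_ge0.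
Qed.
End Injectivity.

(** * The main theorem *)

(** Two maps into the thickening with entries [cl_map] are equal, so [cl] is the class of one
    explicit map. *)
Lemma cl_hclass (R : realType) (K : fcomplex) (d : nat) (e : R)
    (ch : cl_choice R (sc_of K)) (Om : fvert K -> fvert K -> 'M[R]_d) : (0 < d)%N ->
  (forall y : realization R (sc_of K),
    pad_mx (cl_mx ch Om y) \in thickening d (Num.sqrt 2 * e)) ->
  exists f : realization R (sc_of K) -> thickening d (Num.sqrt 2 * e),
    [/\ continuous f, forall y, val (f y) = pad_mx (cl_mx ch Om y) &
      cl e ch Om = hclass R f].
Proof.
move=> d0 thick.
pose f y : thickening d (Num.sqrt 2 * e) :=
  exist (fun x => x \in thickening d (Num.sqrt 2 * e)) _ (thick y).
have cf : continuous f.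
  apply: (@continuous_comp_initial _ _ _ set_val) => y.
  apply: (continuous_comp (f := cl_mx ch Om)
    (g := @pad_mx R (cl_size d ch) : 'M[R]_(cl_size d ch) -> Minf R)).
    exact: cl_mx_continuous.
  exact: (@final_inj_continuous _ _ _ (@pad_mx R) (cl_size d ch)).
exists f; split=> //; apply/seteqP; split=> [g [f' [cf' f'E hg]]|g hg].
  suff -> : f = f' by [].
  apply/funext => y; apply: val_inj; apply: fsarray_ext => p.
  by rewrite f'E /= cl_map_pad.
by exists f; split=> // y p; rewrite /= cl_map_pad.
Qed.

Lemma fset_finset_mem (V : finType) (s : {fset V}) (v : V) : (v \in fset_finset s) = (v \in s).
Proof. by rewrite inE. Qed.

Unset Implicit Arguments.

Theorem proposition5p7 (R : realType) (B : topologicalType)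
    (compactB : compact [set: B]) (triangB : triangulable R B)
    (d : nat) (d_ge1 : (1 <= d)%N) (E : vbundle R B d)
    (eps : R) (eps_gt0 : 0 < eps) (eps_le : eps <= 3 / 8) :
  exists (K : simplicial_complex) (h : B -> realization R K)
      (Om : vertex K -> vertex K -> 'M[R]_d),
    [/\ triangulation h, DZ1 K d eps Om, inhabited (cl_choice R K) &
      forall ch : cl_choice R K,
        represents
          (hpull R h (hpush R (closest d (Num.sqrt 2 * eps)) (cl eps ch Om)))
          E].
Proof.
have [n [G mG]] := bundle_embedding E compactB triangB.
have [F [cF GF FG]] := image_projection mG.
(* An [e]-approximate cocycle is also an [eps]-approximate one; the bound [1 / 10] is what
   [cl_lift_inj] needs. *)
pose e : R := Num.min eps (1 / 10).
have e0 : 0 < e by rewrite lt_min eps_gt0 divr_gt0.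
have e_eps : e <= eps by rewrite ge_min lexx.
have e_10 : e <= 1 / 10 by rewrite ge_min lexx orbT.
have z0 : 0 < e / 8 by rewrite divr_gt0.
have [e1 e1_0 near_orth] := near_orthogonal d z0.
(* [eta <= e1] makes the transitions orthogonalisable with error [e / 8]; [eta <= e / 8] brings the
   defect [3 * (e / 8) + eta] down to [e / 2], which is strictly below [eps]. *)
pose eta : R := Num.min e1 (e / 8).
have eta0 : 0 < eta by rewrite lt_min e1_0.
have eta_e1 : eta <= e1 by rewrite ge_min lexx.
have eta_e : eta <= e / 8 by rewrite ge_min lexx orbT.
have q0 : 0 < eta / 4 by rewrite divr_gt0.
have nF b : nbhs b [set b' | frobenius (F b' - F b) < eta / 4].
  exact: (cF b _ (frob_nbhs (F b) q0)).
have [K [h [hh small]]] := fine_triangulation compactB triangB nF.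
have [ch0 [k [_ hk kh]]] := hh.
(* Two comparisons with [F b] give [eta / 2] within one star; adjacent vertices are compared through
   a common point of their stars, which doubles this to [eta]. *)
have star_near (v : fvert K) b1 b2 : 0 < h b1 v -> 0 < h b2 v ->
    frobenius (F b1 - F b2) < eta / 2.
  have [b bU] := small v; move=> hb1 hb2.
  have n1 : frobenius (F b1 - F b) < eta / 4 :=
    bU _ (@subset_closure _ [set b' | 0 < h b' v] b1 hb1).
  have n2 : frobenius (F b2 - F b) < eta / 4 :=
    bU _ (@subset_closure _ [set b' | 0 < h b' v] b2 hb2).
  apply: le_lt_trans (frobB_triangle _ (F b) _) _; rewrite (frob_distC (F b)).
  lra.
have [pt ptE] := choice (@vertex_point R (sc_of K)).
pose bv (v : fvert K) := k (pt v).
have bvv (v : fvert K) : 0 < h (bv v) v by rewrite /bv kh ptE eqxx.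
have [V VP] := choice (fun v : fvert K => Grn_frame (GF (bv v))).
have VV v : (V v)^T *m V v = 1%:M by have [] := VP v.
have VVF v : V v *m (V v)^T = F (bv v) by have [] := VP v.
(* [DZ1] speaks of faces and the estimates of points [y]; membership in a common face serves both,
   through [face_interior] and [real_supp]. *)
pose adj i j := exists2 s : {set fvert K}, fface s & (i \in s) && (j \in s).
have adjC i j : adj i j -> adj j i by move=> [s fs /andP[? ?]]; exists s => //; apply/andP.
have V_near i j : adj i j -> frobenius (V i *m (V i)^T - V j *m (V j)^T) < eta.
  move=> [s fs /andP[si sj]]; rewrite !VVF.
  have [y ys] := face_interior R fs.
  have n1 := star_near i (bv i) (k y) (bvv i).
  have n2 := star_near j (k y) (bv j).
  rewrite kh in n1 n2; have {}n1 := n1 (ys _ si); have {}n2 := n2 (ys _ sj) (bvv j).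
  apply: le_lt_trans (frobB_triangle _ (F (k y)) _) _; lra.
have [Om [Om1 OmP]] := orthogonal_transitions VV adjC z0 near_orth eta_e1 V_near.
have star_adj (y : realization R (sc_of K)) (i j : fvert K) : 0 < y i -> 0 < y j -> adj i j.
  move=> yi yj; exists (supp (y : fvert K -> R)); first exact: real_supp.
  by rewrite !inE !gt_eqF.
have defect i j l : adj i j -> adj j l -> adj i l ->
    frobenius (Om i j *m Om j l - Om i l) <= e / 2.
  move=> aij ajl ail.
  have := transitions_defect VV V_near OmP aij ajl ail; lra.
exists (sc_of K), h, Om; split=> //.
- split=> // [i j fij|i j l fijl].
    have aij : adj i j.
      by exists (fset_finset [fset i; j]%fset) => //; rewrite !fset_finset_mem !inE !eqxx orbT.
    by have [] := OmP _ _ aij.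
  have a_of a b : a \in [fset i; j; l]%fset -> b \in [fset i; j; l]%fset -> adj a b.
    move=> ha hb; exists (fset_finset [fset i; j; l]%fset) => //.
    by rewrite !fset_finset_mem ha.
  have [mi mj ml] : [/\ i \in [fset i; j; l]%fset, j \in [fset i; j; l]%fset &
      l \in [fset i; j; l]%fset] by rewrite !inE !eqxx !orbT.
  have de := defect i j l (a_of _ _ mi mj) (a_of _ _ mj ml) (a_of _ _ mi ml).
  by apply: le_lt_trans de _; lra.
- exact: cl_choice_exists.
move=> ch.
have Om_orth (y : realization R (sc_of K)) (i j : fvert K) : 0 < y i -> 0 < y j ->
    (Om i j)^T *m Om i j = 1%:M /\ Om i j = (Om j i)^T.
  by move=> yi yj; have [] := OmP _ _ (star_adj _ _ _ yi yj).
have Om_coc (y : realization R (sc_of K)) (i j l : fvert K) : 0 < y i -> 0 < y j -> 0 < y l ->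
    frobenius (Om i j *m Om j l - Om i l) <= e / 2.
  by move=> yi yj yl; apply: defect; exact: (star_adj y).
have e20 : 0 <= e / 2 by rewrite divr_ge0 // ltW.
have thick (y : realization R (sc_of K)) :
    pad_mx (cl_mx ch Om y) \in thickening d (Num.sqrt 2 * eps).
  have [i yi] := bary_exists_gt0 y.
  have PI := cl_Phi_isom ch d_ge1 (@Om_orth y) yi.
  have [P PE] := Gr_stageE (frame_Grn PI).
  rewrite inE; exists P; rewrite PE pad_mxB frobenius_inf_pad.
  apply: le_lt_trans (cl_mx_near ch d_ge1 e20 (@Om_orth y) (@Om_coc y) yi) _.
  rewrite ltr_pM2l ?sqrtr_gt0 //; lra.
have [f [cf fE ->]] := cl_hclass d_ge1 thick.
(* The left side is [2 * eps]: this is the condition [eps <= 3 / 8]. *)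
have s34 : Num.sqrt 2 * eps * Num.sqrt 2 <= 3 / 4.
  rewrite mulrAC -expr2 sqr_sqrtr //; lra.
have cc := closest_continuous s34 (d := d).
pose f0 := closest d (Num.sqrt 2 * eps) \o f \o h.
exists f0; split.
- move=> b; apply: continuous_comp; first exact: ch0.
  by apply: continuous_comp; [exact: cf|exact: cc].
- exact: hpull_hpush.
have exP b := closest_stage s34 (fE (h b)).
have exP' b : exists Pb : 'M[R]_(cl_size d ch), [/\ nearest d (cl_mx ch Om (h b)) Pb,
    frobenius (cl_mx ch Om (h b) - Pb) < Num.sqrt 2 * eps & Gr_val (f0 b) = pad_mx Pb].
  by have [Pb nP [AP cP]] := exP b; exists Pb.
have [P PP] := choice exP'.
have GP b : Grn d (P b) by have [[]] := PP b.
have cA : continuous (fun b => cl_mx ch Om (h b)).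
  move=> b; apply: (continuous_comp (f := h) (g := cl_mx ch Om)); first exact: ch0.
  exact: cl_mx_continuous.
have cP : continuous P.
  move=> b S /nbhs_frob[r r0 rS]; have r4 : 0 < r / 4 by rewrite divr_gt0.
  have nA : \forall b' \near b, frobenius (cl_mx ch Om (h b') - cl_mx ch Om (h b)) < r / 4.
    exact: (cA b _ (frob_nbhs _ r4)).
  apply: filterS nA => b' Ab'.
  have [nP AP _] := PP b; have [nP' AP' _] := PP b'.
  apply: rS; apply: le_lt_trans (nearest_lipschitz nP' (ltW AP') nP (ltW AP) s34) _.
  by rewrite mulrC -ltr_pdivlMr.
(* [cl_lift] sends [G x] only near the range of [P]; the outer factor [P] moves it into the range,
   at the price of having to prove injectivity again. *)
pose Th (x : total_space E) : 'cV[R]_(cl_size d ch) :=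
  P (bundle_proj x) *m (cl_lift ch V (h (bundle_proj x)) *m G x).
apply: (@image_family_viso R B d E f0 _ P Th) => //.
- split.
  + move=> x.
    have cb : bundle_proj x' @[x' --> x] --> bundle_proj x :=
      @bundle_proj_continuous R B E x.
    have cPx : P (bundle_proj x') @[x' --> x] --> P (bundle_proj x) := cvg_comp _ _ cb (cP _).
    have cT : cl_lift ch V (h (bundle_proj x')) @[x' --> x] -->
        cl_lift ch V (h (bundle_proj x)).
      have chx : h (bundle_proj x') @[x' --> x] --> h (bundle_proj x) :=
        cvg_comp _ _ cb (ch0 _).
      exact: (cvg_comp _ _ chx (@stack_phi_continuous R K d ch n _ _)).
    have [cG _ _] := mG.
    exact: (cvg_mulmx cPx (cvg_mulmx cT (cG x))).
  + move=> b a w w'; have [_ linG _] := mG; rewrite /Th.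
    have [ip _ _] := fiber_incl_bij E b.
    have [-> -> ->] : [/\ bundle_proj (fiber_incl w) = b, bundle_proj (fiber_incl w') = b &
        bundle_proj (fiber_incl (a *: w + w')) = b] by split; exact: ip.
    have -> := linG b a w w'.
    by rewrite !mulmxDr -!scalemxAr.
  + move=> x x' xx'; rewrite /Th -xx' => TT.
    have [_ linG injG] := mG; apply: injG => //.
    (* By linearity [cl_lift_inj] is applied to [G x - G x'], which [F b] fixes and the lifted
       projection kills. *)
    apply/eqP; rewrite -subr_eq0; apply/eqP.
    set b := bundle_proj x in xx' TT *.
    apply: (cl_lift_inj d_ge1 VV e_10 (@Om_orth (h b)) _ (@Om_coc (h b)) (F := F b)
        (P := P b) (V := V)).
    * move=> i j yi yj; have [_ _ /ltW] := OmP _ _ (star_adj _ _ _ yi yj).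
      by [].
    * move=> i yi; rewrite VVF; have /ltW h1 := star_near i b (bv i) yi (bvv i).
      apply: le_trans h1 _; lra.
    * by have [] := PP b.
    * by rewrite mulmxBr FG xx' FG.
    * by rewrite !mulmxBr TT subrr.
- by move=> b; have [] := PP b.
- move=> x; rewrite /Th mulmxA; have [_ -> _] := GP (bundle_proj x).
  by [].
Qed.
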